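(* Let $1<p<\infty$. Suppose that $(w,v)\in W_p$, with exponent $\beta$. Let $T$ be a singular integral operator $Tf(x)=\mathrm{p.v.}\int_{\mathbb{R}^n}k(x,y)f(y)\,dy$ of weak-type $(1,1)$ such that for some $c>0$ $$|k(x,y)-k(x',y)|\le c\,\frac{1}{|x-y|^n}\,\omega\Big(\frac{|x-x'|}{|x-y|}\Big)$$ whenever $x,x'\in Q$ and $y\in(2Q)^c$ for any cube $Q$, where $\omega$ is a nondecreasing function on $(0,\infty)$ with $\int_0^1\omega(c_n\tau)\frac{d\tau}{\tau}<\infty$. Let $s,t$ be such that $0<s\le1/2$, $1/2<t<1-s$ and $2^p\big(\frac{s}{1-t}\big)^\beta<1$. Then if $f$ has support contained in a cube $Q_0$, $$\int_{Q_0}|Tf(x)-m_{Tf}(t,Q_0)|^p\,w(x)\,dx\le c\int_{Q_0}|f(x)|^p\,v(x)\,dx.$$ Furthermore, if $m_{Tf}(t,Q_0)\to0$ as $Q_0\to\mathbb{R}^n$, then $$\int_{\mathbb{R}^n}|Tf(x)|^p\,w(x)\,dx\le c\int_{\mathbb{R}^n}|f(x)|^p\,v(x)\,dx.$$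
   Context: All cubes have sides parallel to the axes; $\lambda Q$ is the cube concentric with $Q$ with sidelength multiplied by $\lambda$. A weight is a nonnegative locally integrable function. The dimensional constant $c_n$ is such that for every cube $Q$, if $x,x'\in Q$ and $y\notin2^mQ$ for some $m\ge1$, then $|x-x'|/|x-y|\le c_n2^{-m}$. $T$ is of weak-type $(1,1)$ if $\lambda|\{|Tf|>\lambda\}|\le c\|f\|_{L^1}$ for all $\lambda>0$. The constant in the conclusions is independent of $f$ and $Q_0$. Condition $W_p$ ($1<p<\infty$, $1/p+1/p'=1$): $(w,v)\in W_p$ if there exist positive constants $\alpha,\beta,c_0$, with $\alpha<1$, so that for every cube $Q$ and for all measurable $E,E'\subset Q$ with $E\cap E'=\emptyset$ and $|E'|\ge\alpha|Q|$, $$\int_Ew(x)\,dx\,\Big(\frac{1}{|Q|}\int_{c(n,\alpha)Q}v(x)^{1-p'}\,dx\Big)^p\le c_0\Big(\frac{|E|}{|Q|}\Big)^\beta\int_{E'}v(x)^{1-p'}\,dx<\infty,$$ where $c(n,\alpha)>1$ is increasing with respect to $\alpha$. The (maximal) median is $m_g(t,Q)=\sup\{M:|\{y\in Q:g(y)<M\}|\le t|Q|\}$; $Q_0\to\mathbb{R}^n$ means that the cubes expand to fill $\mathbb{R}^n$. *)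

(* Defs.v *)
From HB Require Import structures.
From mathcomp Require Import all_boot all_order all_algebra.
From mathcomp Require Import all_classical all_reals all_analysis.

Set Implicit Arguments.
Unset Strict Implicit.
Unset Printing Implicit Defensive.
Import Order.TTheory GRing.Theory Num.Theory.
Import numFieldNormedType.Exports.

Local Open Scope classical_set_scope.
Local Open Scope ring_scope.

(* R^d with d >= 1 is 'rV[R]_n.+1, with d = n.+1. *)

(** Lebesgue measure on R^d: the outer measure given by countable covers by
    boxes, restricted to its Caratheodory (i.e. Lebesgue) measurable sets. *)

Section lebesgue_outer.
Context (R : realType) (n : nat).
Local Notation Rn := 'rV[R]_n.+1.
Local Open Scope ereal_scope.

Definition box (b : Rn * Rn) : set Rn :=
  [set x | forall i, (b.1 0%R i <= x 0%R i < b.2 0%R i)%R].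

Definition box_volume (b : Rn * Rn) : R :=
  (\prod_i (b.2 0 i - b.1 0 i))%R.

Definition box_cover (A : set Rn) : set (nat -> Rn * Rn) :=
  [set B : nat -> Rn * Rn | (forall k i, ((B k).1 0%R i <= (B k).2 0%R i)%R) /\
           A `<=` \bigcup_k box (B k)].

Definition lebn_outer (A : set Rn) : \bar R :=
  ereal_inf [set \sum_(0 <= k <oo) (box_volume (B k))%:E | B in box_cover A].

Lemma box_volume_ge0 A B k : box_cover A B -> 0 <= (box_volume (B k))%:E.
Proof.
by move=> [Ble _]; rewrite lee_fin; apply: prodr_ge0 => i _; rewrite subr_ge0.
Qed.

Lemma lebn_outer_ge0 A : 0 <= lebn_outer A.
Proof.
apply: le_ereal_inf_tmp => _ [B AB <-].
by apply: nneseries_ge0 => k _ _; exact: box_volume_ge0 AB.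
Qed.

Lemma lebn_outer0 : lebn_outer set0 = 0.
Proof.
apply/eqP; rewrite eq_le lebn_outer_ge0 andbT.
apply: ereal_inf_lbound; exists (fun=> (0, 0)%R); first by split.
apply: eseries0 => k _ _.
by rewrite /box_volume/= big_ord_recl subrr mul0r.
Qed.

Lemma le_lebn_outer : {homo lebn_outer : A B / A `<=` B >-> A <= B}.
Proof.
move=> A B AB; apply/ereal_inf_le_tmp => _ [C [Cle BC] <-].
by exists C => //; split => //; exact: subset_trans AB BC.
Qed.

Lemma lebn_outer_sigma_subadditive : sigma_subadditive lebn_outer.
Proof.
move=> A; have [[i ioo]|] := pselect (exists i, lebn_outer (A i) = +oo).
  rewrite (eseries_pinfty _ _ ioo) ?leey// => k _.
  by rewrite -ltNye (lt_le_trans _ (lebn_outer_ge0 _)).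
rewrite -forallNE => Aoo.
apply/lee_addgt0Pr => _/posnumP[e].
rewrite (le_trans _ (epsilon_trick _ _ _))//; last first.
  by move=> k; exact: lebn_outer_ge0.
pose P k B := box_cover (A k) B /\ \sum_(0 <= j <oo) (box_volume (B j))%:E <=
  lebn_outer (A k) + (e%:num / (2 ^ k.+1)%:R)%:E.
have [G PG] : {G : nat -> nat -> Rn * Rn & forall k, P k (G k)}.
  apply: (@choice _ _ P) => k; rewrite /P.
  have Afin : lebn_outer (A k) \is a fin_num.
    by rewrite ge0_fin_numE ?lebn_outer_ge0// ltey; apply/eqP; exact: Aoo.
  have e0 : (0 < e%:num / (2 ^ k.+1)%:R)%R by [].
  have [_ [B AB <-] Blt] := lb_ereal_inf_adherent e0 Afin.
  by exists B; split => //; exact/ltW.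
pose V (ij : nat * nat) := (box_volume (G ij.1 ij.2))%:E.
have V0 ij : 0 <= V ij by exact: box_volume_ge0 (PG _).1.
have /card_esym/ppcard_eqP[f] := card_nat2.
apply: (@le_trans _ _ (\sum_(0 <= k <oo) V (f k))).
  apply: ereal_inf_lbound; exists (fun k => G (f k).1 (f k).2) => //.
  split=> [k i|x [i _ /((PG i).1.2)[j _ Gx]]]; first exact: (PG _).1.1.
  by exists (f^-1%FUN (i, j)) => //; rewrite invK// inE.
have -> : \sum_(0 <= k <oo) V (f k) =
    \sum_(0 <= i <oo) \sum_(0 <= j <oo) V (i, j).
  rewrite nneseries_esumT//.
  rewrite -(@reindex_esum _ _ _ [set: nat] [set: nat * nat])//=.
  rewrite [RHS]nneseries_esumT; last first.
    by move=> i; apply: nneseries_ge0 => j _ _; exact: V0.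
  under [RHS]eq_esum do rewrite nneseries_esumT//.
  rewrite (@esum_esum _ _ _ [set: nat] (fun=> [set: nat])
    (fun i j => V (i, j)))//.
  rewrite (_ : _ `*`` _ = [set: nat * nat]); last by apply/seteqP; split.
  by apply: eq_esum => -[].
apply: lee_nneseries => [i _ _|i _]; last exact: (PG i).2.
by apply: nneseries_ge0 => j _ _; exact: V0.
Qed.

HB.instance Definition _ := isOuterMeasure.Build R Rn lebn_outer
  lebn_outer0 lebn_outer_ge0 le_lebn_outer lebn_outer_sigma_subadditive.

End lebesgue_outer.

HB.instance Definition _ (R : realType) (n : nat) :=
  Measurable.copy 'rV[R]_n.+1 (caratheodory_type (@lebn_outer R n)).

Definition lebn (R : realType) (n : nat) : set 'rV[R]_n.+1 -> \bar R :=
  @lebn_outer R n.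

HB.instance Definition _ (R : realType) (n : nat) := isMeasure.Build
  _ 'rV[R]_n.+1 R (@lebn R n)
  (@caratheodory_measure0 _ _ (@lebn_outer R n))
  (@caratheodory_measure_ge0 _ _ (@lebn_outer R n))
  (@caratheodory_measure_sigma_additive _ _ (@lebn_outer R n)).

Section definitions.
Context {R : realType} {n : nat}.
Local Notation Rn := 'rV[R]_n.+1.
Local Notation mu := (@lebn R n).
Implicit Types (f g w v : Rn -> R) (k : Rn -> Rn -> R) (T : (Rn -> R) -> Rn -> R).

Definition enorm (x : Rn) : R := Num.sqrt (\sum_i x 0 i ^+ 2).

(* The cube with centre a and sidelength l; lambda Q is cube a (lambda * l). *)
Definition cube (a : Rn) (l : R) : set Rn :=
  [set x | forall i, `|x 0 i - a 0 i| <= l / 2].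

(* Any admissible value of the dimensional constant c_n. *)
Definition cube_ratio_constant (cn : R) :=
  forall (a : Rn) (l : R) (m : nat) (x x' y : Rn), 0 < l -> (0 < m)%N ->
    cube a l x -> cube a l x' -> ~ cube a (2 ^+ m * l) y ->
    enorm (x - x') / enorm (x - y) <= cn * 2 ^- m.

Definition weight w := [/\ forall x, 0 <= w x, measurable_fun setT w &
  forall K, compact K -> (\int[mu]_(x in K) (w x)%:E < +oo)%E].

(* v^{1 - p'} with 1/p + 1/p' = 1. Since 1 - p' < 0 it is +oo where v vanishes,
   whereas 0 `^ (1 - p') = 0. *)
Definition dual_weight (p : R) v (x : Rn) : \bar R :=
  if v x == 0 then +oo%E else (v x `^ (1 - p / (p - 1)))%:E.

(* dil stands for alpha |-> c(n, alpha). *)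
Definition Wp (p : R) (dil : R -> R) (beta : R) w v :=
  0 < beta /\ exists alpha c0 : R, [/\ 0 < alpha < 1, 0 < c0 &
    forall (a : Rn) (l : R) (E E' : set Rn), 0 < l ->
      let Q := cube a l in
      measurable E -> measurable E' -> E `<=` Q -> E' `<=` Q ->
      E `&` E' = set0 -> (alpha%:E * mu Q <= mu E')%E ->
      ((\int[mu]_(x in E) (w x)%:E) *
         ((fine (mu Q))^-1%:E *
            \int[mu]_(x in cube a (dil alpha * l)) dual_weight p v x) `^ p
       <= c0%:E * ((fine (mu E) / fine (mu Q)) `^ beta)%:E *
            \int[mu]_(x in E') dual_weight p v x
       < +oo)%E].

Definition pv_at k f (x : Rn) (L : R) :=
  (forall eps, 0 < eps ->
     mu.-integrable [set y | eps < enorm (x - y)] (fun y => (k x y * f y)%:E)) /\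
  (\int[mu]_(y in [set y | (eps < enorm (x - y))%R]) (k x y * f y)%:E
     @[eps --> 0^'+] --> L%:E)%E.

(* g(x) = p.v. \int k(x, y) f(y) dy for almost every x. *)
Definition pv_integral k f g :=
  measurable_fun setT g /\ {ae mu, forall x, pv_at k f x (g x)}.

Definition singular_integral k T :=
  forall f, mu.-integrable setT (EFin \o f) -> pv_integral k f (T f).

Definition weak_type11 T := exists2 c : R, 0 < c &
  forall f, mu.-integrable setT (EFin \o f) -> forall lambda : R, 0 < lambda ->
    (lambda%:E * mu [set x | (lambda < `|T f x|)%R]
       <= c%:E * \int[mu]_x `|f x|%:E)%E.

(* The case x = x', excluded because omega lives on (0, oo), is trivial. *)
Definition kernel_regularity k (omega : R -> R) := exists2 c : R, 0 < c &
  forall (a : Rn) (l : R) (x x' y : Rn), 0 < l ->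
    cube a l x -> cube a l x' -> ~ cube a (2 * l) y -> x != x' ->
    `|k x y - k x' y| <=
      c / enorm (x - y) ^+ n.+1 * omega (enorm (x - x') / enorm (x - y)).

Definition median g (t : R) (Q : set Rn) : R :=
  sup [set M : R | (mu [set y | Q y /\ (g y < M)%R] <= t%:E * mu Q)%E].

(* The filter Q -> R^n on cubes, given by their centre and sidelength. *)
Definition expanding_cubes : set_system (Rn * R) :=
  filter_from [set r : R | 0 < r]
    (fun r => [set q | 0 < q.2 /\ cube 0 r `<=` cube q.1 q.2]).

Lemma expanding_cubes_filter : ProperFilter expanding_cubes.
Proof.
apply: filter_from_proper => [|r r0]; last by exists (0, r); split.
apply: filter_from_filter => [|r s r0 s0]; first by exists 1 => /=.
exists (Num.max r s) => /=; first by rewrite lt_max r0.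
move=> q [q0 qrs]; split; split=> // x xc; apply: qrs => i;
  apply: (le_trans (xc i)); rewrite ler_pM2r// le_max lexx ?orbT//.
Qed.

End definitions.

Arguments expanding_cubes {R n}.

#[global] Existing Instance expanding_cubes_filter.

(* Main.v *)
Require Import Defs.
From mathcomp Require Import all_boot all_order all_algebra.
From mathcomp Require Import all_classical all_reals all_analysis.
From mathcomp Require Import measurable_realfun ring lra.
Set Implicit Arguments.
Unset Strict Implicit.
Unset Printing Implicit Defensive.
Import Order.TTheory GRing.Theory Num.Theory.
Import numFieldNormedType.Exports.
Local Open Scope classical_set_scope.
Local Open Scope ring_scope.

(** The proof dominates the oscillation of [T f] over a cube [Q0] by a sparse
    family of averages of [f], and sums that family against the weights by means
    of the gain [(|E| / |Q|)^beta] in condition W_p.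

    Oscillation ([local_oscillation]). Split [f] at the double of a cube [Q]. The
    weak type (1,1) controls the image of the near part off a subset of [Q] of
    measure [eta |Q|]; by the regularity of the kernel and the Dini condition, the
    far part varies on [Q] by at most a multiple of the averages of [|f|] over the
    dilates of [Q]. Hence, off that subset, [T f] is within [A Q] of a constant,
    where [A Q] is a multiple of the largest average of [|f|] over cubes
    containing [Q]. For [eta < min t (1 - t)] this constant differs from the median
    by at most [A Q] ([median_close]).

    Sparse domination ([sparse_domination]). Starting from [Q0], pass from a dyadic
    cell to its maximal subcells in which the exceptional subset of the cell has
    density above 1/2. The cells of the g-th generation fill a layer, and inside a
    cell of generation g the layer g + m has proportion at most [theta^m], with
    [theta = 2 eta] ([lebn_layer_le]). Almost every point leaves the layers, and
    adding the jumps of the constants along its chain of cells gives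
    [|T f - c| <= 16 2^m A P] for a cell [P] of some generation g containing the
    point, where the point lies in layer g + m but not in layer g + m + 1.

    Weights. Averages over cubes are bounded by multiples of averages over the cells
    of finitely many translated dyadic grids ([cube_sub_shifted_cell]). Classify the
    pairs (point, [P]) by m and by the size [lam_k = lam_0 b^k] of the average
    attached to [P]. Let [C] be a maximal cell on which the average exceeds [lam_k].
    The points of class (k, m) in [C] have proportion at most
    [theta^m / (1 - theta)] ([lebn_trapped_le]), while the cells with averages above
    [lam_{k+1}] leave a proportion above alpha of [C] free if [b] is large
    ([next_level_small]).
    Condition W_p, with [E] the former set and [E'] this free part, bounds
    [lam_k^p w(E)] by [theta^(m beta)] times the integral over [E'] of the p-th
    power of a maximal function relative to the measure [v^(1-p') dx]
    ([level_estimate]). The sets [E'] for different k are disjoint, so the sum over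
    k is controlled by the maximal theorem ([dyadic_maximal]) and thus by the
    integral of [|f|^p v]. The sum over m is geometric because [eta] is chosen with
    [2^p theta^beta <= 1/2] ([weighted_oscillation_bound]).

    Large scales. The levels start at a positive [lam_0] that all averages over
    huge cubes have to stay below. Condition W_p provides this: unless [w] vanishes
    a.e. on [Q0], averages over cubes growing to the whole space tend to 0
    ([averages_vanish]). To keep the average over [Q0] positive, [|f|] is replaced on
    [Q0] by its maximum with a small multiple of [v^(1-p')], which tends to 0 at
    the end ([cube_bound]).

    The global inequality follows from the one on the cubes centred at the origin
    by Fatou's lemma. *)

(** * Volume of boxes and cubes *)

Section lebesgue_boxes.
Context (R : realType) (n : nat).
Local Notation Rn := 'rV[R]_n.+1.
Local Notation mu := (@lebn R n).

Definition set_coord (x : Rn) (i : 'I_n.+1) (c : R) : Rn :=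
  \row_j (if j == i then c else x 0 j).

Lemma set_coordE x i c j :
  set_coord x i c 0 j = if j == i then c else x 0 j.
Proof. by rewrite mxE. Qed.

(** A hyperplane cuts a box into two boxes whose volumes add up, so
    half-spaces satisfy the Caratheodory criterion. *)
Lemma measurable_halfspace (i : 'I_n.+1) (c : R) :
  measurable [set x : Rn | x 0 i < c].
Proof.
apply: (@le_caratheodory_measurable _ _ (@lebn_outer R n)) => X.
apply: le_ereal_inf_tmp => _ [B [Ble XB] <-].
pose ck k := Num.max ((B k).1 0 i) (Num.min c ((B k).2 0 i)).
have c1 k : (B k).1 0 i <= ck k by rewrite le_max lexx.
have c2 k : ck k <= (B k).2 0 i by rewrite ge_max Ble ge_min lexx orbT.
pose B1 k := ((B k).1, set_coord (B k).2 i (ck k)).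
pose B2 k := (set_coord (B k).1 i (ck k), (B k).2).
have cov1 : box_cover (X `&` [set x : Rn | x 0 i < c]) B1.
  split=> [k j|x [/XB[k _ Bx] xc]] /=.
    by rewrite set_coordE; case: eqP => [->|_]; [exact: c1|exact: Ble].
  exists k => // j; have /andP[x1 x2] := Bx j; rewrite x1 /= set_coordE.
  by case: eqP => // ji; rewrite lt_max lt_min -ji x2 ji xc orbT.
have cov2 : box_cover (X `&` ~` [set x : Rn | x 0 i < c]) B2.
  split=> [k j|x [/XB[k _ Bx] /= /negP]] /=.
    by rewrite set_coordE; case: eqP => [->|_]; [exact: c2|exact: Ble].
  rewrite -leNgt => xc; exists k => // j.
  have /andP[x1 x2] := Bx j; rewrite x2 andbT /= set_coordE.
  by case: eqP x1 x2 => // -> x1 x2; rewrite ge_max x1 /= ge_min xc.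
have volE k : box_volume (B k) = box_volume (B1 k) + box_volume (B2 k).
  rewrite /box_volume !(bigD1 (P := xpredT) i)//=.
  rewrite !set_coordE eqxx.
  rewrite [X in _ = _ * X + _](eq_bigr (fun j => (B k).2 0 j - (B k).1 0 j)); last first.
    by move=> j ji; rewrite set_coordE (negPf ji).
  rewrite [X in _ = _ + _ * X](eq_bigr (fun j => (B k).2 0 j - (B k).1 0 j)); last first.
    by move=> j ji; rewrite set_coordE (negPf ji).
  by rewrite -mulrDl; congr (_ * _); rewrite [in RHS]addrC addrA subrK.
have -> : (\sum_(0 <= k <oo) (box_volume (B k))%:E =
    \sum_(0 <= k <oo) (box_volume (B1 k))%:E +
    \sum_(0 <= k <oo) (box_volume (B2 k))%:E)%E.
  rewrite -nneseriesD.
  - by apply: eq_eseriesr => k _; rewrite volE EFinD.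
  - by move=> k _ _; exact: (box_volume_ge0 _ cov1).
  - by move=> k _ _; exact: (box_volume_ge0 _ cov2).
by apply: leeD; apply: ereal_inf_lbound; [exists B1|exists B2].
Qed.

Lemma measurable_coord (i : 'I_n.+1) : measurable_fun setT (fun x : Rn => x 0 i).
Proof.
move=> mT; apply: (measurability _ (RGenInftyO.measurableE R)) => //.
move=> _ [_ [c ->] <-]; rewrite setTI preimage_itvNyo.
exact: measurable_halfspace.
Qed.

Lemma measurable_box (b : Rn * Rn) : measurable (box b).
Proof.
rewrite (_ : box b = \bigcap_(i in [set: 'I_n.+1])
    [set x : Rn | b.1 0 i <= x 0 i < b.2 0 i]); last first.
  by apply/seteqP; split => x bx i; [move=> _; exact: (bx i)|exact: (bx i Logic.I)].
apply: fin_bigcap_measurable => // i _.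
rewrite (_ : [set _ | _] = (fun x : Rn => x 0 i) @^-1` `[b.1 0 i, b.2 0 i[).
  by rewrite -[X in measurable X]setTI; exact: measurable_coord.
by apply/seteqP; split => x /=; rewrite in_itv.
Qed.

Lemma measurable_cube (a : Rn) (l : R) : measurable (cube a l).
Proof.
rewrite (_ : cube a l = \bigcap_(i in [set: 'I_n.+1])
    [set x : Rn | `|x 0 i - a 0 i| <= l / 2]); last first.
  by apply/seteqP; split => x bx i; [move=> _; exact: (bx i)|exact: (bx i Logic.I)].
apply: fin_bigcap_measurable => // i _.
rewrite (_ : [set _ | _] =
    (fun x : Rn => x 0 i) @^-1` `[a 0 i - l / 2, a 0 i + l / 2]).
  by rewrite -[X in measurable X]setTI; exact: measurable_coord.
by apply/seteqP; split => x /=; rewrite in_itv/= ler_distl.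
Qed.

(** Countable additivity on the line gives the bound, one coordinate at a time. In
    [phi m x] below the first m sides of each box count by their length, the other
    ones by their indicator at x: [phi 0] is at least 1 on the box because the
    cover has a box through every point, [phi n.+1] is the total volume of the
    cover, and one integration leads from [phi m] to [phi m.+1]. *)
Lemma box_volume_le_cover (b : Rn * Rn) (B : nat -> Rn * Rn) :
  (forall i, b.1 0 i <= b.2 0 i) -> box_cover (box b) B ->
  ((box_volume b)%:E <= \sum_(0 <= k <oo) (box_volume (B k))%:E)%E.
Proof.
move=> b12 [B12 bB].
pose ind k (i : 'I_n.+1) (s : R) : R := \1_(`[(B k).1 0 i, (B k).2 0 i[%classic) s.
pose len k (i : 'I_n.+1) : R := (B k).2 0 i - (B k).1 0 i.
have len0 k i : 0 <= len k i by rewrite subr_ge0.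
have ind0 k i s : 0 <= ind k i s by rewrite /ind indicE ler0n.
pose fac m (x : Rn) k (i : 'I_n.+1) := if (i < m)%N then len k i else ind k i (x 0 i).
have fac0 m x k i : 0 <= fac m x k i by rewrite /fac; case: ifP.
pose phi m x := (\sum_(0 <= k <oo) (\prod_i fac m x k i)%:E)%E.
suff H m : (m <= n.+1)%N -> forall x : Rn,
    (forall i : 'I_n.+1, (m <= i)%N -> b.1 0 i <= x 0 i < b.2 0 i) ->
    ((\prod_(i < n.+1 | (i < m)%N) (b.2 0 i - b.1 0 i))%:E <= phi m x)%E.
  have volE : \prod_(i < n.+1 | (i < n.+1)%N) (b.2 0 i - b.1 0 i) = box_volume b.
    by apply: eq_bigl => i; rewrite ltn_ord.
  rewrite -volE; apply: (le_trans (H _ (leqnn _) 0 _)).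
    by move=> i; rewrite leqNgt ltn_ord.
  rewrite le_eqVlt; apply/orP; left; apply/eqP.
  apply: eq_eseriesr => k _; congr EFin; apply: eq_bigr => i _.
  by rewrite /fac ltn_ord.
elim: m => [_ x bx|m IH mn x bx].
  rewrite big_pred0; last by move=> i; rewrite ltn0.
  have /bB[k _ Bx] : box b x by move=> i; apply: bx.
  have <- : ((\prod_i fac 0 x k i)%:E = 1)%E.
    congr EFin; apply: big1 => i _; rewrite /fac ltn0 /ind indicE mem_set//=.
    by rewrite in_itv; exact: Bx.
  rewrite /phi.
  apply: (@le_trans _ _ (\sum_(0 <= j < k.+1) (\prod_i fac 0 x j i)%:E)%E).
    rewrite big_nat_recr//= leeDr// sume_ge0// => j _.
    by rewrite lee_fin; apply: prodr_ge0.
  by apply: nneseries_lim_ge => j _ _; rewrite lee_fin; apply: prodr_ge0.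
pose i0 := Ordinal mn.
pose c k := \prod_(i | i != i0) fac m.+1 x k i.
have c0 k : 0 <= c k by apply: prodr_ge0.
have phiE s : phi m (set_coord x i0 s) = (\sum_(0 <= k <oo) (c k * ind k i0 s)%:E)%E.
  apply: eq_eseriesr => k _; congr EFin.
  rewrite (bigD1 i0)//= mulrC; congr (_ * _).
    apply: eq_bigr => i ii0; rewrite /fac set_coordE (negPf ii0).
    have im : (i : nat) != m by move: ii0; rewrite -(inj_eq val_inj).
    by rewrite ltnS [(i <= m)%N]leq_eqVlt (negPf im).
  by rewrite /fac /= ltnn set_coordE eqxx.
have lenE k : (\int[lebesgue_measure]_s (c k * ind k i0 s)%:E = (c k * len k i0)%:E)%E.
  under eq_integral do rewrite EFinM.
  rewrite ge0_integralZl_EFin//; last 2 first.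
  - by move=> s _; rewrite lee_fin.
  - by apply/measurable_EFinP; exact: measurable_indic.
  rewrite EFinM integral_indic// setIT; congr (_ * _)%E.
  rewrite [LHS]lebesgue_measure_itv/= lte_fin; case: ltP => // h.
  by apply/esym/eqP; rewrite eqe subr_eq0 eq_le h B12.
have -> : phi m.+1 x = (\int[lebesgue_measure]_s phi m (set_coord x i0 s))%E.
  under eq_integral do rewrite phiE.
  rewrite integral_nneseries//.
  - apply: eq_eseriesr => k _; rewrite lenE; congr EFin.
    by rewrite (bigD1 i0)//= mulrC /fac /= ltnSn.
  - move=> k; apply/measurable_EFinP; apply: measurable_funM => //.
    exact: measurable_indic.
  - by move=> k s _; rewrite lee_fin mulr_ge0.
have mphi : measurable_fun setT (fun s => phi m (set_coord x i0 s)).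
  rewrite (_ : (fun s => _) = fun s => (\sum_(0 <= k <oo) (c k * ind k i0 s)%:E)%E).
    apply: ge0_emeasurable_sum => [k s _ _|k _].
      by rewrite lee_fin mulr_ge0.
    apply/measurable_EFinP; apply: measurable_funM => //; exact: measurable_indic.
  by apply/funext => s; rewrite phiE.
have phi0 m' y : (0 <= phi m' y)%E.
  by apply: nneseries_ge0 => k _ _; rewrite lee_fin; apply: prodr_ge0.
pose I := `[b.1 0 i0, b.2 0 i0[%classic : set R.
have mI : measurable I by exact: measurable_itv.
have muI : (lebesgue_measure I = (b.2 0 i0 - b.1 0 i0)%:E)%E.
  rewrite [LHS]lebesgue_measure_itv/= lte_fin; case: ltP => // h.
  by apply/esym/eqP; rewrite eqe subr_eq0 eq_le h b12.
apply: (@le_trans _ _ (\int[lebesgue_measure]_(s in I) phi m (set_coord x i0 s))%E); last first.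
  by apply: ge0_subset_integral.
apply: (@le_trans _ _ (\int[lebesgue_measure]_(s in I)
    (cst (\prod_(i < n.+1 | (i < m)%N) (b.2 0 i - b.1 0 i))%:E) s)%E).
  rewrite integral_cst//= [X in (_ <= _ * X)%E]muI.
  rewrite (bigD1 i0) ?ltnSn//= mulrC EFinM.
  rewrite [X in (_ <= X%:E * _)%E](eq_bigl (fun i : 'I__ => (i < m.+1)%N && (i != i0))).
    by rewrite lexx.
  by move=> i; rewrite ltnS -(inj_eq val_inj)/= ltn_neqAle andbC.
apply: ge0_le_integral => //.
- by move=> s _; rewrite lee_fin; apply: prodr_ge0 => i _; rewrite subr_ge0.
- exact: measurable_funTS.
- move=> s Is; apply: IH; first exact: ltnW.
  move=> i mi; rewrite set_coordE; case: eqP => [->|/eqP ii0]; first by move: Is; rewrite /I/= in_itv.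
  by apply: bx; rewrite ltn_neqAle mi andbT eq_sym; exact: ii0.
Qed.

Lemma lebn_box (b : Rn * Rn) : (forall i, b.1 0 i <= b.2 0 i) ->
  mu (box b) = (box_volume b)%:E.
Proof.
move=> b12; apply/eqP; rewrite eq_le; apply/andP; split; last first.
  by apply: le_ereal_inf_tmp => _ [B bB <-]; exact: box_volume_le_cover.
pose B k : Rn * Rn := if k is 0 then b else (0, 0).
have z : box_volume ((0, 0) : Rn * Rn) = 0 by rewrite /box_volume/= big_ord_recl subrr mul0r.
have -> : ((box_volume b)%:E = \sum_(0 <= k <oo) (box_volume (B k))%:E)%E.
  rewrite (nneseries_split 0 1)//; last first.
    case=> [|k] _; rewrite /B ?z// lee_fin.
    by apply: prodr_ge0 => i _; rewrite subr_ge0.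
  rewrite big_nat1 eseries0 ?adde0// => -[|k]//= _ _.
  by rewrite z.
apply: ereal_inf_lbound; exists B => //; split; last by move=> x bx; exists 0%N.
by move=> [|k] i //=.
Qed.

(** Boxes and cubes can be enlarged at an arbitrarily small cost in volume. *)
Lemma prod_enlarge (I : Type) (r : seq I) (g : I -> R) (e : R) : 0 < e ->
  exists2 del : R, 0 < del & \prod_(i <- r) (g i + del) <= \prod_(i <- r) g i + e.
Proof.
move=> e0.
have H : (\prod_(i <- r) (g i + del)) @[del --> (0 : R)] --> \prod_(i <- r) g i.
  elim: r => [|i r IH].
    by rewrite big_nil; under eq_fun do rewrite big_nil; exact: cvg_cst.
  rewrite big_cons; under eq_fun do rewrite big_cons.
  apply: cvgM => //; rewrite -[X in _ --> X]addr0.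
  by apply: cvgD; [exact: cvg_cst|exact: cvg_id].
move/cvgrPdist_le: H => /(_ _ e0)/nbhs_ballP[d /= d0 dP].
exists (d / 2); first by rewrite divr_gt0.
have /dP : ball (0 : R) d (d / 2).
  by rewrite /ball/= sub0r normrN gtr0_norm ?divr_gt0// ltr_pdivrMr// ltr_pMr// ltr1n.
by rewrite /= distrC ler_distl => /andP[].
Qed.

Definition corner_box (a : Rn) (l : R) : Rn * Rn :=
  (\row_i (a 0 i - l / 2), \row_i (a 0 i + l / 2)).

Lemma lebn_cube (a : Rn) (l : R) : 0 <= l -> mu (cube a l) = (l ^+ n.+1)%:E.
Proof.
move=> l0; apply/eqP; rewrite eq_le; apply/andP; split.
  apply/lee_addgt0Pr => e e0.
  have [del del0 le_e] := @prod_enlarge _ (enum 'I_n.+1) (fun=> l) _ e0.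
  move: le_e; rewrite !big_enum/= !prodr_const card_ord => le_e.
  pose b : Rn * Rn := (\row_i (a 0 i - l / 2), \row_i (a 0 i + l / 2 + del)).
  apply: (@le_trans _ _ (mu (box b))).
    apply: le_measure; rewrite ?inE//; [exact: measurable_cube|exact: measurable_box|].
    move=> x xa i; move: (xa i); rewrite /b/= !mxE ler_distl => /andP[-> h]/=.
    by rewrite (le_lt_trans h)// ltrDl.
  rewrite lebn_box; last by move=> i; rewrite /b/= !mxE; lra.
  rewrite -EFinD lee_fin (le_trans _ le_e)// /box_volume/b/=.
  rewrite (eq_bigr (fun=> l + del)); last by move=> i _; rewrite !mxE; lra.
  by rewrite prodr_const card_ord.
have <- : mu (box (corner_box a l)) = (l ^+ n.+1)%:E.
  rewrite lebn_box; last by move=> i; rewrite !mxE; lra.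
  rewrite /box_volume (eq_bigr (fun=> l)); last by move=> i _; rewrite !mxE; lra.
  by rewrite prodr_const card_ord.
apply: le_measure; rewrite ?inE//; [exact: measurable_box|exact: measurable_cube|].
move=> x xa i; move: (xa i); rewrite /= !mxE => /andP[h1 h2].
by rewrite ler_distl h1 ltW.
Qed.

Lemma lebn_null_measurable (A : set Rn) : mu A = 0%E -> measurable A.
Proof.
move=> A0; apply: (@le_caratheodory_measurable _ _ (@lebn_outer R n)) => X.
rewrite -[leRHS]add0e; apply: leeD; last by apply: le_lebn_outer.
by rewrite -A0; apply: le_lebn_outer.
Qed.

Lemma lebn_le (A B : set Rn) : A `<=` B -> (mu A <= mu B)%E.
Proof. exact: le_lebn_outer. Qed.

Lemma lebn_null_sub (A B : set Rn) : A `<=` B -> mu B = 0%E -> mu A = 0%E.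
Proof.
move=> AB B0; apply/eqP; rewrite eq_le measure_ge0 andbT -B0; exact: lebn_le.
Qed.

End lebesgue_boxes.

(** * Dyadic grids *)

Section grid.
Context (R : realType) (n : nat) (o : 'rV[R]_n.+1) (L : R).
Context (L0 : 0 < L).
Local Notation Rn := 'rV[R]_n.+1.
Local Notation mu := (@lebn R n).
Implicit Types (x y : Rn) (P : nat -> Rn -> Prop).

Definition cell_index (j : nat) x : {ffun 'I_n.+1 -> int} :=
  [ffun i => Num.floor ((x 0 i - o 0 i) * 2 ^+ j / L)].

(** A cell is named by its level and any one of its points, so that properties of
    cells are predicates of a level and a point. *)
Definition cell (j : nat) x : set Rn := [set y | cell_index j y = cell_index j x].

Lemma cell_refl j x : cell j x x. Proof. by []. Qed.

Lemma cell_eq j x y : cell j x y -> cell j y = cell j x.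
Proof. by rewrite /cell/= => ->. Qed.

Lemma cell_sym j x y : cell j x y -> cell j y x.
Proof. by move=> xy; rewrite (cell_eq xy). Qed.

Lemma cell_nestS j x : cell j.+1 x `<=` cell j x.
Proof.
move=> y /ffunP yx; apply/ffunP => i; move: (yx i); rewrite !ffunE.
set t := (y 0 i - o 0 i) * 2 ^+ j / L; set t' := (x 0 i - o 0 i) * 2 ^+ j / L.
have -> : (y 0 i - o 0 i) * 2 ^+ j.+1 / L = 2 * t by rewrite /t exprS; ring.
have -> : (x 0 i - o 0 i) * 2 ^+ j.+1 / L = 2 * t' by rewrite /t' exprS; ring.
move=> tt'; apply: floor_def.
have /andP[h1 h2] := floor_itv t'; set m := Num.floor t' in h1 h2 *.
have l1 : (2 * m <= Num.floor (2 * t))%R.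
  by rewrite tt' floor_ge_int intrM ler_pM2l.
have l2 : (Num.floor (2 * t) < 2 * (m + 1))%R.
  by rewrite tt' floor_lt_int intrM ltr_pM2l.
by move: l1 l2; rewrite floor_ge_int floor_lt_int !intrM ler_pM2l// ltr_pM2l// => -> ->.
Qed.

Lemma cell_nest i j x : (i <= j)%N -> cell j x `<=` cell i x.
Proof.
elim: j => [|j IH]; first by rewrite leqn0 => /eqP ->.
rewrite leq_eqVlt => /predU1P[->//|]; rewrite ltnS => /IH h.
exact: subset_trans (@cell_nestS j x) h.
Qed.

Definition side (j : nat) : R := L / 2 ^+ j.

Lemma side_gt0 j : 0 < side j. Proof. by rewrite divr_gt0// exprn_gt0. Qed.

Lemma sideS j : side j = 2 * side j.+1.
Proof. by rewrite /side exprS; field; rewrite expf_neq0. Qed.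

Lemma side_le j : side j <= L.
Proof. by rewrite ler_pdivrMr ?exprn_gt0// ler_peMr ?(ltW L0)// exprn_ege1// ler1n. Qed.

Definition cell_box j x : Rn * Rn :=
  (\row_i (o 0 i + (cell_index j x i)%:~R * side j),
   \row_i (o 0 i + (cell_index j x i + 1)%:~R * side j)).

Lemma cellE j x : cell j x = box (cell_box j x).
Proof.
have P2 : 0 < 2 ^+ j :> R by rewrite exprn_gt0.
apply/seteqP; split=> y.
  move=> yx i; rewrite /= !mxE -yx ffunE.
  have := floor_itv ((y 0 i - o 0 i) * 2 ^+ j / L).
  rewrite ler_pdivlMr// ltr_pdivrMr// => /andP[h1 h2].
  rewrite addrC -lerBrDr [ltRHS]addrC -ltrBlDr /side !mulrA.
  by rewrite ler_pdivrMr// ltr_pdivlMr// h1 h2.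
move=> yx; apply/ffunP => i; move: (yx i); rewrite /= !mxE [in X in _ -> X]ffunE.
move=> yb; apply: floor_def; move: yb.
rewrite addrC -lerBrDr [ltRHS]addrC -ltrBlDr /side !mulrA.
by rewrite ler_pdivrMr// ltr_pdivlMr// ler_pdivlMr// ltr_pdivrMr.
Qed.

Lemma measurable_cell j x : measurable (cell j x).
Proof. by rewrite cellE; exact: measurable_box. Qed.

Lemma lebn_cell j x : mu (cell j x) = (side j ^+ n.+1)%:E.
Proof.
have s0 := side_gt0 j.
rewrite cellE lebn_box.
  rewrite /box_volume (eq_bigr (fun=> side j)) ?prodr_const ?card_ord// => i _.
  by rewrite !mxE intrD; ring.
by move=> i; rewrite !mxE intrD; nra.
Qed.

Definition cell_center j x : Rn :=
  \row_i (o 0 i + ((cell_index j x i)%:~R + 2^-1) * side j).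

Lemma cell_sub_cube j x : cell j x `<=` cube (cell_center j x) (side j).
Proof.
rewrite cellE => y yx i; move: (yx i); rewrite /= !mxE intrD => h.
by rewrite ler_norml; lra.
Qed.

(** A family of cells is given by a predicate [P], where [P j x] means that the cell
    of level j around x belongs to the family. This depends on the cell alone for
    a [cell_invariant] predicate, and the cells of the family are pairwise disjoint
    for a [level_unique] one. *)
Definition cell_invariant P := forall j x y, cell j x y -> P j x -> P j y.
Definition level_unique P := forall i j x, P i x -> P j x -> i = j.
Definition cells P : set Rn := [set x | exists j, P j x].

Let piece P (q : nat) : set Rn :=
  [set x | exists2 j, P j x & pickle (j, cell_index j x) = q].

Let piece_cell P q x j : cell_invariant P -> P j x ->
  pickle (j, cell_index j x) = q -> piece P q = cell j x.
Proof.
move=> Pinv Px xq; apply/seteqP; split => y.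
  move=> [j' Py] ; rewrite -xq => /(pcan_inj pickleK)[-> ].
  by [].
by move=> yx; exists j; [exact: Pinv Px|rewrite yx].
Qed.

Let measurable_piece P q : cell_invariant P -> measurable (piece P q).
Proof.
move=> Pinv; have [[x [j Px xq]]|h] := pselect (exists x, piece P q x).
  by rewrite (piece_cell Pinv Px xq); exact: measurable_cell.
rewrite (_ : piece P q = set0)//; apply/seteqP; split => // x xq.
by apply: h; exists x.
Qed.

Let cells_pieces P : cells P = \bigcup_q piece P q.
Proof.
apply/seteqP; split => x; first by move=> [j Px]; exists (pickle (j, cell_index j x)) => //; exists j.
by move=> [q _ [j Px _]]; exists j.
Qed.

Lemma measurable_cells P : cell_invariant P -> measurable (cells P).
Proof.
move=> Pinv; rewrite cells_pieces.
by apply: bigcup_measurable => q _; exact: measurable_piece.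
Qed.

(** The cells of the family are disjoint and, being named by finitely many integers,
    countable; so inequalities on the single cells add up. *)
Lemma le_integral_cells P (F G : Rn -> \bar R) (A A' : set Rn) :
  cell_invariant P -> level_unique P -> measurable A -> measurable A' ->
  measurable_fun setT F -> measurable_fun setT G ->
  (forall x, 0 <= F x)%E -> (forall x, 0 <= G x)%E ->
  (forall j x, P j x -> \int[mu]_(y in cell j x `&` A) F y <=
                        \int[mu]_(y in cell j x `&` A') G y)%E ->
  (\int[mu]_(y in cells P `&` A) F y <= \int[mu]_(y in cells P `&` A') G y)%E.
Proof.
move=> Pinv Puniq mA mA' mF mG F0 G0 FG.
have tr : trivIset setT (piece P).
  apply/trivIsetP => p q _ _ /eqP pq; apply/seteqP; split => // x [[j Px xp] [j' Px' xq]].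
  by apply: pq; rewrite -xp -xq (Puniq _ _ _ Px Px').
have E (H : Rn -> \bar R) (B : set Rn) : measurable B -> measurable_fun setT H ->
    (forall x, 0 <= H x)%E ->
    (\int[mu]_(y in cells P `&` B) H y =
     \sum_(0 <= q <oo) \int[mu]_(y in piece P q `&` B) H y)%E.
  move=> mB mH H0; rewrite cells_pieces setI_bigcupl ge0_integral_bigcup//.
  - by move=> q; apply: measurableI => //; exact: measurable_piece.
  - exact: measurable_funTS.
  - exact: trivIset_setIr.
rewrite !E//; apply: lee_nneseries => q _; first by move=> _; apply: integral_ge0.
have [[x [j Px xq]]|h] := pselect (exists x, piece P q x).
  by rewrite (piece_cell Pinv Px xq); exact: FG.
rewrite (_ : piece P q = set0) ?set0I ?integral_set0//.
by apply/seteqP; split => // x xq; apply: h; exists x.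
Qed.

Lemma le_measure_cells P (a b : R) (A A' : set Rn) :
  0 <= a -> 0 <= b ->
  cell_invariant P -> level_unique P -> measurable A -> measurable A' ->
  (forall j x, P j x ->
     a%:E * mu (cell j x `&` A) <= b%:E * mu (cell j x `&` A'))%E ->
  (a%:E * mu (cells P `&` A) <= b%:E * mu (cells P `&` A'))%E.
Proof.
move=> a0 b0 Pinv Puniq mA mA' ab.
have mP := measurable_cells Pinv.
have := @le_integral_cells P (cst a%:E) (cst b%:E) A A' Pinv Puniq mA mA'.
rewrite !integral_cst; [|exact: measurableI|exact: measurableI].
apply => // j x Px.
have mc := measurable_cell j x.
by rewrite !integral_cst; [exact: ab|exact: measurableI|exact: measurableI].
Qed.

(** The maximal cells of a family. *)
Definition first_level P j x := P j x /\ forall i, (i < j)%N -> ~ P i x.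

Lemma first_level_invariant P : cell_invariant P -> cell_invariant (first_level P).
Proof.
move=> Pinv j x y xy [Px Pmin]; split; first exact: Pinv Px.
move=> i ij Py; apply: (Pmin i ij); apply: Pinv Py.
by apply/cell_sym/(cell_nest (ltnW ij)).
Qed.

Lemma first_level_unique P : level_unique (first_level P).
Proof.
move=> i j x [Pi mi] [Pj mj]; case: (ltngtP i j) => // ij.
- by have := mj _ ij Pi.
- by have := mi _ ij Pj.
Qed.

Lemma first_level_exists P j x : P j x ->
  exists2 i, (i <= j)%N & first_level P i x.
Proof.
move=> Pj; have ex : exists i, `[< P i x >] by exists j; apply/asboolP.
have [i /asboolP Pi mi] := ex_minnP ex.
exists i; first by apply: mi; apply/asboolP.
split=> // i' i'i Pi'; move: i'i; rewrite ltnNge => /negP; apply.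
by apply: mi; apply/asboolP.
Qed.

Lemma cells_first_level P : cells (first_level P) = cells P.
Proof.
apply/seteqP; split => x [j]; first by move=> [Px _]; exists j.
by move=> /first_level_exists[i _ h]; exists i.
Qed.

(** Cover [B] by boxes of nearly optimal total volume and cut them into small cells:
    the hypothesis then gives [2 |B| <= |B|]. This is the part of the Lebesgue
    density theorem on which the stopping argument relies. *)
Lemma null_of_half_density (B : set Rn) (j0 : nat) : measurable B ->
  (mu B < +oo)%E ->
  (forall j x, (j0 <= j)%N -> (2%:E * mu (cell j x `&` B) <= mu (cell j x))%E) ->
  mu B = 0%E.
Proof.
move=> mB Bfin half.
have Hbox (b : Rn * Rn) : (forall i, b.1 0 i <= b.2 0 i) ->
    (2%:E * mu (box b `&` B) <= (box_volume b)%:E)%E.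
  move=> b12; apply/lee_addgt0Pr => e e0.
  have [del del0 le_e] := @prod_enlarge _ _ (enum 'I_n.+1)
    (fun i => b.2 0 i - b.1 0 i) _ e0.
  rewrite !big_enum/= -/(box_volume b) in le_e.
  have [j j0j Lj] : exists2 j, (j0 <= j)%N & side j <= del / 2.
    exists (j0 + Num.bound (2 * L / del))%N; first exact: leq_addr.
    have B0 : 0 <= 2 * L / del by rewrite divr_ge0 ?mulr_ge0// ltW.
    have := archi_boundP B0; set N := Num.bound _ => LN.
    rewrite /side ler_pdivrMr ?exprn_gt0//.
    rewrite ltr_pdivrMr// in LN.
    have : N%:R <= 2 ^+ (j0 + N) :> R.
      rewrite -natrX ler_nat; apply: leq_trans (ltnW (ltn_expl _ (ltnSn 1))) _.
      by rewrite leq_exp2l// leq_addl.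
    by nra.
  pose P i x := i = j /\ exists2 y, box b y & cell j x y.
  have Pinv : cell_invariant P.
    move=> i x y xy [ij [z bz xz]]; split=> //; exists z => //.
    by rewrite ij in xy; rewrite (cell_eq xy).
  have Puniq : level_unique P by move=> i i' x [-> _] [-> _].
  have mP := measurable_cells Pinv.
  pose b' : Rn * Rn := (\row_i (b.1 0 i - del / 2), \row_i (b.2 0 i + del / 2)).
  have Pb' : cells P `<=` box b'.
    move=> x [i' [_ [y by_ xy]]] i; rewrite /b'/= !mxE.
    have /andP[y1 y2] := by_ i.
    have := xy; rewrite cellE => /(_ i); rewrite /= !mxE => /andP[].
    have := cell_refl j x; rewrite {1}cellE => /(_ i); rewrite /= !mxE => /andP[].
    rewrite intrD mulrDl mul1r; lra.
  apply: (@le_trans _ _ (2%:E * mu (cells P `&` B))%E).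
    rewrite lee_pmul2l//; apply: lebn_le => x [bx Bx]; split=> //.
    by exists j; split=> //; exists x.
  apply: (@le_trans _ _ (1%:E * mu (cells P `&` setT))%E).
    apply: le_measure_cells => // i x [-> _].
    by rewrite mul1e setIT; exact: half.
  rewrite mul1e setIT; apply: (le_trans (lebn_le Pb')).
  rewrite lebn_box; last by move=> i; rewrite /b'/= !mxE; have := b12 i; lra.
  rewrite -EFinD lee_fin (le_trans _ le_e)// /box_volume le_eqVlt.
  apply/orP; left; apply/eqP; apply: eq_bigr => i _; rewrite /b'/= !mxE; lra.
have Bfn : mu B \is a fin_num by rewrite ge0_fin_numE.
have H2 : (2%:E * mu B <= mu B)%E.
  apply/lee_addgt0Pr => e e0.
  have [_ [C [Cle BC] <-] Clt] := lb_ereal_inf_adherent e0 Bfn.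
  apply: le_trans (ltW Clt).
  apply: (@le_trans _ _ (2%:E * \sum_(0 <= k <oo) mu (box (C k) `&` B)))%E.
    rewrite lee_pmul2l//; apply: measure_sigma_subadditive => //.
      by move=> k; apply: measurableI => //; exact: measurable_box.
    by move=> x Bx; have [k _ Ckx] := BC _ Bx; exists k.
  rewrite -nneseriesZl; last by move=> k _; exact: measure_ge0.
  by apply: lee_nneseries => [k _ _|k _]; [rewrite mule_ge0|exact: Hbox].
move: H2; rewrite -(fineK Bfn) -EFinM lee_fin => H2.
have : 0 <= fine (mu B) by exact: fine_ge0.
by move=> ?; congr EFin; lra.
Qed.

End grid.

(** * Translated grids *)

Section shifted_grids.
Context (R : realType) (n : nat) (o : 'rV[R]_n.+1) (L : R).
Context (L0 : 0 < L).
Local Notation Rn := 'rV[R]_n.+1.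

Definition shift_origin (u : {ffun 'I_n.+1 -> bool}) : Rn :=
  \row_i (o 0 i + (if u i then L / 3 else 0)).

(** Since [2^j / 3] is a third or two thirds modulo 1, the integers and their translate by
    it stay at distance at least 1/3 from each other; an interval of length below
    1/3 misses one of the two sets. *)
Lemma floor_third_shift (j : nat) (t0 rho : R) : 0 <= rho -> 6 * rho < 1 ->
  exists b : bool, forall t, `|t - t0| <= rho ->
    Num.floor (t - (if b then 2 ^+ j / 3 else 0)) =
    Num.floor (t0 - (if b then 2 ^+ j / 3 else 0)).
Proof.
move=> rho0 rho6; pose m := Num.floor (t0 + rho).
have /andP[m1 m2] := floor_itv (t0 + rho); rewrite -/m intrD in m1 m2.
have [h|h] := leP m%:~R (t0 - rho).
  exists false => t; rewrite ler_norml !subr0 => /andP[h1 h2].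
  by transitivity m; [|symmetry]; apply: floor_def; rewrite intrD; lra.
pose q := (2 ^ j %/ 3)%N; pose e := (2 ^ j %% 3)%N.
have jE : 2 ^+ j = 3 * q%:R + e%:R :> R.
  by rewrite -natrX (divn_eq (2 ^ j) 3) natrD natrM -/q -/e; ring.
have e12 : e%:R = 1 :> R \/ e%:R = 2 :> R.
  have : (e < 3)%N by rewrite ltn_mod.
  have : e != 0%N.
    apply/eqP => e0; have : (3 %| 2 ^ j)%N by rewrite /dvdn -/e e0.
    by rewrite Euclid_dvdX// => /andP[].
  by case: (e) => [|[|[|k]]]// _ _; [left|right].
exists true => t; rewrite ler_norml => /andP[h1 h2].
transitivity (m - q%:Z - 1); [|symmetry]; apply: floor_def;
  by rewrite jE !(intrD, mulrN1z, intrN) -pmulrn; case: e12 => ->; lra.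
Qed.

(** The one-third trick, applied to each coordinate separately. *)
Lemma cube_sub_shifted_cell (c : Rn) (r : R) (j : nat) :
  0 <= r -> 3 * r < side L j ->
  exists u, cube c r `<=` cell (shift_origin u) L j c.
Proof.
move=> r0 rj.
have P2 : 0 < 2 ^+ j :> R by rewrite exprn_gt0.
pose rho := r / 2 * 2 ^+ j / L.
have rho0 : 0 <= rho by rewrite /rho divr_ge0 ?mulr_ge0// ?divr_ge0// ltW.
have rho6 : 6 * rho < 1.
  rewrite /rho mulrA ltr_pdivrMr// mul1r.
  by move: rj; rewrite /side ltr_pdivlMr//; lra.
have H i := @floor_third_shift j ((c 0 i - o 0 i) * 2 ^+ j / L) rho rho0 rho6.
have [u Hu] := choice H.
exists (finfun u) => y cy; apply/ffunP => i.
have yc : `|(y 0 i - o 0 i) * 2 ^+ j / L - (c 0 i - o 0 i) * 2 ^+ j / L| <= rho.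
  have -> : (y 0 i - o 0 i) * 2 ^+ j / L - (c 0 i - o 0 i) * 2 ^+ j / L =
            (y 0 i - c 0 i) * (2 ^+ j / L) by field; rewrite gt_eqF.
  rewrite normrM [X in _ * X]gtr0_norm ?divr_gt0// /rho -[leRHS]mulrA.
  by rewrite ler_pM2r ?divr_gt0//; exact: cy.
have := Hu i _ yc; rewrite !ffunE /shift_origin !mxE ffunE.
have E z : (z - (o 0 i + (if u i then L / 3 else 0))) * 2 ^+ j / L =
    (z - o 0 i) * 2 ^+ j / L - (if u i then 2 ^+ j / 3 else 0).
  by case: (u i); field; rewrite gt_eqF.
by rewrite !E.
Qed.

Lemma exists_side (r : R) : 0 < r -> r < L ->
  exists2 j : nat, r < side L j & side L j <= 2 * r.
Proof.
move=> r0 rL.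
have ex : exists j, side L j.+1 <= r.
  have B0 : 0 <= L / r by rewrite divr_ge0// ltW.
  exists (Num.bound (L / r)); have := archi_boundP B0; set N := Num.bound _ => LN.
  rewrite /side ler_pdivrMr ?exprn_gt0//.
  rewrite ltr_pdivrMr// in LN.
  have : N%:R <= 2 ^+ N.+1 :> R.
    by rewrite -natrX ler_nat (leq_trans (ltnW (ltn_expl _ (ltnSn 1))))// leq_exp2l.
  by nra.
have [j jr jmin] := ex_minnP ex.
exists j; last by rewrite (sideS L); lra.
case: j jr jmin => [|j] jr jmin; first by rewrite /side expr0 divr1.
rewrite ltNge; apply/negP => h; have := jmin _ h.
by rewrite ltnn.
Qed.

End shifted_grids.

(** * The Euclidean norm and the cubes *)

Section euclidean_norm.
Context (R : realType) (n : nat).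
Local Notation Rn := 'rV[R]_n.+1.
Local Notation mu := (@lebn R n).
Implicit Types x y : Rn.

Lemma ler_coord_enorm x i : `|x 0 i| <= enorm x.
Proof.
rewrite -sqrtr_sqr /enorm ler_sqrt; last by apply: sumr_ge0 => j _; exact: sqr_ge0.
by rewrite (bigD1 i)//= lerDl sumr_ge0// => j _; exact: sqr_ge0.
Qed.

Lemma enorm_gt0 x : x != 0 -> 0 < enorm x.
Proof.
move=> x0; have [i xi] : exists i, x 0 i != 0.
  apply: contra_notP (negP x0) => h; apply/eqP/rowP => i; rewrite mxE.
  by apply: contra_notP h => /eqP xi; exists i.
by apply: lt_le_trans (ler_coord_enorm x i); rewrite normr_gt0.
Qed.

Lemma enorm_coord_vector (a : R) : enorm (a *: delta_mx 0 0 : Rn) = `|a|.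
Proof.
rewrite /enorm (bigD1 0)//= big1 ?addr0; last first.
  by move=> i i0; rewrite !mxE (negPf i0) andbF mulr0 expr0n.
by rewrite !mxE !eqxx mulr1 sqrtr_sqr.
Qed.

Lemma measurable_enormB x : measurable_fun setT (fun y : Rn => enorm (x - y)).
Proof.
apply: (@measurableT_comp _ _ _ _ _ _ (@Num.sqrt R)).
  by apply: continuous_measurable_fun; exact: sqrt_continuous.
apply: measurable_sum => i; apply: measurable_funX.
rewrite (_ : (fun y => _) = (fun y : Rn => x 0 i - y 0 i)); last first.
  by apply/funext => y; rewrite !mxE.
by apply: measurable_funB; [exact: measurable_cst|exact: measurable_coord].
Qed.

Lemma cube_le (a : Rn) (l l' : R) : l <= l' -> cube a l `<=` cube a l'.
Proof. by move=> ll' x xa i; apply: le_trans (xa i) _; rewrite ler_pM2r. Qed.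

Lemma enorm_outside_cube (a : Rn) (l l' : R) x y : cube a l x ->
  ~ cube a l' y -> (l' - l) / 2 < enorm (x - y).
Proof.
move=> xa /existsNP[i] /negP; rewrite -ltNge => yi.
apply: lt_le_trans (ler_coord_enorm _ i); rewrite !mxE.
have : `|y 0 i - a 0 i| <= `|x 0 i - a 0 i| + `|x 0 i - y 0 i|.
  by rewrite (_ : y 0 i - a 0 i = (x 0 i - a 0 i) - (x 0 i - y 0 i)) ?ler_normB//; ring.
by have := xa i; lra.
Qed.

End euclidean_norm.

(** * The modulus of continuity of the kernel *)

Section modulus.
Context (R : realType) (n : nat).
Local Notation Rn := 'rV[R]_n.+1.
Local Notation mu := (@lebn R n).
Context (k : Rn -> Rn -> R) (omega : R -> R) (cn : R).
Context (cn_const : @cube_ratio_constant R n cn).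
Context (omega_incr : forall x y : R, 0 < x -> x <= y -> omega x <= omega y).
Context (k_reg : kernel_regularity k omega).

Let e0 : Rn := delta_mx 0 0.

Let test_points (rho : R) : 0 < rho -> rho <= 2^-1 ->
  [/\ cube (0 : Rn) 1 0, cube (0 : Rn) 1 (rho *: e0), ~ cube (0 : Rn) (2 * 1) (2 *: e0),
    (0 : Rn) != rho *: e0 & enorm (0 - rho *: e0 : Rn) / enorm (0 - 2 *: e0 : Rn) = rho / 2].
Proof.
move=> rho0 rho1.
have E a : enorm (0 - a *: e0 : Rn) = `|a|.
  by rewrite sub0r -scaleNr enorm_coord_vector normrN.
split.
- by move=> i; rewrite !mxE subrr normr0 divr_ge0.
- move=> i; rewrite !mxE subr0 normrM (ger0_norm (ltW rho0)).
  rewrite (le_trans (ler_pM _ _ (lexx _) (_ : _ <= 1))) ?(ltW rho0)//.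
    by case: (i == 0); rewrite ?normr1 ?normr0.
  by rewrite mulr1 mul1r.
- by move=> /(_ 0); rewrite !mxE/= subr0 !mulr1 ger0_norm//; lra.
- apply/eqP => /rowP/(_ 0); rewrite !mxE eqxx mulr1 => h.
  by move: rho0; rewrite -h ltxx.
- by rewrite !E !ger0_norm// ltW.
Qed.

(** The kernel estimate bounds an absolute value from above, and is available for
    points in which the modulus is taken at arbitrarily small arguments. *)
Lemma modulus_ge0 (tau : R) : 0 < tau -> 0 <= omega tau.
Proof.
move=> tau0; pose rho := Num.min tau 2^-1.
have rho0 : 0 < rho by rewrite lt_min tau0 invr_gt0 ltr0n.
have rho1 : rho <= 2^-1 by rewrite ge_min lexx orbT.
have [h1 h2 h3 h4 h5] := test_points rho0 rho1.
have [c c0 /(_ 0 1 _ _ _ ltr01 h1 h2 h3 h4)] := k_reg.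
rewrite h5 => /(le_trans (normr_ge0 _)).
have r2 : 0 < rho / 2 by rewrite divr_gt0.
have E : 0 < enorm (0 - 2 *: e0 : Rn).
  by rewrite sub0r -scaleNr enorm_coord_vector normrN normr_gt0 pnatr_eq0.
rewrite pmulr_rge0; last by rewrite divr_gt0// exprn_gt0.
move=> /le_trans; apply; apply: omega_incr => //.
have : rho <= tau by rewrite ge_min lexx.
lra.
Qed.

Lemma cube_ratio_constant_gt0 : 0 < cn.
Proof.
have rho0 : (0 : R) < 2^-1 by rewrite invr_gt0 ltr0n.
have [h1 h2 h3 h4 h5] := test_points rho0 (lexx _).
have := cn_const ltr01 (isT : (0 < 1)%N) h1 h2; rewrite expr1 => /(_ _ h3).
rewrite h5; lra.
Qed.

(** On the dyadic interval between [2^-(m+1)] and [2^-m] the integrand is at least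
    [omega (cn 2^-(m+1)) 2^m], by monotonicity. *)
Lemma dini_series :
  (\int[lebesgue_measure]_(tau in `]0%R, 1%R[) (omega (cn * tau) / tau)%:E < +oo)%E ->
  (\sum_(0 <= m <oo) (omega (cn * 2 ^- m.+1))%:E < +oo)%E.
Proof.
move=> dini; have cn0 := cube_ratio_constant_gt0.
have P2 m : 0 < 2 ^+ m :> R by rewrite exprn_gt0.
pose I (m : nat) : set R := `]2 ^- m.+1, 2 ^- m[%classic.
have mI m : measurable (I m) by exact: measurable_itv.
have muI m : (lebesgue_measure (I m) = (2 ^- m.+1)%:E)%E.
  rewrite [LHS]lebesgue_measure_itv/= lte_fin.
  have E : 2 ^- m - 2 ^- m.+1 = 2 ^- m.+1 :> R by rewrite exprS; field; rewrite gt_eqF.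
  have lt2 : 2 ^- m.+1 < 2 ^- m :> R by rewrite -subr_gt0 E invr_gt0.
  by rewrite lt2 -EFinB E.
pose D01 : set R := `]0%R, 1%R[%classic.
have mD : measurable D01 by exact: measurable_itv.
pose f (tau : R) := omega (cn * tau) / tau.
have I01 : \bigcup_m I m `<=` D01.
  move=> t [m _]; rewrite /I/D01/= !in_itv/= => /andP[h1 h2].
  rewrite (lt_trans _ h1) ?invr_gt0//= (lt_le_trans h2)//.
  by rewrite invf_le1// exprn_ege1// ler1n.
have f0 t : D01 t -> (0 <= (f t)%:E)%E.
  rewrite /D01/= in_itv/= => /andP[t0 _]; rewrite lee_fin divr_ge0 ?(ltW t0)//.
  by rewrite modulus_ge0// mulr_gt0.
have mf : measurable_fun D01 (EFin \o f).
  apply/measurable_EFinP.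
  pose F t := if 0 < t then omega (cn * t) else 0.
  apply: (@eq_measurable_fun _ _ _ _ _ (fun t => F t * t `^ (-1))).
    move=> t; rewrite inE/D01/= in_itv/= => /andP[t0 _].
    by rewrite /F t0 powR_inv1 ?ltW.
  apply: measurable_funM; last by apply: measurable_funTS; exact: measurable_powR.
  apply: nondecreasing_measurable => // x y xy; rewrite /F.
  case: ltP => x0; case: ltP => y0 //.
  - by apply: omega_incr; [exact: mulr_gt0|rewrite ler_pM2l].
  - by have := lt_le_trans x0 xy; rewrite ltNge y0.
  - by rewrite modulus_ge0// mulr_gt0.
have trI : trivIset setT I.
  suff H i j t : (i < j)%N -> I i t -> I j t -> False.
    apply/trivIsetP => i j _ _ ij; apply/seteqP; split => // t [ti tj].
    by case: (ltngtP i j) ij => // ij _; [exact: H ij ti tj|exact: H ij tj ti].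
  move=> ij; rewrite /I/= !in_itv/= => /andP[h1 _] /andP[_ h2].
  have := lt_trans h1 h2; rewrite ltf_pV2 ?posrE//.
  by rewrite ltNge ler_weXn2l// ler1n.
have mU : measurable (\bigcup_m I m) by exact: bigcup_measurable.
have : (2^-1%:E * \sum_(0 <= m <oo) (omega (cn * 2 ^- m.+1))%:E < +oo)%E.
  apply: le_lt_trans dini.
  apply: (@le_trans _ _ (\int[lebesgue_measure]_(tau in \bigcup_m I m) (f tau)%:E)%E); last first.
    by apply: ge0_subset_integral.
  rewrite ge0_integral_bigcup//; last 2 first.
  - by apply: measurable_funS mf.
  - by move=> t /I01; exact: f0.
  rewrite -nneseriesZl; last first.
    by move=> m _; rewrite lee_fin modulus_ge0// mulr_gt0// invr_gt0.
  apply: lee_nneseries => m _.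
    by move=> _; rewrite mule_ge0// lee_fin modulus_ge0// mulr_gt0// invr_gt0.
  apply: (@le_trans _ _ (\int[lebesgue_measure]_(tau in I m)
      (cst (omega (cn * 2 ^- m.+1) * 2 ^+ m)%:E) tau)%E).
    rewrite [leRHS]integral_cst; last exact: mI.
    rewrite [X in (_ <= _ * X)%E]muI -!EFinM lee_fin.
    rewrite exprS invfM le_eqVlt; apply/orP; left; apply/eqP.
    by field; rewrite gt_eqF.
  apply: ge0_le_integral; [exact: mI| |exact: measurable_cst| |].
  - move=> t _; rewrite lee_fin mulr_ge0 ?(ltW (P2 m))//.
    by rewrite modulus_ge0// mulr_gt0// invr_gt0.
  - apply: measurable_funS mf => //.
    by move=> t It; apply: I01; exists m.
  - move=> t It; rewrite lee_fin /f.
    move: (It); rewrite /I/= in_itv/= => /andP[h1 h2].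
    have t0 : 0 < t by apply: lt_trans h1; rewrite invr_gt0.
    apply: ler_pM.
    + by rewrite modulus_ge0// mulr_gt0// invr_gt0.
    + exact: ltW.
    + by apply: omega_incr; [rewrite mulr_gt0// invr_gt0|rewrite ler_pM2l// ltW].
    + by rewrite -[leLHS]invrK lef_pV2 ?posrE ?invr_gt0// ltW.
case: (\sum_(0 <= m <oo) _)%E => [r _||//]; first exact: ltry.
by rewrite gt0_muley ?lte_fin ?invr_gt0// ltxx.
Qed.

End modulus.

(** * Oscillation of a singular integral on one cube *)

Section local_oscillation.
Context (R : realType) (n : nat).
Local Notation Rn := 'rV[R]_n.+1.
Local Notation mu := (@lebn R n).
Local Notation d := n.+1.
Context (k : Rn -> Rn -> R) (omega : R -> R) (cn : R).
Context (cn_const : @cube_ratio_constant R n cn).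
Context (omega_incr : forall x y : R, 0 < x -> x <= y -> omega x <= omega y).
Context (k_reg : kernel_regularity k omega).
Context (omega_dini : (\int[lebesgue_measure]_(tau in `]0%R, 1%R[)
                   (omega (cn * tau) / tau)%:E < +oo)%E).

Definition dyadic_average_bound (f : Rn -> R) (c : Rn) (r G : R) :=
  forall m, (\int[mu]_(y in cube c (2 ^+ m.+1 * r)) `|f y|%:E <=
             (G * (2 ^+ m.+1 * r) ^+ d)%:E)%E.

Lemma annulus_index (c : Rn) (r : R) (y : Rn) : 0 < r -> ~ cube c (2 * r) y ->
  exists m, ~ cube c (2 ^+ m.+1 * r) y /\ cube c (2 ^+ m.+2 * r) y.
Proof.
move=> r0 y2.
have ex : exists m, `[< cube c (2 ^+ m * r) y >].
  pose B := \sum_i `|y 0 i - c 0 i|.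
  have B0 : 0 <= B by apply: sumr_ge0.
  have B1 : 0 <= 2 * B / r by rewrite divr_ge0 ?mulr_ge0// ltW.
  exists (Num.bound (2 * B / r)); apply/asboolP => i.
  have := archi_boundP B1; set N := Num.bound _; rewrite ltr_pdivrMr// => BN.
  have N2 : N%:R * r <= 2 ^+ N * r.
    by rewrite ler_pM2r// -natrX ler_nat ltnW// ltn_expl.
  have yB : `|y 0 i - c 0 i| <= B by rewrite /B (bigD1 i)//= lerDl sumr_ge0.
  rewrite ler_pdivlMr// mulrC; apply: le_trans (le_trans (ltW BN) N2).
  by rewrite ler_pM2l.
have [M /asboolP yM Mmin] := ex_minnP ex.
have sub m : (M <= m)%N -> cube c (2 ^+ m * r) y.
  move=> Mm; apply: cube_le yM; rewrite ler_pM2r// ler_weXn2l// ler1n//.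
have M2 : (1 < M)%N.
  by rewrite ltnNge; apply/negP => /sub; rewrite expr1.
exists (M - 2)%N; case: M M2 yM Mmin sub ex => [|[|M]]// _ yM Mmin sub ex.
rewrite subn2/=; split=> // yM1.
have /Mmin : `[< cube c (2 ^+ M.+1 * r) y >] by exact/asboolP.
by rewrite ltnn.
Qed.

(** Off the dilated cube, y has distance comparable to [2^m.+1 r] from x, and [cn] was
    introduced to bound the argument of the modulus. *)
Lemma kernel_annulus_bound : exists2 C : R, 0 < C &
  forall (c : Rn) (r : R) (x x' y : Rn) m, 0 < r -> cube c r x -> cube c r x' ->
    ~ cube c (2 ^+ m.+1 * r) y ->
    `|k x y - k x' y| <= C * omega (cn * 2 ^- m.+1) / (2 ^+ m.+1 * r) ^+ d.
Proof.
have [C C0 kC] := k_reg.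
have cn0 := cube_ratio_constant_gt0 cn_const.
exists (C * 4 ^+ d); first by rewrite mulr_gt0// exprn_gt0.
move=> c r x x' y m r0 xQ x'Q yQ.
have rm0 : 0 < 2 ^+ m.+1 * r by rewrite mulr_gt0// exprn_gt0.
have cm0 : 0 < cn * 2 ^- m.+1 by rewrite mulr_gt0// invr_gt0 exprn_gt0.
have om0 : 0 <= omega (cn * 2 ^- m.+1) by exact: (modulus_ge0 omega_incr k_reg).
have [->|xx'] := eqVneq x x'.
  by rewrite subrr normr0 divr_ge0// ?exprn_ge0 ?(ltW rm0)// mulr_ge0// mulr_ge0 ?(ltW C0)// exprn_ge0.
have y2 : ~ cube c (2 * r) y.
  apply: contra_not yQ; apply: cube_le; rewrite ler_pM2r// exprS ler_peMr//.
  by rewrite exprn_ege1// ler1n.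
(* The factor 4 is lost when m = 0, where the double cube is only r / 2 away. *)
have dist : (2 ^+ m.+1 * r) / 4 <= enorm (x - y).
  apply: le_trans (ltW (enorm_outside_cube xQ yQ)).
  have : 1 <= 2 ^+ m :> R by rewrite exprn_ege1// ler1n.
  by rewrite exprS; nra.
have dist0 : 0 < enorm (x - y) by apply: lt_le_trans dist; rewrite divr_gt0.
have xx0 : 0 < enorm (x - x') by apply: enorm_gt0; rewrite subr_eq0.
apply: le_trans (kC _ _ _ _ _ r0 xQ x'Q y2 xx') _.
have om1 : omega (enorm (x - x') / enorm (x - y)) <= omega (cn * 2 ^- m.+1).
  by apply: omega_incr; [exact: divr_gt0|exact: (cn_const r0 (ltn0Sn m) xQ x'Q yQ)].
have E1 : (enorm (x - y) ^+ d)^-1 <= 4 ^+ d / (2 ^+ m.+1 * r) ^+ d.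
  rewrite -expr_div_n -exprVn lerXn2r// ?nnegrE ?invr_ge0 ?(ltW dist0)//.
    by rewrite divr_ge0// ltW.
  by rewrite -[leRHS]invrK invf_div lef_pV2// posrE// divr_gt0.
apply: (@le_trans _ _ (C * ((4 ^+ d / (2 ^+ m.+1 * r) ^+ d) * omega (cn * 2 ^- m.+1)))).
  rewrite -mulrA ler_pM2l//; apply: ler_pM => //.
    by rewrite invr_ge0 exprn_ge0// ltW.
  by apply: (modulus_ge0 omega_incr k_reg); exact: divr_gt0.
by rewrite le_eqVlt; apply/orP; left; apply/eqP; ring.
Qed.

(** Each dyadic annulus around the cube contributes the modulus at [cn 2^-(m+1)]
    times an average of [|f|], and these moduli are summable by the Dini condition. *)
Lemma tail_oscillation : exists2 K : R, 0 < K &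
  forall (f : Rn -> R) (c : Rn) (r G : R) (x x' : Rn), 0 < r -> 0 <= G ->
    measurable_fun setT f -> dyadic_average_bound f c r G ->
    cube c r x -> cube c r x' ->
    mu.-integrable (~` cube c (2 * r)) (fun y => (k x y * f y)%:E) ->
    mu.-integrable (~` cube c (2 * r)) (fun y => (k x' y * f y)%:E) ->
    (`|\int[mu]_(y in ~` cube c (2 * r)) (k x y * f y)%:E -
       \int[mu]_(y in ~` cube c (2 * r)) (k x' y * f y)%:E| <= (K * G)%:E)%E.
Proof.
have [C C0 kC] := kernel_annulus_bound.
have cn0 := cube_ratio_constant_gt0 cn_const.
pose om m := omega (cn * 2 ^- m.+1).
have om0 m : 0 <= om m.
  by apply: (modulus_ge0 omega_incr k_reg); rewrite mulr_gt0// invr_gt0 exprn_gt0.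
have := dini_series cn_const omega_incr k_reg omega_dini; rewrite -/om => Wfin.
pose W := fine (\sum_(0 <= m <oo) (om m)%:E)%E.
have W0 : 0 <= W.
  by apply: fine_ge0; apply: nneseries_ge0 => m _ _; rewrite lee_fin; exact: om0.
have WE : (\sum_(0 <= m <oo) (om m)%:E = W%:E)%E.
  rewrite fineK// ge0_fin_numE//.
  by apply: nneseries_ge0 => m _ _; rewrite lee_fin; exact: om0.
exists (C * 2 ^+ d * (W + 1)); first by rewrite !mulr_gt0 ?exprn_gt0// ltr_wpDl.
move=> f c r G x x' r0 G0 mf fG xQ x'Q ix ix'.
set D := ~` _; have mD : measurable D by apply: measurableC; exact: measurable_cube.
have rm0 m : 0 < 2 ^+ m * r by rewrite mulr_gt0// exprn_gt0.
pose a m := C * om m / (2 ^+ m.+1 * r) ^+ d.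
have a0 m : 0 <= a m.
  by rewrite divr_ge0 ?exprn_ge0 ?(ltW (rm0 _))// mulr_ge0 ?(ltW C0)//; exact: om0.
pose Q m := cube c (2 ^+ m.+2 * r).
have mQ m : measurable (Q m) by exact: measurable_cube.
pose term m (y : Rn) : \bar R := ((a m)%:E * (`|f y|%:E * (\1_(Q m) y)%:E))%E.
have term0 m y : (0 <= term m y)%E.
  by rewrite /term !mule_ge0// lee_fin ?indicE.
have mfabs : measurable_fun setT (fun y => `|f y|%:E).
  by apply/measurable_EFinP; apply: measurableT_comp.
have mterm m B : measurable B -> measurable_fun B (term m).
  move=> mB; apply: measurable_funTS; apply: emeasurable_funM; first exact: measurable_cst.
  apply: emeasurable_funM; first exact: mfabs.
  by apply/measurable_EFinP; exact: measurable_indic.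
rewrite -integralB//; under eq_integral do rewrite -EFinB.
have mdiff : measurable_fun D (fun y => (k x y * f y - k x' y * f y)%:E).
  apply/measurable_EFinP; apply: measurable_funB; apply/measurable_EFinP.
    exact: measurable_int ix.
  exact: measurable_int ix'.
apply: le_trans (le_abse_integral _ mD mdiff) _.
apply: (@le_trans _ _ (\int[mu]_(y in D) (\sum_(0 <= m <oo) term m y))%E).
  apply: ge0_le_integral; [exact: mD|by move=> y _; exact: abse_ge0| | |].
  - exact: measurableT_comp.
  - by apply: ge0_emeasurable_sum => [m y _ _|m _]; [exact: term0|exact: mterm].
  move=> y Dy; have [m [y1 y2]] := annulus_index r0 Dy.
  apply: (@le_trans _ _ (term m y)).
    rewrite /term indicE mem_set// mule1 -EFinM -mulrBl abse_EFin lee_fin normrM.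
    by apply: ler_wpM2r => //; exact: (kC c r).
  apply: (@le_trans _ _ (\sum_(0 <= j < m.+1) term j y)%E).
    by rewrite big_nat_recr//= leeDr// sume_ge0.
  exact: nneseries_lim_ge.
rewrite integral_nneseries//; last by move=> m; exact: mterm.
apply: (@le_trans _ _ (\sum_(0 <= m <oo) ((C * 2 ^+ d * G)%:E * (om m)%:E))%E).
  apply: lee_nneseries => m _; first by move=> _; apply: integral_ge0.
  have mfQ : measurable_fun setT (fun y => `|f y|%:E * (\1_(Q m) y)%:E)%E.
    apply: emeasurable_funM; first exact: mfabs.
    by apply/measurable_EFinP; exact: measurable_indic.
  have fQ0 y : (0 <= `|f y|%:E * (\1_(Q m) y)%:E)%E.
    by rewrite mule_ge0// lee_fin ?indicE.
  rewrite /term ge0_integralZl_EFin; last first.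
  - exact: a0.
  - exact: measurable_funTS.
  - by move=> y _; exact: fQ0.
  - exact: mD.
  apply: (@le_trans _ _ ((a m)%:E * (G * (2 ^+ m.+2 * r) ^+ d)%:E)%E).
    apply: lee_wpmul2l; first by rewrite lee_fin.
    apply: le_trans (fG m.+1).
    rewrite [leRHS](_ : _ = \int[mu]_(y in setT `&` Q m) `|f y|%:E)%E; last by rewrite setTI.
    rewrite integral_mkcondr.
    apply: (@le_trans _ _ (\int[mu]_y (`|f y|%:E * (\1_(Q m) y)%:E))%E).
      apply: ge0_subset_integral; [exact: mD|exact: measurableT|exact: mfQ| |].
        by move=> y _; exact: fQ0.
      exact: subsetT.
    rewrite le_eqVlt; apply/orP; left; apply/eqP; apply: eq_integral => y _.
    by rewrite epatch_indic.
  rewrite -!EFinM lee_fin /a [2 ^+ m.+2]exprS -(mulrA 2) [(2 * _) ^+ d]exprMn.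
  rewrite le_eqVlt; apply/orP; left; apply/eqP; field.
  by rewrite expf_neq0// gt_eqF.
rewrite nneseriesZl; last by move=> m _; rewrite lee_fin; exact: om0.
rewrite WE -EFinM lee_fin -mulrA [leRHS]mulrC mulrA.
have : 0 <= C * 2 ^+ d * G by rewrite !mulr_ge0 ?(ltW C0)// exprn_ge0.
by rewrite [leRHS]mulrC; nra.
Qed.

(** Truncations at a small distance leave the complement of the double cube untouched:
    there the principal value is an absolutely convergent integral. *)
Lemma pv_split (f : Rn -> R) (c x : Rn) (r h t : R) : 0 < r -> cube c r x ->
  pv_at k f x h -> pv_at k (fun y => f y * \1_(cube c (2 * r)) y) x t ->
  mu.-integrable (~` cube c (2 * r)) (fun y => (k x y * f y)%:E) /\
  (\int[mu]_(y in ~` cube c (2 * r)) (k x y * f y)%:E = (h - t)%:E)%E.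
Proof.
move=> r0 xQ [if_ f_h] [ig g_t].
pose D := ~` cube c (2 * r); have mD : measurable D by apply: measurableC; exact: measurable_cube.
pose S (e : R) : set Rn := [set y | e < enorm (x - y)].
have mS e : measurable (S e).
  rewrite (_ : S e = (fun y : Rn => enorm (x - y)) @^-1` `]e, +oo[).
    by rewrite -[X in measurable X]setTI; exact: measurable_enormB.
  by apply/seteqP; split => y /=; rewrite in_itv/= andbT.
have DS e : e < r / 2 -> D `<=` S e.
  move=> er y Dy; apply: lt_trans (enorm_outside_cube xQ Dy).
  by apply: (lt_le_trans er); lra.
have iD : mu.-integrable D (fun y => (k x y * f y)%:E).
  apply: (integrableS (mS (r / 4))) => //; first by apply: DS; lra.
  by apply: if_; lra.
split=> //.
have E e : 0 < e -> e < r / 2 ->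
    (\int[mu]_(y in D) (k x y * f y)%:E =
     \int[mu]_(y in S e) (k x y * f y)%:E -
     \int[mu]_(y in S e) (k x y * (f y * \1_(cube c (2 * r)) y))%:E)%E.
  move=> e0 er; have i1 := if_ _ e0; have i2 := ig _ e0.
  rewrite -[RHS](integralB (mS e) i1 i2).
  have -> : D = S e `&` D by rewrite setIC; apply/esym/setIidPl; exact: DS.
  rewrite integral_mkcondr; apply: eq_integral => y _.
  rewrite -EFinB indicE patchE.
  have [yQ|yQ] := pselect (cube c (2 * r) y).
    have -> : (y \in D) = false by apply/negbTE; rewrite notin_setE => /(_ yQ).
    by rewrite mem_set// mulr1 subrr.
  by rewrite (mem_set (yQ : D y)) memNset// !mulr0 subr0.
have : (\int[mu]_(y in S e) (k x y * f y)%:E -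
     \int[mu]_(y in S e) (k x y * (f y * \1_(cube c (2 * r)) y))%:E @[e --> 0^'+] -->
     h%:E - t%:E)%E.
  exact: cvgeB.
have : (\int[mu]_(y in S e) (k x y * f y)%:E -
     \int[mu]_(y in S e) (k x y * (f y * \1_(cube c (2 * r)) y))%:E @[e --> 0^'+] -->
     \int[mu]_(y in D) (k x y * f y)%:E)%E.
  apply: cvg_near_cst; near=> e; apply/esym/E.
    by near: e; exact: nbhs_right_gt.
  by near: e; apply: nbhs_right_lt; rewrite divr_gt0.
move=> h1 h2; apply: cvg_unique h1 _ => //.
Unshelve. all: by end_near. Qed.

(** The weak type bound makes the near part small off a set of measure
    [eta r^d], and the far part is nearly constant. Its value at any point where
    both principal values exist serves as the constant. *)
Lemma local_oscillation (T : (Rn -> R) -> Rn -> R) (eta : R) :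
  singular_integral k T -> weak_type11 T -> 0 < eta ->
  exists2 K : R, 0 < K &
  forall (f h : Rn -> R) (c : Rn) (r G : R), 0 < r -> 0 < G ->
    measurable_fun setT f -> pv_integral k f h -> dyadic_average_bound f c r G ->
    exists c0 : R,
      (mu [set x | cube c r x /\ (K * G < `|h x - c0|)%R] <= (eta * r ^+ d)%:E)%E.
Proof.
move=> Tsing [Cw Cw0 weak] eta0; have [Kt Kt0 tail] := tail_oscillation.
pose K' := Cw * 2 ^+ d / eta.
have K'0 : 0 < K' by rewrite divr_gt0// mulr_gt0// exprn_gt0.
exists (Kt + K'); first exact: addr_gt0.
move=> f h c r G r0 G0 mf [mh aeh] fG.
pose Q2 := cube c (2 * r); have mQ2 : measurable Q2 by exact: measurable_cube.
pose f1 y := f y * \1_Q2 y.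
have mf1 : measurable_fun setT f1.
  by apply: measurable_funM; [exact: mf|exact: measurable_indic].
have f1E : (\int[mu]_y `|f1 y|%:E <= (G * (2 * r) ^+ d)%:E)%E.
  apply: le_trans (fG 0%N); rewrite expr1 -/Q2.
  rewrite [leRHS](_ : _ = \int[mu]_(y in setT `&` Q2) `|f y|%:E)%E; last by rewrite setTI.
  rewrite integral_mkcondr le_eqVlt; apply/orP; left; apply/eqP; apply: eq_integral => y _.
  by rewrite epatch_indic /f1 normrM EFinM [X in (_ * X%:E)%E]ger0_norm// indicE ler0n.
have if1 : mu.-integrable setT (EFin \o f1).
  apply/integrableP; split; first exact/measurable_EFinP.
  by apply: le_lt_trans f1E _; rewrite ltry.
have [mTf1 aeT] := Tsing _ if1.
have [N [mN N0 subN]] : {ae mu, forall x, pv_at k f x (h x) /\ pv_at k f1 x (T f1 x)}.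
  by move: aeh aeT; apply: filterS2.
pose J x := (\int[mu]_(y in ~` Q2) (k x y * f y)%:E)%E.
have good x : cube c r x -> ~ N x ->
    mu.-integrable (~` Q2) (fun y => (k x y * f y)%:E) /\ J x = (h x - T f1 x)%:E.
  move=> xQ xN; have [h1 h2] : pv_at k f x (h x) /\ pv_at k f1 x (T f1 x).
    by apply: contrapT => hx; apply/xN/subN.
  exact: pv_split h1 h2.
have [x0 [x0Q x0N]] : exists x0, cube c r x0 /\ ~ N x0.
  apply: contrapT => /forallNP H.
  have : (mu (cube c r) <= mu N)%E.
    by apply: lebn_le => x xQ; apply: contrapT => xN; apply: (H x).
  rewrite N0 lebn_cube ?(ltW r0)// lee_fin leNgt.
  by rewrite exprn_gt0.
have [ix0 Jx0] := good _ x0Q x0N.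
(* This is the far part of the principal value at x0. *)
exists (h x0 - T f1 x0).
pose W : set Rn := [set x | K' * G < `|T f1 x|].
have mW : measurable W.
  rewrite (_ : W = (fun x => `|T f1 x|) @^-1` `]K' * G, +oo[).
    by rewrite -[X in measurable X]setTI; apply: measurableT_comp.
  by apply/seteqP; split => x /=; rewrite in_itv/= andbT.
apply: (@le_trans _ _ (mu (N `|` W))).
  apply: lebn_le => x [xQ hx]; have [xN|xN] := pselect (N x); [by left|right].
  have [ix Jx] := good _ xQ xN.
  have := tail f c r G x x0 r0 (ltW G0) mf fG xQ x0Q ix ix0.
  rewrite -/Q2 -/(J x) -/(J x0) Jx Jx0 -EFinB abse_EFin lee_fin => tl.
  rewrite /W/=.
  have E : h x - (h x0 - T f1 x0) = T f1 x + (h x - T f1 x - (h x0 - T f1 x0)) by ring.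
  have := ler_normD (T f1 x) (h x - T f1 x - (h x0 - T f1 x0)).
  by rewrite -E; rewrite mulrDl in hx; lra.
have NW : (mu (N `|` W) <= mu N + mu W)%E by exact: measureU2.
apply: le_trans NW _; rewrite N0 add0e.
have KG0 : 0 < K' * G by rewrite mulr_gt0.
have := weak _ if1 _ KG0; rewrite -/W => wk.
rewrite -(@lee_pmul2l _ (K' * G)%:E)//.
apply: le_trans wk _.
apply: (@le_trans _ _ (Cw%:E * (G * (2 * r) ^+ d)%:E)%E).
  by rewrite lee_pmul2l.
rewrite -!EFinM lee_fin /K' exprMn le_eqVlt; apply/orP; left; apply/eqP; field.
by rewrite gt_eqF.
Qed.

End local_oscillation.

(** * Sparse domination *)

Section stopping_cubes.
Context (R : realType) (n : nat) (o : 'rV[R]_n.+1) (l : R).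
Context (l0 : 0 < l).
Local Notation Rn := 'rV[R]_n.+1.
Local Notation mu := (@lebn R n).
Local Notation B := (cell o l).
Context (x0 : Rn) (h : Rn -> R) (A : set Rn -> R) (eta : R).
Local Notation Q0 := (B 0 x0).
Context (mh : measurable_fun setT h).
Context (A0 : forall S, 0 <= A S).
Context (A_mono : forall i j x, Q0 x -> (i <= j)%N -> A (B i x) <= A (B j x)).
Context (eta0 : 0 < eta) (eta1 : eta * (1 + 2 ^+ n.+1) < 1).
Context (osc : forall j x, Q0 x -> exists c : R,
  (mu [set y | B j x y /\ (A (B j x) < `|h y - c|)%R] <= eta%:E * mu (B j x))%E).

Let eta_small : 3 * eta < 1.
Proof.
have h2 : 2 <= 2 ^+ n.+1 :> R by rewrite exprS ler_peMr// exprn_ege1// ler1n.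
have : eta * (1 + 2) <= eta * (1 + 2 ^+ n.+1) by rewrite ler_pM2l// lerD2l.
by move=> /le_lt_trans/(_ eta1); lra.
Qed.

Definition center_value (S : set Rn) : R :=
  xget 0 [set c : R | (mu [set y | S y /\ (A S < `|h y - c|)%R] <= eta%:E * mu S)%E].

Definition bad (S : set Rn) : set Rn :=
  [set y | S y /\ A S < `|h y - center_value S|].

Lemma lebn_bad_le j x : Q0 x -> (mu (bad (B j x)) <= eta%:E * mu (B j x))%E.
Proof.
move=> /(osc j) [c hc]; rewrite /bad /center_value.
by case: xgetP => [c' _ h'|/(_ c)]; [exact: h'|move=> /(_ hc)].
Qed.

Lemma measurable_bad j x : measurable (bad (B j x)).
Proof.
rewrite (_ : bad _ = B j x `&`
    (fun y => `|h y - center_value (B j x)|) @^-1` `]A (B j x), +oo[); last first.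
  by apply/seteqP; split => y /=; rewrite in_itv/= andbT.
have mhc : measurable_fun setT (fun y => `|h y - center_value (B j x)|).
  apply: (measurableT_comp (@normr_measurable R setT)).
  by apply: measurable_funB; [exact: mh|exact: measurable_cst].
apply: measurableI; first exact: measurable_cell.
by rewrite -[X in measurable X]setTI; exact: (mhc measurableT _ (measurable_itv _)).
Qed.

Lemma bad_sub S : bad S `<=` S. Proof. by move=> y []. Qed.

(** A one-constructor wrapper, which keeps unification from unfolding the outer measure
    in the inequality. *)
Variant dense (i j : nat) (x : Rn) : Prop :=
  Dense of (mu (B j x) < 2%:E * mu (B j x `&` bad (B i x)))%E.

(** The maximal proper subcells more than half filled by the bad set of the cell of
    level i. *)
Definition child (i j : nat) (x : Rn) : Prop :=
  [/\ (i < j)%N, dense i j x & forall j', (i < j' < j)%N -> ~ dense i j' x].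

Fixpoint generation (g j : nat) (x : Rn) : Prop :=
  if g is g'.+1 then exists2 i, generation g' i x & child i j x
  else j = 0%N /\ Q0 x.

Definition layer (g : nat) : set Rn := cells (generation g).

Lemma dense_invariant i j x y : (i <= j)%N -> B j x y -> dense i j x -> dense i j y.
Proof.
move=> ij xy [dx]; constructor.
by rewrite (cell_eq xy) (cell_eq (cell_nest ij xy)); exact: dx.
Qed.

Lemma child_invariant i : cell_invariant o l (child i).
Proof.
move=> j x y xy [ij dij nd]; split=> //; first exact: (dense_invariant (ltnW ij) xy).
move=> j' /andP[ij' j'j] dj'; apply: (nd j'); first by rewrite ij'.
have yx : B j' y x by apply/(cell_nest (ltnW j'j))/cell_sym.
exact: (dense_invariant (ltnW ij') yx).
Qed.

Lemma child_unique i : level_unique (child i).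
Proof.
move=> j j' x [ij dj nj] [ij' dj' nj'].
case: (ltngtP j j') => // jj.
- by case: (nj' j) => //; rewrite ij.
- by case: (nj j') => //; rewrite ij'.
Qed.

Lemma cell_sub_root j x : Q0 x -> B j x `<=` Q0.
Proof. by move=> x00; rewrite -(cell_eq x00); exact: cell_nest. Qed.

Lemma generation_root g j x : generation g j x -> Q0 x.
Proof. by elim: g j => [|g IH] j /=; [case|move=> [i /IH]]. Qed.

Lemma generation_invariant g : cell_invariant o l (generation g).
Proof.
elim: g => [|g IH] j x y xy /=.
  by move=> [-> x00]; split=> //; apply: cell_sub_root xy.
move=> [i gi ci]; exists i; last exact: child_invariant ci.
by apply: IH gi; apply: (cell_nest _ xy); case: ci => /ltnW.
Qed.

Lemma generation_unique g : level_unique (generation g).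
Proof.
elim: g => [|g IH] i j x /=; first by move=> [-> _] [-> _].
move=> [i' gi ci] [j' gj cj]; move: cj; rewrite -(IH _ _ _ gi gj) => cj.
exact: child_unique ci cj.
Qed.

Lemma measurable_layer g : measurable (layer g).
Proof. by apply: (@measurable_cells _ _ o l) => //; exact: generation_invariant. Qed.

Lemma layerS g : layer g.+1 `<=` layer g.
Proof. by move=> x [j [i gi _]]; exists i. Qed.

Lemma generation_le g m i j x : generation g i x -> generation (g + m) j x -> (i <= j)%N.
Proof.
elim: m j => [|m IH] j gi; first by rewrite addn0 => /(generation_unique gi) ->.
rewrite addnS /= => -[i' gi' [ii' _ _]].
exact: leq_trans (IH _ gi gi') (ltnW ii').
Qed.

(** The children are disjoint and more than half filled by a set of proportion [eta]. *)
Lemma lebn_children_le g i x : generation g i x ->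
  (mu (B i x `&` layer g.+1) <= (2 * eta)%:E * mu (B i x))%E.
Proof.
move=> gi; have x00 := generation_root gi.
pose P j y := B i x y /\ child i j y.
have E : B i x `&` layer g.+1 = cells P.
  apply/seteqP; split => y.
    move=> [xy [j [i' gi' ci]]]; exists j; split=> //.
    by rewrite (generation_unique (generation_invariant xy gi) gi').
  move=> [j [xy cj]]; split=> //; exists j; exists i => //.
  exact: generation_invariant xy gi.
have Pinv : cell_invariant o l P.
  move=> j y z yz [xy cj]; split; last exact: child_invariant cj.
  rewrite -(cell_eq xy); apply: (cell_nest _ yz).
  by case: cj => /ltnW.
have Puniq : level_unique P by move=> j j' y [_ cj] [_ cj']; exact: child_unique cj cj'.
have mb := measurable_bad i x.
have := @le_measure_cells _ _ o l l0 P 1 2 setT (bad (B i x)) ler01 (ler0n _ _)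
  Pinv Puniq measurableT mb.
rewrite E mul1e setIT => /(_ _)/le_trans; apply.
  move=> j y [xy [ij [dj] _]]; rewrite mul1e setIT; apply: ltW.
  by rewrite -(cell_eq xy); exact: dj.
apply: (@le_trans _ _ (2%:E * mu (bad (B i x)))%E).
  by rewrite lee_pmul2l//; apply: lebn_le; exact: subIsetr.
by rewrite EFinM -muleA lee_pmul2l//; exact: lebn_bad_le.
Qed.

Lemma lebn_layer_le g m i x : generation g i x ->
  (mu (B i x `&` layer (g + m)) <= ((2 * eta) ^+ m)%:E * mu (B i x))%E.
Proof.
move=> gi; elim: m => [|m IH].
  by rewrite expr0 mul1e; apply: lebn_le; exact: subIsetl.
pose P j y := B i x y /\ generation (g + m) j y.
have Pinv : cell_invariant o l P.
  move=> j y z yz [xy gj]; split; last exact: generation_invariant gj.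
  rewrite -(cell_eq xy); apply: (cell_nest _ yz).
  exact: generation_le (generation_invariant xy gi) gj.
have Puniq : level_unique P by move=> j j' y [_ gj] [_ gj']; exact: generation_unique gj gj'.
have PE : cells P = B i x `&` layer (g + m).
  by apply/seteqP; split => y; [move=> [j [xy gj]]; split=> //; exists j|move=> [xy [j gj]]; exists j].
have e20 : 0 <= 2 * eta by rewrite mulr_ge0// ltW.
have := @le_measure_cells _ _ o l l0 P 1 (2 * eta) (layer (g + m).+1) setT ler01 e20
  Pinv Puniq (measurable_layer _) measurableT.
rewrite mul1e setIT PE -setIA (setIidr (@layerS (g + m))) => /(_ _)/le_trans.
rewrite addnS; apply.
  by move=> j y [xy gj]; rewrite mul1e setIT; exact: lebn_children_le.
rewrite exprS [X in (_ <= X * _)%E]EFinM -muleA.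
by apply: lee_wpmul2l; [rewrite lee_fin|exact: IH].
Qed.

Lemma lebn_null_inf_layer : mu [set x | forall g, layer g x] = 0%E.
Proof.
have two : 2 * eta < 1 by move: eta0 eta_small; lra.
have e20 : 0 <= 2 * eta by rewrite mulr_ge0// ltW.
apply/eqP; rewrite eq_le measure_ge0 andbT.
apply/lee_addgt0Pr => e e0; rewrite add0e.
have cv : ((2 * eta) ^+ m * side l 0 ^+ n.+1) @[m --> \oo] --> 0.
  rewrite -(mul0r (side l 0 ^+ n.+1)); apply: cvgMl; apply: cvg_expr.
  by rewrite ger0_norm.
move/cvgrPdist_le : cv => /(_ _ e0)[m _ /(_ m (leqnn m))]; rewrite sub0r normrN.
move=> /(le_trans (ler_norm _)) hm.
apply: (@le_trans _ _ (mu (Q0 `&` layer (0 + m)))).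
  apply: lebn_le => x hx; split; last exact: hx.
  by have [j] := hx 0%N; move=> [].
apply: le_trans (@lebn_layer_le 0 m 0 x0 _) _; first by [].
by rewrite lebn_cell// -EFinM lee_fin.
Qed.

(** What remains of the bad set outside the children has density at most 1/2 in
    every small cell. *)
Lemma lebn_null_sparse_bad i x : Q0 x ->
  mu (bad (B i x) `\` cells (fun j y => (i < j)%N /\ dense i j y)) = 0%E.
Proof.
move=> x00; set P := (fun j y => _).
have Pinv : cell_invariant o l P.
  by move=> j y z yz [ij dj]; split=> //; exact: (dense_invariant (ltnW ij) yz).
have mD : measurable (bad (B i x) `\` cells P).
  by apply: measurableD; [exact: measurable_bad|apply: measurable_cells Pinv].
apply: (@null_of_half_density _ _ o l l0 _ i.+1 mD).
  apply: (@le_lt_trans _ _ (mu (B i x))).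
    by apply: lebn_le => y [/bad_sub].
  by rewrite lebn_cell// ltry.
move=> j y ij.
have [[z [yz [bz nz]]]|hn] := pselect (exists z, B j y z /\ (bad (B i x) `\` cells P) z); last first.
  rewrite (_ : _ `&` _ = set0) ?measure0 ?mule0//.
  by apply/seteqP; split => // z hz; apply: hn; exists z.
have : ~ (mu (B j z) < 2%:E * mu (B j z `&` bad (B i z)))%E.
  by move=> dz; apply: nz; exists j; split; [exact: ij|constructor; exact: dz].
move/negP; rewrite -leNgt (cell_eq yz) (cell_eq (bad_sub bz)).
apply: le_trans; rewrite lee_pmul2l//; apply: lebn_le.
by move=> u [? []].
Qed.

(** A point that is good for two cells compares their central values through the
    value of h there. *)
Lemma exists_two_good (S : set Rn) (i j : nat) (x : Rn) (a b v : R) :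
  measurable S -> mu S = v%:E -> 0 < v -> a + b < 1 ->
  (mu (S `&` bad (B i x)) <= (a * v)%:E)%E ->
  (mu (S `&` bad (B j x)) <= (b * v)%:E)%E ->
  exists y, [/\ S y, ~ bad (B i x) y & ~ bad (B j x) y].
Proof.
move=> mS Sv v0 ab Sa Sb; apply: contrapT => H.
have : (mu S <= mu (S `&` bad (B i x)) + mu (S `&` bad (B j x)))%E.
  apply: (@le_trans _ _ (mu ((S `&` bad (B i x)) `|` (S `&` bad (B j x))))).
    apply: lebn_le => y Sy; apply: contrapT => ny; apply: H; exists y; split=> //.
      by move=> by_; apply: ny; left.
    by move=> by_; apply: ny; right.
  by apply: measureU2; apply: measurableI => //; exact: measurable_bad.
move=> /le_trans/(_ (leeD Sa Sb)); rewrite Sv -EFinD lee_fin; nra.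
Qed.

(** Let p be the parent of the child j. It is not dense, or it is the cell i itself, so
    it contains a point good for both i and p. The cell j has proportion [2^-d] of
    its parent, so it contains a point good for both p and j; this is where [eta]
    has to be smaller than [1 / (1 + 2^d)]. *)
Lemma center_value_step g i j x : generation g i x -> child i j x ->
  `|center_value (B j x) - center_value (B i x)| <= 4 * A (B j x).
Proof.
move=> gi [ij _ nd]; have x00 := generation_root gi.
case: j ij nd => // p; rewrite ltnS => ip nd.
have s0 j : 0 < side l j ^+ n.+1 by rewrite exprn_gt0// side_gt0.
have small : eta < 2^-1 by move: eta0 eta_small; lra.
have bad_le j : (mu (B j x `&` bad (B j x)) <= (eta * side l j ^+ n.+1)%:E)%E.
  rewrite EFinM -(lebn_cell o l0 j x); apply: le_trans (lebn_bad_le j x00).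
  by apply: lebn_le; exact: subIsetr.
have half : (mu (B p x `&` bad (B i x)) <= (2^-1 * side l p ^+ n.+1)%:E)%E.
  move: ip; rewrite leq_eqVlt => /predU1P[->|ip].
    by apply: le_trans (bad_le p) _; rewrite lee_fin ler_pM2r// ltW.
  have nd' : ~ (mu (B p x) < 2%:E * mu (B p x `&` bad (B i x)))%E.
    by move=> dx; apply: (nd p); [rewrite ip ltnSn|constructor; exact: dx].
  move/negP : nd'; rewrite -leNgt lebn_cell// => hh.
  by rewrite -(@lee_pmul2l _ 2%:E)// -EFinM mulrA divff// mul1r.
have [y1 [py1 iy1 py1']] : exists y, [/\ B p x y, ~ bad (B i x) y & ~ bad (B p x) y].
  apply: (exists_two_good _ (lebn_cell o l0 p x) (s0 p) _ half (bad_le p)).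
    exact: measurable_cell.
  by move: eta0 eta_small; lra.
have parent : (mu (B p.+1 x `&` bad (B p x)) <=
    (eta * 2 ^+ n.+1 * side l p.+1 ^+ n.+1)%:E)%E.
  rewrite -mulrA -exprMn -sideS EFinM -(lebn_cell o l0 p x).
  by apply: le_trans (lebn_bad_le p x00); apply: lebn_le; exact: subIsetr.
have [y2 [py2 iy2 py2']] : exists y,
    [/\ B p.+1 x y, ~ bad (B p.+1 x) y & ~ bad (B p x) y].
  apply: (exists_two_good _ (lebn_cell o l0 p.+1 x) (s0 _) _ (bad_le _) parent).
    exact: measurable_cell.
  by move: eta1; rewrite mulrDr mulr1.
have good j y : B j x y -> ~ bad (B j x) y -> `|h y - center_value (B j x)| <= A (B j x).
  by move=> jy /not_andP[//|/negP]; rewrite -leNgt.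
have g1 := good _ _ (cell_nest ip py1) iy1.
have g2 := good _ _ py1 py1'.
have g3 := good _ _ py2 iy2.
have g4 := good _ _ (cell_nest (leqnSn p) py2) py2'.
have m1 := A_mono x00 (leq_trans ip (leqnSn p)).
have m2 := A_mono x00 (leqnSn p).
move: g1 g2 g3 g4; rewrite !ler_norml => /andP[? ?] /andP[? ?] /andP[? ?] /andP[? ?].
by apply/andP; split; lra.
Qed.

(** The central values change by at most 4 A at each generation. Rather than keeping
    the sum of these jumps along the chain of ancestors, one keeps its largest term
    after weighting: either the newest jump exceeds the bound obtained so far, or
    doubling that bound absorbs it. The number of doublings is the number of
    generations between the retained cell and the last one. *)
Lemma center_value_chain g j x : generation g j x ->
  exists g' m i, [/\ g = (g' + m)%N, generation g' i x &
    `|center_value (B j x) - center_value Q0| <= 8 * 2 ^+ m * A (B i x)].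
Proof.
elim: g j => [|g IH] j /=.
  move=> [-> x00]; exists 0%N, 0%N, 0%N; split=> //.
  by rewrite (cell_eq x00) subrr normr0 !mulr_ge0.
move=> [i gi cij]; have [g' [m [i' [gE gi' hi]]]] := IH _ gi.
have step := center_value_step gi cij.
have tri : `|center_value (B j x) - center_value Q0| <=
    4 * A (B j x) + 8 * 2 ^+ m * A (B i' x).
  rewrite (_ : _ - center_value Q0 = (center_value (B j x) - center_value (B i x)) +
    (center_value (B i x) - center_value Q0)); last by ring.
  exact: le_trans (ler_normD _ _) (lerD step hi).
have [hA|hA] := leP (4 * A (B j x)) (8 * 2 ^+ m * A (B i' x)).
  exists g', m.+1, i'; split; [by rewrite gE addnS|by []|].
  by rewrite exprS; apply: le_trans tri _; lra.
exists g.+1, 0%N, j; split; [by rewrite addn0|by exists i|].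
by rewrite expr0 mulr1; apply: le_trans tri _; lra.
Qed.

Lemma lebn_null_bigcup (F : nat -> set Rn) :
  (forall q, mu (F q) = 0%E) -> mu (\bigcup_q F q) = 0%E.
Proof.
move=> F0; apply/eqP; rewrite eq_le measure_ge0 andbT.
apply: le_trans (lebn_outer_sigma_subadditive F) _.
by rewrite eseries0// => q _ _; exact: F0.
Qed.

Definition exceptional : set Rn :=
  [set x | forall g, layer g x] `|`
  \bigcup_i [set x | [/\ Q0 x, bad (B i x) x &
     forall j, (i < j)%N -> ~ dense i j x]].

(** Layers decay geometrically, and there are countably many cells. *)
Lemma lebn_null_exceptional : mu exceptional = 0%E.
Proof.
rewrite /exceptional; set U := \bigcup_i _.
have U0 : mu U = 0%E.
  apply: lebn_null_bigcup => i; set V := (X in mu X).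
  have -> : V = \bigcup_q (V `&` [set x | pickle (cell_index o l i x) = q]).
    apply/seteqP; split=> x; first by move=> Vx; exists (pickle (cell_index o l i x)).
    by move=> [q _ []].
  apply: lebn_null_bigcup => q.
  have [[x [[x00 bx nx] xq]]|hn] := pselect (exists x, V x /\ pickle (cell_index o l i x) = q); last first.
    rewrite (_ : _ `&` _ = set0) ?measure0//.
    by apply/seteqP; split => // x hx; apply: hn; exists x.
  apply: lebn_null_sub (lebn_null_sparse_bad i x00) => y [[_ by_ ny] yq].
  have xy : B i x y by apply: (pcan_inj pickleK); rewrite yq xq.
  rewrite -(cell_eq xy); split=> //.
  move=> [j [ij dj]]; exact: (ny j ij).
have mU : measurable U by exact: lebn_null_measurable.
have mI : measurable [set x | forall g, layer g x].
  by apply: lebn_null_measurable; exact: lebn_null_inf_layer.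
apply/eqP; rewrite eq_le measure_ge0 andbT.
have : (mu ([set x | forall g, layer g x] `|` U) <=
    mu [set x | forall g, layer g x] + mu U)%E by exact: measureU2.
by move=> /le_trans; apply; rewrite lebn_null_inf_layer U0 adde0.
Qed.

(** In the last cell of the chain containing x, the value h x is close to the central
    value, since a bad point outside all children is exceptional; the chain of
    central values leads back to the root. *)
Lemma sparse_domination x : Q0 x -> ~ exceptional x ->
  exists g m i, [/\ generation g i x, layer (g + m) x, ~ layer (g + m).+1 x &
    `|h x - center_value Q0| <= 16 * 2 ^+ m * A (B i x)].
Proof.
move=> x00 xN.
have ex : exists g, ~~ `[< layer g x >].
  apply: contrapT => /forallNP H; apply: xN; left => g.
  by have /negP := H g; rewrite negbK => /asboolP.
have [G /asboolP nG Gmin] := ex_minnP ex.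
have Gin g : (g < G)%N -> layer g x.
  move=> gG; apply: contrapT => ng; have := Gmin g; rewrite leqNgt gG.
  by move=> /(_ _)/negP; case=> //; apply/asboolP.
case: G nG Gmin Gin => [nG _ _|G nG _ Gin].
  by case: nG; exists 0%N.
have [j gj] := Gin G (ltnSn G).
have [g [m [i [gE gi hi]]]] := center_value_chain gj.
have hx : `|h x - center_value (B j x)| <= A (B j x).
  have [bx|nb] := pselect (bad (B j x) x); last first.
    by move/not_andP : nb => [/(_ erefl)//|/negP]; rewrite -leNgt.
  case: xN; right; exists j => //; split=> // j' jj' dj'; apply: nG.
  have [j'' j''le [[jj'' dj''] mj'']] :=
    @first_level_exists _ _ (fun j' y => (j < j')%N /\ dense j j' y) j' x (conj jj' dj').
  exists j''; exists j => //; split=> // i' /andP[ji' i'j''] di'.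
  exact: (mj'' i' i'j'').
have tri : `|h x - center_value Q0| <= A (B j x) + 8 * 2 ^+ m * A (B i x).
  rewrite (_ : _ - center_value Q0 = (h x - center_value (B j x)) +
    (center_value (B j x) - center_value Q0)); last by ring.
  exact: le_trans (ler_normD _ _) (lerD hx hi).
have p0 : 0 <= 2 ^+ m * A (B i x) by rewrite mulr_ge0.
have [hA|hA] := leP (A (B j x)) (8 * 2 ^+ m * A (B i x)).
  exists g, m, i; split; rewrite -?gE//; first exact: Gin.
  by apply: le_trans tri _; lra.
exists G, 0%N, j; split; rewrite ?addn0//; first exact: Gin.
rewrite expr0 mulr1; apply: le_trans tri _.
have := A0 (B j x); lra.
Qed.

End stopping_cubes.

(** * Condition W_p on dyadic cells *)

Section weights.
Context (R : realType) (n : nat).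
Local Notation Rn := 'rV[R]_n.+1.
Local Notation mu := (@lebn R n).
Local Notation d := n.+1.

Lemma lebn_setU_le (A B : set Rn) : (mu (A `|` B) <= mu A + mu B)%E.
Proof. exact: outer_measureU2. Qed.

Lemma integral_gt0 (s : Rn -> R) (A : set Rn) : (forall x, 0 < s x) ->
  measurable_fun setT s -> measurable A -> (0 < mu A)%E ->
  (0 < \int[mu]_(x in A) (s x)%:E)%E.
Proof.
move=> s0 ms mA A0; rewrite lt_neqAle; apply/andP; split; last first.
  by apply: integral_ge0 => x _; rewrite lee_fin ltW.
apply/eqP => I0; move: A0; rewrite lt_neqAle eq_sym => /andP[/eqP A0 _]; apply: A0.
have msA : measurable_fun A (fun x => (s x)%:E).
  by apply: measurable_funTS; apply/measurable_EFinP.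
have : (\int[mu]_(x in A) `|(s x)%:E| = 0)%E.
  by rewrite [RHS]I0; apply: eq_integral => x _; rewrite gee0_abs// lee_fin ltW.
move/(ae_eq_integral_abs _ mA msA) => [N [mN N0 sub]].
apply: lebn_null_sub N0 => x Ax; apply: sub => /(_ Ax) /= [] sx.
by move: (s0 x); rewrite sx ltxx.
Qed.

(** Condition W_p for a positive and finite density [s] of the dual weight,
    with the average taken over the cube itself. *)
Definition muckenhoupt_type (p beta alpha c0 : R) (w s : Rn -> R) :=
  forall (a : Rn) (l : R) (E E' : set Rn), 0 < l -> measurable E -> measurable E' ->
    E `<=` cube a l -> E' `<=` cube a l -> E `&` E' = set0 ->
    ((alpha * l ^+ d)%:E <= mu E')%E ->
    ((\int[mu]_(x in E) (w x)%:E) *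
       ((fine (\int[mu]_(x in cube a l) (s x)%:E) / l ^+ d) `^ p)%:E <=
     (c0 * (fine (mu E) / l ^+ d) `^ beta)%:E * \int[mu]_(x in E') (s x)%:E)%E.

Context (p beta alpha c0 : R) (w s : Rn -> R).
Context (p0 : 0 < p) (beta0 : 0 < beta) (alpha01 : 0 < alpha < 1) (c00 : 0 < c0).
Context (w0 : forall x, 0 <= w x) (s0 : forall x, 0 < s x).
Context (mw : measurable_fun setT w) (ms : measurable_fun setT s).
Context (sfin : forall a l, (\int[mu]_(x in cube a l) (s x)%:E < +oo)%E).
Context (WS : muckenhoupt_type p beta alpha c0 w s).

Local Notation IS A := (\int[mu]_(x in A) (s x)%:E)%E.
Local Notation IW A := (\int[mu]_(x in A) (w x)%:E)%E.

Let msE : measurable_fun setT (fun x => (s x)%:E).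
Proof. exact/measurable_EFinP. Qed.
Let mwE : measurable_fun setT (fun x => (w x)%:E).
Proof. exact/measurable_EFinP. Qed.
Let s0E x : (0 <= (s x)%:E)%E. Proof. by rewrite lee_fin ltW. Qed.
Let w0E x : (0 <= (w x)%:E)%E. Proof. by rewrite lee_fin. Qed.

Lemma le_weight (A B : set Rn) : measurable A -> measurable B -> A `<=` B ->
  (IS A <= IS B)%E.
Proof.
move=> mA mB AB; apply: ge0_subset_integral; [exact: mA|exact: mB| |by []|exact: AB].
exact: measurable_funTS.
Qed.

Lemma weight_cell_fin o L m x : 0 < L -> IS (cell o L m x) \is a fin_num.
Proof.
move=> L0; rewrite ge0_fin_numE; last exact: integral_ge0.
apply: (@le_lt_trans _ _ (IS (cube (cell_center o L m x) (side L m)))) (sfin _ _).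
apply: le_weight; [exact: measurable_cell|exact: measurable_cube|exact: cell_sub_cube].
Qed.

Lemma exists_fine_scale : exists K : nat, (2 ^+ K)^-1 <= (1 - alpha) / 2.
Proof.
have e0 : 0 < (1 - alpha) / 2 by move: alpha01 => /andP[_ ?]; rewrite divr_gt0// subr_gt0.
have B0 : 0 <= ((1 - alpha) / 2)^-1 by rewrite invr_ge0 ltW.
exists (Num.bound ((1 - alpha) / 2)^-1); have := archi_boundP B0; set N := Num.bound _ => LN.
rewrite -[leRHS]invrK lef_pV2 ?posrE ?invr_gt0// ?exprn_gt0//.
apply: le_trans (ltW LN) _.
by rewrite -natrX ler_nat ltnW// ltn_expl.
Qed.

(** W_p asks for disjoint sets, of which the second fills most of the cube, whereas
    [F] may meet [C \ G]. Cut the cell [C] into subcells so small that [C \ G]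
    without one of them still has proportion alpha of [C], apply W_p to the part of
    [F] in each subcell, and add up. *)
Lemma muckenhoupt_cell : exists2 C1 : R, 0 < C1 &
  forall (o : Rn) (L : R) m x (F G : set Rn), 0 < L -> measurable F -> measurable G ->
  F `<=` cell o L m x ->
  (mu (cell o L m x `&` G) <= ((1 - alpha) / 2)%:E * mu (cell o L m x))%E ->
  (IW F * ((fine (IS (cell o L m x)) / side L m ^+ d) `^ p)%:E <=
   (C1 * (fine (mu F) / side L m ^+ d) `^ beta)%:E * IS (cell o L m x `\` G))%E.
Proof.
have [K hK] := exists_fine_scale.
exists (c0 * (2 ^+ K) ^+ d); first by rewrite mulr_gt0// exprn_gt0// exprn_gt0.
move=> o L m x F G L0 mF mG FC smallG; set C := cell o L m x.
have mC : measurable C by exact: measurable_cell.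
have mCG : measurable (C `\` G) by exact: measurableD.
have v0 : 0 < side L m ^+ d by rewrite exprn_gt0// side_gt0.
have muC : mu C = (side L m ^+ d)%:E by exact: lebn_cell.
have sideK : side L m = 2 ^+ K * side L (m + K).
  by rewrite /side exprD; field; rewrite !expf_neq0.
set X := (_ `^ p); set t := fine (mu F) / _.
have X0 : 0 <= X by exact: powR_ge0.
have ISfin : IS (C `\` G) \is a fin_num.
  rewrite ge0_fin_numE; last exact: integral_ge0.
  apply: (@le_lt_trans _ _ (IS C)); first by apply: le_weight => //; exact: subDsetl.
  by have := weight_cell_fin o m x L0; rewrite ge0_fin_numE//; exact: integral_ge0.
pose Y := c0 * t `^ beta * fine (IS (C `\` G)).
have Y0 : 0 <= Y.
  by rewrite /Y !mulr_ge0 ?powR_ge0 ?(ltW c00)// fine_ge0// integral_ge0.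
pose D y := cell o L (m + K) y.
have Ffin : mu F \is a fin_num.
  rewrite ge0_fin_numE//; apply: (@le_lt_trans _ _ (mu C)); first exact: lebn_le.
  by rewrite muC ltry.
have piece y : C y -> (IW (D y `&` F) * X%:E <= Y%:E)%E.
  move=> Cy.
  have mD : measurable (D y) by exact: measurable_cell.
  have DC : D y `<=` C by rewrite /C -(cell_eq Cy); apply: cell_nest; exact: leq_addr.
  have mE' : measurable ((C `\` G) `\` D y) by exact: measurableD.
  have CQ : C `<=` cube (cell_center o L m x) (side L m) by exact: cell_sub_cube.
  have big : ((alpha * side L m ^+ d)%:E <= mu ((C `\` G) `\` D y))%E.
    have cov : (mu C <= mu ((C `\` G) `\` D y) + (mu (C `&` G) + mu (D y)))%E.
      apply: (@le_trans _ _ (mu (((C `\` G) `\` D y) `|` ((C `&` G) `|` D y)))).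
        apply: lebn_le => z Cz.
        have [Dz|Dz] := pselect (D y z); first by right; right.
        by have [Gz|Gz] := pselect (G z); [right; left|left].
      by apply: le_trans (lebn_setU_le _ _) _; rewrite leeD2l// lebn_setU_le.
    have muD : mu (D y) = (side L (m + K) ^+ d)%:E by exact: lebn_cell.
    have hD : side L (m + K) ^+ d <= (1 - alpha) / 2 * side L m ^+ d.
      have -> : side L (m + K) = (2 ^+ K)^-1 * side L m.
        by rewrite sideK mulKf// expf_neq0.
      rewrite exprMn ler_pM2r//; apply: le_trans hK; rewrite exprS ler_piMr//.
      by rewrite exprn_ile1// ?invr_ge0 ?exprn_ge0// invf_le1 ?exprn_gt0// exprn_ege1// ler1n.
    have E'fin : mu ((C `\` G) `\` D y) \is a fin_num.
      rewrite ge0_fin_numE//; apply: (@le_lt_trans _ _ (mu C)).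
        by apply: lebn_le => z [[]].
      by rewrite muC ltry.
    have : (mu C <= mu ((C `\` G) `\` D y) + (((1 - alpha) / 2)%:E * mu C + mu (D y)))%E.
      by apply: le_trans cov _; rewrite leeD2l// leeD2r.
    rewrite muD muC -(fineK E'fin) -!EFinM -!EFinD !lee_fin; lra.
  have mDF : measurable (D y `&` F) by exact: measurableI.
  have DFsub : D y `&` F `<=` cube (cell_center o L m x) (side L m).
    by move=> z [_ /FC /CQ].
  have E'sub : (C `\` G) `\` D y `<=` cube (cell_center o L m x) (side L m).
    by move=> z [[/CQ]].
  have dis : (D y `&` F) `&` ((C `\` G) `\` D y) = set0.
    by apply/seteqP; split => // z [[Dz _] [_ /(_ Dz)]].
  have WSE := WS (side_gt0 L0 m) mDF mE' DFsub E'sub dis big.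
  apply: (@le_trans _ _ (IW (D y `&` F) *
    ((fine (IS (cube (cell_center o L m x) (side L m))) / side L m ^+ d) `^ p)%:E)%E).
    apply: lee_wpmul2l; first exact: integral_ge0.
    rewrite lee_fin; apply: ge0_ler_powR; rewrite ?nnegrE ?(ltW p0)//.
    - by rewrite divr_ge0 ?(ltW v0)// fine_ge0// integral_ge0.
    - by rewrite divr_ge0 ?(ltW v0)// fine_ge0// integral_ge0.
    rewrite ler_pM2r ?invr_gt0//; apply: fine_le.
    - exact: weight_cell_fin.
    - by rewrite ge0_fin_numE; [exact: sfin|exact: integral_ge0].
    - by apply: le_weight; [|exact: measurable_cube|].
  apply: le_trans WSE _; rewrite /Y [leRHS]EFinM (fineK ISfin); apply: lee_pmul.
  - by rewrite lee_fin mulr_ge0 ?powR_ge0// ltW.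
  - exact: integral_ge0.
  - rewrite lee_fin ler_pM2l//; apply: ge0_ler_powR; rewrite ?nnegrE ?(ltW beta0)//.
    + by rewrite divr_ge0 ?(ltW v0)// fine_ge0.
    + by rewrite divr_ge0 ?(ltW v0)// fine_ge0.
    rewrite ler_pM2r ?invr_gt0//; apply: fine_le => //.
      rewrite ge0_fin_numE//; apply: (@le_lt_trans _ _ (mu C)).
        by apply: lebn_le => z [/DC].
      by rewrite muC ltry.
    by apply: lebn_le; exact: subIsetr.
  - by apply: le_weight => // z [].
pose P j y := j = (m + K)%N /\ C y.
have Pinv : cell_invariant o L P.
  move=> j y z yz [jE Cy]; split=> //; move: yz; rewrite jE => yz.
  by move: (cell_nest (leq_addr K m) yz); rewrite (cell_eq Cy).
have Puniq : level_unique P by move=> j j' y [-> _] [-> _].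
have PC : cells P = C.
  by apply/seteqP; split => y; [move=> [j []]|move=> Cy; exists (m + K)%N].
have vD0 : 0 < side L (m + K) ^+ d by rewrite exprn_gt0// side_gt0.
have mwX : measurable_fun setT (fun x => (w x)%:E * X%:E)%E.
  by apply: emeasurable_funM; [exact: mwE|exact: measurable_cst].
have sumP := @le_integral_cells _ _ o L L0 P (fun x => (w x)%:E * X%:E)%E
  (cst (Y / side L (m + K) ^+ d)%:E) F setT Pinv Puniq mF measurableT mwX.
have pull (B : set Rn) : measurable B ->
    (\int[mu]_(x in B) ((w x)%:E * X%:E) = IW B * X%:E)%E.
  move=> mB; apply: ge0_integralZr; [exact: mB|exact: measurable_funTS|by []|by rewrite lee_fin].
have FE : C `&` F = F by apply/setIidPr.
rewrite PC FE pull// in sumP.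
apply: (le_trans (sumP _ _ _ _)).
- exact: measurable_cst.
- by move=> z; rewrite mule_ge0// lee_fin.
- by move=> z; rewrite lee_fin divr_ge0// ltW.
- move=> j y [-> Cy]; rewrite pull; last by apply: measurableI => //; exact: measurable_cell.
  rewrite integral_cst; last by apply: measurableI => //; exact: measurable_cell.
  rewrite setIT [X in (_ <= _ * X)%E]lebn_cell// -EFinM divfK ?gt_eqF//.
  exact: piece.
rewrite setIT integral_cst// [X in (_ * X <= _)%E]muC -EFinM -(fineK ISfin) -EFinM lee_fin.
rewrite /Y sideK [(2 ^+ K * _) ^+ d]exprMn le_eqVlt; apply/orP; left; apply/eqP.
by field; rewrite gt_eqF// side_gt0.
Qed.

End weights.

(** * The weighted dyadic maximal function *)

Section dyadic_maximal.
Context (R : realType) (n : nat).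
Local Notation Rn := 'rV[R]_n.+1.
Local Notation mu := (@lebn R n).

Lemma powR2_gt1 (q : R) : 0 < q -> 1 < (2 : R) `^ q.
Proof.
move=> q0; suff : (1 : R) `^ q < 2 `^ q by rewrite powR1.
by apply: gt0_ltr_powR => //; rewrite ?nnegrE// ltr1n.
Qed.

(** A geometric sum is comparable with its largest term. *)
Lemma geometric_sum_le (q e t : R) J : 0 < q -> 0 < e -> 0 <= t ->
  \sum_(j < J) (if e * 2 ^+ j < t then (e * 2 ^+ j) `^ q else 0) <=
  2 `^ q / (2 `^ q - 1) * t `^ q.
Proof.
move=> q0 e0 t0; pose D := 2 `^ q : R; pose b j : R := e * 2 ^+ j.
have b0 j : 0 < b j by rewrite mulr_gt0// exprn_gt0.
have D1 : 1 < D by exact: powR2_gt1.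
pose k := (D - 1)^-1.
have k0 : 0 < k by rewrite invr_gt0 subr_gt0.
have kD : k + 1 = D * k by rewrite /k; field; rewrite gt_eqF// subr_gt0.
have bS j : b j.+1 `^ q = D * b j `^ q.
  rewrite (_ : b j.+1 = 2 * b j); last by rewrite /b exprS mulrCA.
  by rewrite powRM// ltW.
pose S J' : R := \sum_(j < J') (if b j < t then b j `^ q else 0).
rewrite -/D -/k -/(S J).
have H : S J <= k * b J `^ q /\ S J <= D * k * t `^ q.
  elim: J => [|J [IH1 IH2]].
    by rewrite /S big_ord0; split; rewrite !mulr_ge0 ?powR_ge0 ?(ltW k0).
  rewrite /S big_ord_recr/= -/(S J) -/(b J); case: ifPn => bt; last first.
    rewrite addr0; split=> //; apply: le_trans IH1 _; rewrite bS.
    rewrite mulrCA ler_peMl ?(ltW D1)// mulr_ge0 ?(ltW k0)//; exact: powR_ge0.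
  have h : S J + b J `^ q <= D * k * b J `^ q.
    by rewrite -kD mulrDl mul1r lerD2r.
  split; first by rewrite bS mulrA [k * D]mulrC.
  apply: le_trans h _; rewrite ler_pM2l; last by rewrite mulr_gt0// (lt_trans ltr01).
  by apply: ge0_ler_powR; rewrite ?nnegrE ?(ltW q0) ?(ltW (b0 J))// ltW.
by case: H.
Qed.

Context (p : R) (p1 : 1 < p).

(** [Psi] is the sum over j of [(e 2^(j+1))^p s] on the set where some weighted average
    exceeds [e 2^j], that is, a dyadic version of the p-th power of the
    maximal function times [s]. The weak type bound for [g] truncated at half the
    level ([weak] below) and the summation of the levels below [2 g] give the
    strong type. Averages smaller than [e] are left to the term [e^p s], so that the
    levels are indexed by natural numbers. *)
Lemma dyadic_maximal : exists2 Cp : R, 0 < Cp &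
  forall (o : Rn) (L : R) (s g : Rn -> R) (e : R), 0 < L -> 0 < e ->
  (forall x, 0 < s x) -> (forall x, 0 <= g x) ->
  measurable_fun setT s -> measurable_fun setT g ->
  (forall a l, (\int[mu]_(x in cube a l) (s x)%:E < +oo)%E) ->
  exists Psi : Rn -> \bar R, [/\ measurable_fun setT Psi, (forall x, 0 <= Psi x)%E,
   (\int[mu]_x Psi x <= Cp%:E * \int[mu]_x (g x `^ p * s x)%:E)%E &
   forall m x r, 0 <= r ->
     (r%:E * \int[mu]_(y in cell o L m x) (s y)%:E <=
      \int[mu]_(y in cell o L m x) (g y * s y)%:E)%E ->
     ((r `^ p * s x)%:E <= (e `^ p * s x)%:E + Psi x)%E].
Proof.
pose q := p - 1; have q0 : 0 < q by rewrite subr_gt0.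
have pp : 0 < p by apply: lt_trans p1.
pose kq : R := 2 `^ q / (2 `^ q - 1).
have kq0 : 0 < kq.
  by rewrite divr_gt0 ?powR_gt0// subr_gt0 powR2_gt1.
have P2 r : 0 < (2 : R) `^ r by apply: powR_gt0.
have Cp0 : 0 < 2 * 2 `^ p * kq * 2 `^ q.
  exact: (mulr_gt0 (mulr_gt0 (mulr_gt0 (ltr0Sn R 1) (P2 _)) kq0) (P2 _)).
exists (2 * 2 `^ p * kq * 2 `^ q); first by [].
move=> o L s g e L0 e0 s0 g0 ms mg sfin.
pose b j : R := e * 2 ^+ j.
have b0 j : 0 < b j by rewrite mulr_gt0// exprn_gt0.
pose gs y := g y * s y.
have gs0 y : 0 <= gs y by rewrite mulr_ge0// ltW.
have mgs : measurable_fun setT (fun y => (gs y)%:E).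
  by apply/measurable_EFinP; apply: measurable_funM.
have msE : measurable_fun setT (fun y => (s y)%:E) by exact/measurable_EFinP.
pose good (t : R) m x := (t%:E * \int[mu]_(y in cell o L m x) (s y)%:E <
                     \int[mu]_(y in cell o L m x) (gs y)%:E)%E.
have good_inv t : cell_invariant o L (good t).
  by move=> m x y xy; rewrite /good (cell_eq xy).
pose Om j := cells (good (b j)).
have mOm j : measurable (Om j) by apply: measurable_cells (good_inv _).
pose G j : set Rn := [set y | b j < 2 * g y].
have mG j : measurable (G j).
  rewrite (_ : G j = (fun y => 2 * g y) @^-1` `]b j, +oo[); last first.
    by apply/seteqP; split => y /=; rewrite in_itv/= andbT.
  have m2g : measurable_fun setT (fun y => 2 * g y).
    by apply: measurable_funM; [exact: measurable_cst|exact: mg].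
  by rewrite -[X in measurable X]setTI; exact: (m2g measurableT _ (measurable_itv _)).
have weak j : ((b j / 2)%:E * \int[mu]_(y in Om j) (s y)%:E <=
               \int[mu]_(y in G j) (gs y)%:E)%E.
  pose P := first_level (good (b j)).
  have PE : cells P = Om j by exact: cells_first_level.
  have hb : 0 <= b j / 2 by rewrite divr_ge0// ltW.
  have mbs : measurable_fun setT (fun y => (b j / 2)%:E * (s y)%:E)%E.
    by apply: emeasurable_funM; [exact: measurable_cst|exact: msE].
  have pull (B : set Rn) : measurable B ->
     (\int[mu]_(y in B) ((b j / 2)%:E * (s y)%:E) = (b j / 2)%:E * \int[mu]_(y in B) (s y)%:E)%E.
    move=> mB; apply: ge0_integralZl_EFin; [exact: mB| |exact: measurable_funTS|exact: hb].
    by move=> y _; rewrite lee_fin ltW.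
  have := @le_integral_cells _ _ o L L0 P (fun y => (b j / 2)%:E * (s y)%:E)%E
    (fun y => (gs y)%:E) setT (G j) (first_level_invariant (@good_inv _))
    (@first_level_unique _ _ _) measurableT (mG j) mbs mgs.
  rewrite setIT PE pull// => H; apply: le_trans (H _ _ _) _.
  - by move=> y; rewrite mule_ge0// lee_fin// ltW.
  - by move=> y; rewrite lee_fin.
  - move=> m x [gx _]; set C := cell o L m x in gx *.
    have mC : measurable C by exact: measurable_cell.
    rewrite setIT pull//.
    have ISfin : (\int[mu]_(y in C) (s y)%:E)%E \is a fin_num by exact: weight_cell_fin.
    have split_int : (\int[mu]_(y in C) (gs y)%:E <=
        \int[mu]_(y in C `&` G j) (gs y)%:E + (b j / 2)%:E * \int[mu]_(y in C) (s y)%:E)%E.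
      rewrite integral_mkcondr -pull// -ge0_integralD; last 5 first.
      - exact: mC.
      - by move=> y _; apply: erestrict_ge0 => z _; rewrite lee_fin.
      - by apply: measurable_funTS; apply/(measurable_restrictT _ (mG j)); exact: measurable_funTS.
      - by move=> y _; rewrite mule_ge0// lee_fin// ltW.
      - exact: measurable_funTS.
      apply: ge0_le_integral; [exact: mC|by move=> y _; rewrite lee_fin|exact: measurable_funTS| |].
        apply: emeasurable_funD; last exact: measurable_funTS.
        by apply: measurable_funTS; apply/(measurable_restrictT _ (mG j)); exact: measurable_funTS.
      move=> y _; rewrite patchE; case: ifPn => yG.
        by rewrite leeDl// mule_ge0// lee_fin// ltW.
      rewrite add0e -EFinM lee_fin /gs ler_pM2r//.
      move: yG; rewrite notin_setE => /negP; rewrite -leNgt => h.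
      by rewrite ler_pdivlMr// mulrC.
    have : ((b j)%:E * \int[mu]_(y in C) (s y)%:E <=
      \int[mu]_(y in C `&` G j) (gs y)%:E + (b j / 2)%:E * \int[mu]_(y in C) (s y)%:E)%E.
      exact: le_trans (ltW gx) split_int.
    have X0 : (0 <= \int[mu]_(y in C `&` G j) (gs y)%:E)%E.
      by apply: integral_ge0 => y _; rewrite lee_fin.
    move: X0; case: (\int[mu]_(y in C `&` G j) (gs y)%:E)%E => [X _||//].
      by rewrite -(fineK ISfin) -!EFinM -EFinD !lee_fin; lra.
    by move=> _ _; rewrite leey.
  - apply: ge0_subset_integral; [|exact: mG| | |exact: subIsetr].
    + by apply: measurableI; [exact: mOm|exact: mG].
    + exact: measurable_funTS.
    + by move=> y _; rewrite lee_fin.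
pose term j (x : Rn) : \bar R := ((b j.+1 `^ p)%:E * ((\1_(Om j) x)%:E * (s x)%:E))%E.
have ind_s_ge0 j x : (0 <= (\1_(Om j) x)%:E * (s x)%:E)%E.
  by rewrite mule_ge0// lee_fin ?indicE// ltW.
have term0 j x : (0 <= term j x)%E.
  by rewrite /term mule_ge0// lee_fin powR_ge0.
have mind_s j : measurable_fun setT (fun x => (\1_(Om j) x)%:E * (s x)%:E)%E.
  apply: emeasurable_funM; last exact: msE.
  by apply/measurable_EFinP; exact: measurable_indic.
have mterm j : measurable_fun setT (term j).
  by apply: emeasurable_funM; [exact: measurable_cst|exact: mind_s].
exists (fun x => \sum_(0 <= j <oo) term j x)%E; split.
- by apply: ge0_emeasurable_sum => [j x _ _|j _]; [exact: term0|exact: mterm].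
- by move=> x; apply: nneseries_ge0 => j _ _; exact: term0.
- rewrite integral_nneseries; [|exact: measurableT|exact: mterm|by move=> *; exact: term0].
  pose K := 2 * 2 `^ p : R.
  have K0 : 0 < K by rewrite mulr_gt0// ?powR_gt0.
  pose u j y : R := K * (if b j < 2 * g y then b j `^ q else 0) * gs y.
  have u0 j y : 0 <= u j y.
    apply: mulr_ge0 => //; apply: mulr_ge0; first exact: ltW.
    by case: ifP => // _; exact: powR_ge0.
  have uE j : (fun y => (u j y)%:E) =
      (fun y => (K * b j `^ q)%:E * ((fun z => (gs z)%:E) \_ (G j)) y)%E.
    apply/funext => y; rewrite patchE /u; case: ifPn => yG.
      by rewrite (mem_set (yG : G j y)) -EFinM.
    by rewrite memNset ?mulr0 ?mul0r ?mule0//; apply/negP.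
  have mres j : measurable_fun setT ((fun z => (gs z)%:E) \_ (G j)).
    by apply/(measurable_restrictT _ (mG j)); exact: measurable_funTS.
  have mu_ j : measurable_fun setT (fun y => (u j y)%:E).
    by rewrite uE; apply: emeasurable_funM; [exact: measurable_cst|exact: mres].
  apply: (@le_trans _ _ (\sum_(0 <= j <oo) \int[mu]_y (u j y)%:E)%E).
    apply: lee_nneseries => j _; first by move=> _; apply: integral_ge0 => x _; exact: term0.
    rewrite /term ge0_integralZl_EFin; last first.
    + exact: powR_ge0.
    + exact: mind_s.
    + by move=> x _; exact: ind_s_ge0.
    + exact: measurableT.
    have -> : (\int[mu]_x ((\1_(Om j) x)%:E * (s x)%:E) = \int[mu]_(x in Om j) (s x)%:E)%E.
      rewrite [RHS]integral_mkcond; apply: eq_integral => x _.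
      by rewrite epatch_indic muleC.
    rewrite uE ge0_integralZl_EFin; last first.
    + by rewrite mulr_ge0 ?(ltW K0)// powR_ge0.
    + exact: mres.
    + by move=> x _; apply: erestrict_ge0 => z _; rewrite lee_fin.
    + exact: measurableT.
    rewrite -integral_mkcond.
    apply: (@le_trans _ _ ((K * b j `^ q)%:E * ((b j / 2)%:E * \int[mu]_(x in Om j) (s x)%:E))%E).
      rewrite muleA -EFinM; apply: lee_wpmul2r.
        by apply: integral_ge0 => x _; rewrite lee_fin ltW.
      have -> : b j.+1 = 2 * b j by rewrite /b exprS; ring.
      rewrite lee_fin powRM ?(ltW (b0 j))//.
      have -> : b j `^ p = b j * b j `^ q by rewrite mulr_powRB1// ltW.
      by rewrite /K le_eqVlt; apply/orP; left; apply/eqP; field.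
    by apply: lee_wpmul2l; [rewrite lee_fin mulr_ge0 ?(ltW K0)// powR_ge0|exact: weak].
  rewrite -integral_nneseries; [|exact: measurableT|exact: mu_|by move=> *; rewrite lee_fin].
  rewrite -ge0_integralZl_EFin; last first.
  + exact: ltW.
  + apply/measurable_EFinP; apply: measurable_funM; last exact: ms.
    by apply: (measurableT_comp (measurable_powR p)).
  + by move=> y _; rewrite lee_fin mulr_ge0 ?powR_ge0// ltW.
  + exact: measurableT.
  apply: ge0_le_integral; [exact: measurableT| | | |].
  + by move=> y _; apply: nneseries_ge0 => j _ _; rewrite lee_fin.
  + by apply: ge0_emeasurable_sum => [j x _ _|j _]; [rewrite lee_fin|exact: mu_].
  + apply: emeasurable_funM; first exact: measurable_cst.
    apply/measurable_EFinP; apply: measurable_funM; last exact: ms.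
    by apply: (measurableT_comp (measurable_powR p)).
  + move=> y _; apply: lime_le; first by apply: is_cvg_nneseries => j _ _; rewrite lee_fin.
    apply: nearW => J; rewrite sumEFin lee_fin big_mkord /u.
    rewrite -mulr_suml -mulr_sumr.
    have t0 : 0 <= 2 * g y by rewrite mulr_ge0.
    have := geometric_sum_le J q0 e0 t0; rewrite -/kq powRM// => hg.
    have gp : g y `^ p = g y * g y `^ q by rewrite mulr_powRB1.
    apply: (@le_trans _ _ (K * (kq * (2 `^ q * g y `^ q)) * gs y)).
      by apply: ler_wpM2r => //; rewrite ler_pM2l.
    by rewrite /gs gp /K le_eqVlt; apply/orP; left; apply/eqP; ring.
- move=> m x r r0 hr.
  have [re|er] := leP r e.
    apply: (@le_trans _ _ (e `^ p * s x)%:E).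
      rewrite lee_fin ler_pM2r//; apply: ge0_ler_powR; rewrite ?nnegrE ?(ltW pp)//.
      by rewrite ltW.
    by rewrite leeDl//; apply: nneseries_ge0 => j _ _; exact: term0.
  have ex : exists j, r <= b j.+1.
    have B0 : 0 <= r / e by rewrite divr_ge0// ltW.
    exists (Num.bound (r / e)); have := archi_boundP B0; set N := Num.bound _.
    rewrite ltr_pdivrMr// => hN; apply: le_trans (ltW hN) _.
    rewrite /b mulrC ler_pM2l// -natrX ler_nat; apply: ltnW.
    by rewrite (leq_trans (ltn_expl _ (ltnSn 1)))// leq_exp2l.
  have [j rj jmin] := ex_minnP ex.
  have bjr : b j < r.
    case: j rj jmin => [|j] rj jmin; first by rewrite /b expr0 mulr1.
    by rewrite ltNge; apply/negP => /jmin; rewrite ltnn.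
  have xOm : Om j x.
    exists m; rewrite /good; apply: lt_le_trans hr.
    have ISfin : (\int[mu]_(y in cell o L m x) (s y)%:E)%E \is a fin_num.
      exact: weight_cell_fin.
    have IS0 : (0 < \int[mu]_(y in cell o L m x) (s y)%:E)%E.
      apply: integral_gt0 => //; first exact: measurable_cell.
      by rewrite [ltRHS]lebn_cell// lte_fin exprn_gt0// side_gt0.
    rewrite -(fineK ISfin) in IS0 *; rewrite lte_fin in IS0.
    by rewrite -!EFinM lte_fin ltr_pM2r.
  apply: (@le_trans _ _ (term j x)).
    rewrite /term indicE mem_set// mul1e -EFinM lee_fin ler_pM2r//.
    by apply: ge0_ler_powR; rewrite ?nnegrE ?(ltW pp)// ltW.
  apply: (@le_trans _ _ (\sum_(0 <= i <oo) term i x)%E).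
    apply: (@le_trans _ _ (\sum_(0 <= i < j.+1) term i x)%E).
      by rewrite big_nat_recr//= leeDr// sume_ge0.
    by apply: nneseries_lim_ge => i _ _; exact: term0.
  by rewrite leeDr// lee_fin mulr_ge0 ?powR_ge0// ltW.
Qed.

End dyadic_maximal.

(** * Stopping cells of a given size of averages *)

Section level_sets.
Context (R : realType) (n : nat).
Local Notation Rn := 'rV[R]_n.+1.
Local Notation mu := (@lebn R n).
Local Notation d := n.+1.
Context (p beta alpha C1 e : R) (w s : Rn -> R).
Context (p0 : 0 < p) (beta0 : 0 < beta) (alpha01 : 0 < alpha < 1) (C10 : 0 < C1).
Context (w0 : forall x, 0 <= w x) (s0 : forall x, 0 < s x).
Context (mw : measurable_fun setT w) (ms : measurable_fun setT s).
Context (sfin : forall a l, (\int[mu]_(x in cube a l) (s x)%:E < +oo)%E).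
Local Notation IS A := (\int[mu]_(x in A) (s x)%:E)%E.
Local Notation IW A := (\int[mu]_(x in A) (w x)%:E)%E.
Context (o : Rn) (L : R) (L0 : 0 < L).
Local Notation C := (cell o L).
Context (muck : forall m x (F G : set Rn), measurable F -> measurable G ->
  F `<=` C m x ->
  (mu (C m x `&` G) <= ((1 - alpha) / 2)%:E * mu (C m x))%E ->
  (IW F * ((fine (IS (C m x)) / side L m ^+ d) `^ p)%:E <=
   (C1 * (fine (mu F) / side L m ^+ d) `^ beta)%:E * IS (C m x `\` G))%E).
Context (F : Rn -> R) (mF : measurable_fun setT F) (F0 : forall x, 0 <= F x).
Context (Psi : Rn -> \bar R) (mPsi : measurable_fun setT Psi) (Psi0 : forall x, (0 <= Psi x)%E).
Context (maxPsi : forall m x r, 0 <= r ->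
  (r%:E * IS (C m x) <= \int[mu]_(y in C m x) (F y)%:E)%E ->
  ((r `^ p * s x)%:E <= (e `^ p * s x)%:E + Psi x)%E).
Context (Z : set Rn) (lam0 : R) (lam00 : 0 < lam0).

(** Restricting to cells that meet [Z] keeps the level sets within a fixed cube. *)
Definition meets j x := exists2 z, Z z & C j x z.

Context (top : forall x, meets 0 x ->
  (\int[mu]_(y in C 0 x) (F y)%:E <= (lam0 * side L 0 ^+ d)%:E)%E).

Definition large (lam : R) j x :=
  meets j x /\ ((lam * side L j ^+ d)%:E < \int[mu]_(y in C j x) (F y)%:E)%E.

Lemma large_invariant lam : cell_invariant o L (large lam).
Proof. by move=> j x y xy; rewrite /large /meets (cell_eq xy). Qed.

Lemma first_large_invariant lam : cell_invariant o L (first_level (large lam)).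
Proof. by apply: first_level_invariant; exact: large_invariant. Qed.

(** Passing from a maximal cell to its parent may double the side, whence
    [2^d]; the other factor leaves the proportion [(1 - alpha) / 2] to the next
    level set. *)
Definition ratio : R := 2 ^+ d * 2 / (1 - alpha).

Lemma ratio_ge1 : 1 <= ratio.
Proof.
have /andP[a0 a1] := alpha01.
rewrite /ratio ler_pdivlMr ?subr_gt0// mul1r.
have h2 : 1 <= 2 ^+ d :> R by rewrite exprn_ege1// ler1n.
by lra.
Qed.

Lemma large_le lam lam' j x : lam <= lam' -> large lam' j x -> large lam j x.
Proof.
move=> ll [mj lF]; split=> //; apply: le_lt_trans lF.
by rewrite lee_fin ler_pM2r// exprn_gt0// side_gt0.
Qed.

Definition level_set (lam : R) : set Rn := cells (large lam).

Lemma measurable_level_set lam : measurable (level_set lam).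
Proof. exact: (measurable_cells L0 (@large_invariant _)). Qed.

Lemma level_set_le lam lam' : lam <= lam' -> level_set lam' `<=` level_set lam.
Proof. by move=> ll x [j /(large_le ll) h]; exists j. Qed.

Let mFE : measurable_fun setT (fun y => (F y)%:E).
Proof. exact/measurable_EFinP. Qed.

(** The parent of a maximal cell is not large, and cells of level 0 satisfy the bound
    by hypothesis. *)
Lemma stopping_average lam j x : lam0 <= lam -> first_level (large lam) j x ->
  (\int[mu]_(y in C j x) (F y)%:E <= (2 ^+ d * lam * side L j ^+ d)%:E)%E.
Proof.
move=> l0l [[[z Zz jz] lF] mn]; case: j => [|j] in jz lF mn *.
  have m0 : meets 0 x by exists z.
  have := lt_le_trans lF (top m0); rewrite lte_fin ltr_pM2r ?exprn_gt0 ?side_gt0//.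
  by rewrite ltNge l0l.
have mj : meets j x by exists z => //; exact: cell_nestS.
have nl : ~ large lam j x by exact: mn.
apply: (@le_trans _ _ (\int[mu]_(y in C j x) (F y)%:E)%E).
  apply: ge0_subset_integral; [exact: measurable_cell|exact: measurable_cell| | |exact: cell_nestS].
    exact: measurable_funTS.
  by move=> y _; rewrite lee_fin.
have : (\int[mu]_(y in C j x) (F y)%:E <= (lam * side L j ^+ d)%:E)%E.
  by rewrite leNgt; apply/negP => h; apply: nl.
move=> /le_trans; apply; rewrite lee_fin (sideS L) exprMn.
by rewrite le_eqVlt; apply/orP; left; apply/eqP; ring.
Qed.

(** A weak type bound inside the maximal cell. *)
Lemma next_level_small lam j x : lam0 <= lam -> first_level (large lam) j x ->
  (mu (C j x `&` level_set (ratio * lam)) <= ((1 - alpha) / 2)%:E * mu (C j x))%E.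
Proof.
move=> l0l stop; have lam_gt0 : 0 < lam by apply: lt_le_trans l0l.
have rl : lam <= ratio * lam by rewrite ler_peMl ?ratio_ge1// ltW.
have r0 : 0 < ratio by apply: lt_le_trans ratio_ge1.
pose P i y := first_level (large (ratio * lam)) i y /\ C j x y.
have level i y : P i y -> (j <= i)%N.
  move=> [[ly _] xy]; have [_ mn] := first_large_invariant xy stop.
  by rewrite leqNgt; apply/negP => ij; apply: (mn _ ij); exact: large_le ly.
have Pinv : cell_invariant o L P.
  move=> i y z yz Py; have ij := level _ _ Py; case: Py => [fy xy]; split.
    exact: first_large_invariant yz fy.
  by move: (cell_nest ij yz); rewrite (cell_eq xy).
have Puniq : level_unique P.
  by move=> i i' y [fy _] [fy' _]; exact: first_level_unique fy fy'.
have PE : cells P = C j x `&` level_set (ratio * lam).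
  apply/seteqP; split => y.
    by move=> [i [[ly _] xy]]; split=> //; exists i.
  by move=> [xy [i /first_level_exists[i' _ fi']]]; exists i'.
have mC : measurable (C j x) by exact: measurable_cell.
have := @le_integral_cells _ _ o L L0 P (cst (ratio * lam)%:E) (fun y => (F y)%:E)
  setT setT Pinv Puniq measurableT measurableT (@measurable_cst _ _ _ _ _ _) mFE.
rewrite !setIT PE integral_cst; last by apply: measurableI => //; exact: measurable_level_set.
move=> H.
have rl0 : 0 < ratio * lam by rewrite mulr_gt0.
rewrite -(@lee_pmul2l _ (ratio * lam)%:E)//; apply: le_trans (H _ _ _) _.
- by move=> y; rewrite lee_fin ltW.
- by move=> y; rewrite lee_fin.
- move=> i y [[[_ /ltW ly] _] _].
  rewrite !setIT integral_cst; last exact: measurable_cell.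
  by rewrite [X in (_ * X <= _)%E]lebn_cell// -EFinM.
apply: (@le_trans _ _ (\int[mu]_(y in C j x) (F y)%:E)%E).
  apply: ge0_subset_integral; [|exact: mC| | |exact: subIsetl].
  - by apply: measurableI => //; exact: measurable_level_set.
  - exact: measurable_funTS.
  - by move=> y _; rewrite lee_fin.
apply: le_trans (stopping_average l0l stop) _.
rewrite [X in (_ <= _ * (_ * X))%E]lebn_cell// -!EFinM lee_fin /ratio.
rewrite le_eqVlt; apply/orP; left; apply/eqP; field.
by have /andP[_ a1] := alpha01; rewrite gt_eqF// subr_gt0.
Qed.

Context (o' : Rn) (l : R) (l0 : 0 < l).
Local Notation B := (cell o' l).
Context (gen : nat -> nat -> Rn -> Prop) (theta : R).
Context (theta0 : 0 < theta) (theta1 : theta < 1).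
Local Notation layer g := (cells (gen g)).
Context (gen_inv : forall g, cell_invariant o' l (gen g)).
Context (gen_uniq : forall g, level_unique (gen g)).
Context (layer_dec : forall g, layer g.+1 `<=` layer g).
Context (packing : forall g m i x, gen g i x ->
  (mu (B i x `&` layer (g + m)) <= (theta ^+ m)%:E * mu (B i x))%E).

Definition trapped g lam j y :=
  gen g j y /\ exists2 i, large lam i y & B j y `<=` C i y.

Lemma trapped_invariant g lam : cell_invariant o' l (trapped g lam).
Proof.
move=> j x y xy [gx [i lx BC]]; split; first exact: gen_inv gx.
have yx : C i x y by exact: BC.
exists i; first exact: large_invariant lx.
by rewrite (cell_eq xy) (cell_eq yx).
Qed.

Definition ring_of g m : set Rn := layer (g + m) `\` layer (g + m).+1.

Lemma measurable_layer' g : measurable (layer g).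
Proof. exact: (measurable_cells l0 (@gen_inv g)). Qed.

(** The points of depth exactly m below a stopping cell that is contained in a cell
    with average above [lam]. *)
Definition trapped_set lam m : set Rn :=
  \bigcup_g (cells (trapped g lam) `&` ring_of g m).

Lemma measurable_trapped_set lam m : measurable (trapped_set lam m).
Proof.
apply: bigcup_measurable => g _; apply: measurableI.
  exact: (measurable_cells l0 (@trapped_invariant _ _)).
by apply: measurableD; exact: measurable_layer'.
Qed.

Lemma trapped_set_sub lam m : trapped_set lam m `<=` level_set lam.
Proof. by move=> x [g _ [[j [_ [i li _]]] _]]; exists i. Qed.

(** Let P run through the trapped cells of generation g inside the maximal cell. The
    layer g + m has measure at most [theta^m |P|] in P, and [|P|] is at most
    [(1 - theta)^-1] times the part of P outside the layer g + 1. The latter parts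
    are disjoint for distinct g as well. *)
Lemma lebn_trapped_le lam m j x : first_level (large lam) j x ->
  (mu (C j x `&` trapped_set lam m) <=
   (theta ^+ m / (1 - theta))%:E * mu (C j x))%E.
Proof.
move=> stop; have t1 : 0 < 1 - theta by rewrite subr_gt0.
have tm0 : 0 <= theta ^+ m / (1 - theta) by rewrite divr_ge0 ?exprn_ge0// ltW.
have mC : measurable (C j x) by exact: measurable_cell.
pose D g : set Rn := C j x `&` (layer g `\` layer g.+1).
have mD g : measurable (D g).
  by apply: measurableI => //; apply: measurableD; exact: measurable_layer'.
have trD : trivIset setT D.
  suff H i k y : (i < k)%N -> D i y -> D k y -> False.
    apply/trivIsetP => i k _ _ ik; apply/seteqP; split => // y [yi yk].
    by case: (ltngtP i k) ik => // ik _; [exact: H ik yi yk|exact: H ik yk yi].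
  move=> ik [_ [_ ni]] [_ [lk _]]; apply: ni.
  elim: k ik lk => // k IH; rewrite ltnS leq_eqVlt => /predU1P[->//|ik lk].
  by apply: IH ik _; exact: layer_dec.
have piece g : (mu (C j x `&` (cells (trapped g lam) `&` ring_of g m)) <=
    (theta ^+ m / (1 - theta))%:E * mu (D g))%E.
  pose P i y := trapped g lam i y /\ C j x y.
  have PC i y : P i y -> B i y `<=` C j x.
    move=> [[_ [i' li' BC]] xy].
    have [_ mn] := first_large_invariant xy stop.
    have ji' : (j <= i')%N by rewrite leqNgt; apply/negP => h; exact: (mn _ h).
    by rewrite -(cell_eq xy); exact: subset_trans BC (cell_nest ji').
  have Pinv : cell_invariant o' l P.
    move=> i y z yz Py; split; first by apply: (trapped_invariant yz); case: Py.
    exact: PC Py _ yz.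
  have Puniq : level_unique P.
    by move=> i i' y [[gy _] _] [[gy' _] _]; exact: gen_uniq gy gy'.
  have tD : measurable (~` layer g.+1) by apply: measurableC; exact: measurable_layer'.
  have := @le_measure_cells _ _ o' l l0 P (1 - theta) (theta ^+ m)
    (layer (g + m)) (~` layer g.+1) (ltW t1) (exprn_ge0 _ (ltW theta0))
    Pinv Puniq (measurable_layer' _) tD.
  move=> H.
  rewrite -(@lee_pmul2l _ (1 - theta)%:E)// muleA -EFinM mulrCA divff ?gt_eqF// mulr1.
  apply: (@le_trans _ _ ((1 - theta)%:E * mu (cells P `&` layer (g + m)))%E).
    rewrite lee_pmul2l//; apply: lebn_le => y [xy [[i ti] [lgm _]]]; split=> //.
    by exists i.
  apply: le_trans (H _) _; last first.
    apply: lee_wpmul2l; first by rewrite lee_fin exprn_ge0// ltW.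
    apply: lebn_le => y [[i Py] ny]; split; first by case: Py.
    by split=> //; exists i; case: Py => -[].
  move=> i y [[gy _] _].
  have mB : measurable (B i y) by exact: measurable_cell.
  have muB : mu (B i y) = (side l i ^+ d)%:E by exact: lebn_cell.
  apply: (@le_trans _ _ ((1 - theta)%:E * ((theta ^+ m)%:E * mu (B i y)))%E).
    by rewrite lee_pmul2l//; exact: packing.
  rewrite muleCA; apply: lee_wpmul2l; first by rewrite lee_fin exprn_ge0// ltW.
  have := packing 1 gy; rewrite addn1 expr1 => pk.
  have split_mu : (mu (B i y) <= mu (B i y `&` layer g.+1) + mu (B i y `&` ~` layer g.+1))%E.
    apply: le_trans (lebn_setU_le _ _); apply: lebn_le => z Bz.
    by have [lz|lz] := pselect (layer g.+1 z); [left|right].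
  have Xfin : mu (B i y `&` ~` layer g.+1) \is a fin_num.
    rewrite ge0_fin_numE//; apply: (@le_lt_trans _ _ (mu (B i y))).
      by apply: lebn_le; exact: subIsetl.
    by rewrite muB ltry.
  have := le_trans split_mu (leeD2r _ pk).
  by rewrite muB -(fineK Xfin) -!EFinM -EFinD !lee_fin; lra.
have -> : C j x `&` trapped_set lam m =
    \bigcup_g (C j x `&` (cells (trapped g lam) `&` ring_of g m)).
  by rewrite /trapped_set setI_bigcupr.
apply: (@le_trans _ _ (\sum_(0 <= g <oo) mu (C j x `&` (cells (trapped g lam) `&` ring_of g m)))%E).
  exact: lebn_outer_sigma_subadditive.
apply: (@le_trans _ _ (\sum_(0 <= g <oo) (theta ^+ m / (1 - theta))%:E * mu (D g))%E).
  by apply: lee_nneseries => [g _ _|g _]; [exact: measure_ge0|exact: piece].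
rewrite nneseriesZl; last by move=> g _; exact: measure_ge0.
apply: lee_wpmul2l; first by rewrite lee_fin.
have <- : mu (\bigcup_g D g) = (\sum_(0 <= g <oo) mu (D g))%E.
  by rewrite measure_bigcup//; apply: eq_eseriesl => g; rewrite in_setT.
by apply: lebn_le => y [g _ []].
Qed.

(** It bounds [r^p s] for every weighted average r at the point, see [maxPsi]. *)
Definition majorant (y : Rn) : \bar R := ((e `^ p * s y)%:E + Psi y)%E.

Lemma majorant_ge0 y : (0 <= majorant y)%E.
Proof. by rewrite adde_ge0// lee_fin mulr_ge0 ?powR_ge0// ltW. Qed.

Lemma measurable_majorant : measurable_fun setT majorant.
Proof.
apply: emeasurable_funD; last exact: mPsi.
by apply/measurable_EFinP; apply: measurable_funM; [exact: measurable_cst|exact: ms].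
Qed.

Definition gap_constant m : R := C1 * (theta ^+ m / (1 - theta)) `^ beta.

Lemma gap_constant_ge0 m : 0 <= gap_constant m.
Proof. by rewrite mulr_ge0 ?powR_ge0// ltW. Qed.

(** Condition W_p on a maximal cell [C], with [F] the trapped points and [G] the next
    level set. As the average of F over [C] exceeds [lam], the quotient r of the
    integrals of F and s over [C] is an average relative to [s], and
    [lam = r (s(C) / |C|)]. *)
Lemma level_estimate lam m : lam0 <= lam ->
  ((lam `^ p)%:E * IW (trapped_set lam m) <=
   (gap_constant m)%:E *
   \int[mu]_(y in level_set lam `\` level_set (ratio * lam)) majorant y)%E.
Proof.
move=> l0l; have lam_gt0 : 0 < lam by apply: lt_le_trans l0l.
have t1 : 0 < 1 - theta by rewrite subr_gt0.
set G := level_set (ratio * lam).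
have mG : measurable G by exact: measurable_level_set.
have mT : measurable (trapped_set lam m) by exact: measurable_trapped_set.
pose f1 x := ((lam `^ p)%:E * (w x)%:E)%E.
pose f2 y := ((gap_constant m)%:E * majorant y)%E.
have mf1 : measurable_fun setT f1.
  by apply: emeasurable_funM; [exact: measurable_cst|exact/measurable_EFinP].
have mf2 : measurable_fun setT f2.
  by apply: emeasurable_funM; [exact: measurable_cst|exact: measurable_majorant].
have pull1 (A : set Rn) : measurable A ->
    (\int[mu]_(x in A) f1 x = (lam `^ p)%:E * IW A)%E.
  move=> mA; apply: ge0_integralZl_EFin; [exact: mA| | |exact: powR_ge0].
    by move=> x _; rewrite lee_fin.
  by apply: measurable_funTS; apply/measurable_EFinP.
have pull2 (A : set Rn) : measurable A ->
    (\int[mu]_(x in A) f2 x = (gap_constant m)%:E * \int[mu]_(x in A) majorant x)%E.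
  move=> mA; apply: ge0_integralZl_EFin; [exact: mA| | |exact: gap_constant_ge0].
    by move=> x _; exact: majorant_ge0.
  by apply: measurable_funTS; exact: measurable_majorant.
have := @le_integral_cells _ _ o L L0 (first_level (large lam)) f1 f2
  (trapped_set lam m) (~` G) (@first_large_invariant lam)
  (@first_level_unique _ _ _) mT (measurableC mG) mf1 mf2.
rewrite cells_first_level -/(level_set lam) -setDE.
rewrite (setIidr (@trapped_set_sub lam m)) pull1// pull2; last first.
  by apply: measurableD => //; exact: measurable_level_set.
apply.
- by move=> x; rewrite mule_ge0// lee_fin// powR_ge0.
- by move=> y; rewrite mule_ge0// ?lee_fin ?gap_constant_ge0// majorant_ge0.
move=> j x stop; have mC : measurable (C j x) by exact: measurable_cell.
have mCT : measurable (C j x `&` trapped_set lam m) by exact: measurableI.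
have mCG : measurable (C j x `\` G) by exact: measurableD.
rewrite pull1// -setDE pull2//.
set v := side L j ^+ d.
have v0 : 0 < v by rewrite exprn_gt0// side_gt0.
have muC : mu (C j x) = v%:E by exact: lebn_cell.
have ISfin : IS (C j x) \is a fin_num by exact: weight_cell_fin.
have IS0 : (0 < IS (C j x))%E.
  by apply: integral_gt0 => //; rewrite [ltRHS]muC lte_fin.
set S := fine (IS (C j x)).
have SE : IS (C j x) = S%:E by rewrite fineK.
have S0 : 0 < S by rewrite -lte_fin -SE.
pose r := lam * v / S.
have r0 : 0 <= r by rewrite divr_ge0 ?mulr_ge0// ltW.
have rF : (r%:E * IS (C j x) <= \int[mu]_(y in C j x) (F y)%:E)%E.
  rewrite SE -EFinM /r divfK ?gt_eqF//.
  by case: stop => -[_ /ltW].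
have Gsmall := next_level_small l0l stop.
have mk := muck mCT mG (@subIsetl _ _ _) Gsmall.
rewrite -/v -/S in mk.
have lamE : lam `^ p = r `^ p * (S / v) `^ p.
  rewrite -powRM//; last by rewrite divr_ge0// ltW.
  by congr (_ `^ _); rewrite /r; field; rewrite !gt_eqF.
have Tle : fine (mu (C j x `&` trapped_set lam m)) / v <= theta ^+ m / (1 - theta).
  rewrite ler_pdivrMr//; have := lebn_trapped_le m stop; rewrite muC -EFinM => h.
  rewrite -lee_fin fineK// ge0_fin_numE; last exact: measure_ge0.
  by apply: le_lt_trans h _; rewrite ltry.
rewrite lamE EFinM -muleA [X in (_ * X <= _)%E]muleC.
apply: (@le_trans _ _ ((r `^ p)%:E * ((gap_constant m)%:E * IS (C j x `\` G)))%E).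
  apply: lee_wpmul2l; first by rewrite lee_fin powR_ge0.
  apply: le_trans mk _; apply: lee_wpmul2r; first by apply: integral_ge0 => y _; rewrite lee_fin ltW.
  rewrite lee_fin ler_pM2l//; apply: ge0_ler_powR; rewrite ?nnegrE ?(ltW beta0)//.
    by rewrite divr_ge0 ?(ltW v0)// fine_ge0.
  by rewrite divr_ge0 ?exprn_ge0// ltW.
rewrite muleCA; apply: lee_wpmul2l; first by rewrite lee_fin gap_constant_ge0.
rewrite -ge0_integralZl_EFin; last first.
- exact: powR_ge0.
- by apply: measurable_funTS; apply/measurable_EFinP.
- by move=> y _; rewrite lee_fin ltW.
- exact: mCG.
apply: ge0_le_integral; [exact: mCG| | | |].
- by move=> y _; rewrite mule_ge0// lee_fin ?powR_ge0// ltW.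
- apply: measurable_funTS; apply: emeasurable_funM; first exact: measurable_cst.
  exact/measurable_EFinP.
- by apply: measurable_funTS; exact: measurable_majorant.
move=> y [xy _]; rewrite -EFinM; apply: (@maxPsi j y r r0).
by rewrite (cell_eq xy).
Qed.

(** The differences of consecutive level sets are disjoint. *)
Lemma level_sum m :
  (\sum_(0 <= k <oo) ((lam0 * ratio ^+ k) `^ p)%:E * IW (trapped_set (lam0 * ratio ^+ k) m) <=
   (gap_constant m)%:E * \int[mu]_(y in level_set lam0) majorant y)%E.
Proof.
have r1 := ratio_ge1.
pose lam k := lam0 * ratio ^+ k.
have lam_ge k : lam0 <= lam k by rewrite /lam ler_peMr ?exprn_ege1// ltW.
pose D k := level_set (lam k) `\` level_set (lam k.+1).
have mD k : measurable (D k) by apply: measurableD; exact: measurable_level_set.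
have lamS k : lam k.+1 = ratio * lam k by rewrite /lam exprS; ring.
have lam_dec i k : (i <= k)%N -> level_set (lam k) `<=` level_set (lam i).
  move=> ik; apply: level_set_le; rewrite /lam ler_pM2l//.
  exact: ler_weXn2l.
have trD : trivIset setT D.
  suff H i k y : (i < k)%N -> D i y -> D k y -> False.
    apply/trivIsetP => i k _ _ ik; apply/seteqP; split => // y [yi yk].
    by case: (ltngtP i k) ik => // ik _; [exact: H ik yi yk|exact: H ik yk yi].
  by move=> ik [_ ni] [lk _]; apply: ni; exact: lam_dec lk.
apply: (@le_trans _ _ (\sum_(0 <= k <oo) (gap_constant m)%:E * \int[mu]_(y in D k) majorant y)%E).
  apply: lee_nneseries => [k _ _|k _].
    rewrite mule_ge0 ?lee_fin ?powR_ge0//.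
    by apply: integral_ge0 => y _; rewrite lee_fin.
  by rewrite /D lamS; exact: (@level_estimate (lam k) m (lam_ge k)).
rewrite nneseriesZl; last by move=> k _; apply: integral_ge0 => y _; exact: majorant_ge0.
apply: lee_wpmul2l; first by rewrite lee_fin gap_constant_ge0.
rewrite -ge0_integral_bigcup//; last 2 first.
- by apply: measurable_funTS; exact: measurable_majorant.
- by move=> y _; exact: majorant_ge0.
apply: ge0_subset_integral; [exact: bigcup_measurable|exact: measurable_level_set| | |].
- by apply: measurable_funTS; exact: measurable_majorant.
- by move=> y _; exact: majorant_ge0.
- by move=> y [k _ [lk _]]; apply: level_set_le lk.
Qed.

End level_sets.

(** * The dual weight *)

Lemma powR_inv (R : realType) (a q : R) : 0 < a -> a^-1 `^ q = (a `^ q)^-1.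
Proof. by move=> a0; rewrite -(powR_inv1 (ltW a0)) -powRrM mulN1r powRN. Qed.

Lemma lebn_setD (R : realType) (n : nat) (A B : set 'rV[R]_n.+1) (a b : R) :
  measurable A -> measurable B -> B `<=` A -> lebn A = a%:E -> lebn B = b%:E ->
  lebn (A `\` B) = (a - b)%:E.
Proof.
move=> mA mB BA Aa Bb.
have : lebn A = (lebn (A `\` B) + lebn (A `&` B))%E by exact: measureDI.
rewrite (setIidr BA) Aa Bb.
case: (lebn (A `\` B)) => [x /=|//|//].
by rewrite -EFinD => -[->]; rewrite addrK.
Qed.

Section dual_weights.
Context (R : realType) (n : nat).
Local Notation Rn := 'rV[R]_n.+1.
Local Notation mu := (@lebn R n).
Local Notation d := n.+1.
Context (p : R) (dil : R -> R) (beta : R) (w v : Rn -> R).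
Context (p1 : 1 < p).
Context (dil1 : forall alpha : R, 0 < alpha < 1 -> 1 < dil alpha).
Context (v0 : forall x, 0 <= v x) (mv : measurable_fun setT v).
Context (w0 : forall x, 0 <= w x).
Context (wv : Wp p dil beta w v).

(** The dual weight, made finite on the null set where [v] vanishes. *)
Definition density (x : Rn) : R := if v x == 0 then 1 else v x `^ (1 - p / (p - 1)).

Lemma density_gt0 x : 0 < density x.
Proof.
rewrite /density; case: ifPn => // vx; apply: powR_gt0.
by rewrite lt_neqAle eq_sym vx v0.
Qed.

Let mv0 : measurable_fun setT (fun x => v x == 0).
Proof.
rewrite (_ : (fun x => _) = (fun x => v x <= 0)); last first.
  by apply/funext => x; rewrite eq_le v0 andbT.
by apply: measurable_fun_ler; [exact: mv|exact: measurable_cst].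
Qed.

Let mvp (r : R) : measurable_fun setT (fun x => v x `^ r).
Proof. exact: (measurableT_comp (measurable_powR r)). Qed.

Lemma measurable_density : measurable_fun setT density.
Proof. by apply: measurable_fun_ifT; [exact: mv0|exact: measurable_cst|exact: mvp]. Qed.

Lemma measurable_dual_weight : measurable_fun setT (dual_weight p v).
Proof.
apply: measurable_fun_ifT; [exact: mv0|exact: measurable_cst|].
by apply/measurable_EFinP; exact: mvp.
Qed.

Lemma dual_weight_ge0 x : (0 <= dual_weight p v x)%E.
Proof. by rewrite /dual_weight; case: ifP => // _; rewrite lee_fin powR_ge0. Qed.

Lemma le_dual_weight (A B : set Rn) : measurable A -> measurable B -> A `<=` B ->
  (\int[mu]_(x in A) dual_weight p v x <= \int[mu]_(x in B) dual_weight p v x)%E.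
Proof.
move=> mA mB AB; apply: ge0_subset_integral; [exact: mA|exact: mB| | |exact: AB].
  by apply: measurable_funTS; exact: measurable_dual_weight.
by move=> x _; exact: dual_weight_ge0.
Qed.

(** Take for [E'] the given cube and for [E] the shell between it and a slightly larger
    cube [Q]. The set [E] has positive measure, hence the finiteness
    required by W_p concerns the integral over [E']. *)
Lemma dual_weight_cube_fin (a : Rn) (l : R) :
  (\int[mu]_(x in cube a l) dual_weight p v x < +oo)%E.
Proof.
wlog l0 : l / 0 < l => [H|].
  have : (\int[mu]_(x in cube a (Num.max l 1)%R) dual_weight p v x < +oo)%E.
    by apply: H; rewrite lt_max ltr01 orbT.
  apply: le_lt_trans; apply: le_dual_weight; [exact: measurable_cube|exact: measurable_cube|].
  by apply: cube_le; rewrite le_max lexx.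
have [beta0 [alpha [c0 [alpha01 c00 W]]]] := wv.
have /andP[a0 a1] := alpha01.
have e0 : 0 < alpha^-1 - 1 by rewrite subr_gt0 invf_gt1.
have [del del0] := @prod_enlarge _ _ (enum 'I_d) (fun=> 1) _ e0.
rewrite !big_enum/= !prodr_const card_ord expr1n (addrC 1 (alpha^-1 - 1)) subrK => le_del.
pose t := 1 + del; have t1 : 1 < t by rewrite ltrDl.
have lt0 : 0 < l * t by rewrite mulr_gt0// (lt_trans ltr01).
have ltl : l < l * t by rewrite ltr_pMr.
have sub : cube a l `<=` cube a (l * t) by apply: cube_le; exact: ltW.
have mQ r : measurable (cube a r) by exact: measurable_cube.
pose E := cube a (l * t) `\` cube a l.
have mE : measurable E by exact: measurableD.
have muE : mu E = ((l * t) ^+ d - l ^+ d)%:E.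
  by apply: lebn_setD => //; rewrite lebn_cube// ltW.
have E0 : 0 < (l * t) ^+ d - l ^+ d.
  by rewrite subr_gt0 ltr_pXn2r// ?nnegrE ltW.
have big : (alpha%:E * mu (cube a (l * t)) <= mu (cube a l))%E.
  rewrite !lebn_cube ?(ltW l0) ?(ltW lt0)// -EFinM lee_fin exprMn mulrCA.
  rewrite ger_pMr ?exprn_gt0// mulrC -ler_pdivlMr// div1r.
  exact: le_del.
have := W a (l * t) E (cube a l) lt0 mE (mQ l).
move=> /(_ (@subDsetl _ _ _) sub _ big)/andP[|_].
  by apply/seteqP; split => // x [[_]].
have : (0 <= \int[mu]_(x in cube a l) dual_weight p v x)%E.
  by apply: integral_ge0 => x _; exact: dual_weight_ge0.
case: (\int[mu]_(x in cube a l) dual_weight p v x)%E => [r _ _|_|//]; first exact: ltry.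
rewrite -EFinM gt0_muley ?ltxx// lte_fin mulr_gt0// powR_gt0//.
rewrite lebn_cube ?(ltW lt0)// muE /=.
by rewrite divr_gt0// exprn_gt0.
Qed.

(** The dual weight is infinite where [v] vanishes. *)
Lemma lebn_weight_zero : mu [set x | v x = 0] = 0%E.
Proof.
have -> : [set x | v x = 0] = \bigcup_(k : nat) ([set x | v x = 0] `&` cube 0 k%:R).
  apply/seteqP; split => x; last by move=> [k _ []].
  move=> vx; pose N := \sum_i Num.bound (2 * `|x 0 i|).
  exists N => //; split=> // i; rewrite mxE subr0 ler_pdivlMr// mulrC.
  have B0 : 0 <= 2 * `|x 0 i| by rewrite mulr_ge0.
  apply: le_trans (ltW (archi_boundP B0)) _; rewrite ler_nat.
  by rewrite /N (bigD1 i)//= leq_addr.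
apply: lebn_null_bigcup => k.
have mQ : measurable (cube (0 : Rn) k%:R) by exact: measurable_cube.
have : mu.-integrable (cube (0 : Rn) k%:R) (dual_weight p v).
  apply/integrableP; split.
    by apply: measurable_funTS; exact: measurable_dual_weight.
  apply: le_lt_trans (dual_weight_cube_fin 0 k%:R).
  rewrite le_eqVlt; apply/orP; left; apply/eqP; apply: eq_integral => x _.
  by rewrite gee0_abs//; exact: dual_weight_ge0.
move=> /(integrable_ae mQ)[N [mN N0 sub]].
apply: lebn_null_sub N0 => x [vx xQ]; apply: sub => /(_ xQ).
by rewrite /dual_weight vx eqxx.
Qed.

Lemma integral_density (A : set Rn) : measurable A ->
  (\int[mu]_(x in A) (density x)%:E = \int[mu]_(x in A) dual_weight p v x)%E.
Proof.
move=> mA; apply: ge0_ae_eq_integral; [exact: mA| | | | |].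
- by apply: measurable_funTS; apply/measurable_EFinP; exact: measurable_density.
- by apply: measurable_funTS; exact: measurable_dual_weight.
- by move=> x _; rewrite lee_fin ltW// density_gt0.
- by move=> x _; exact: dual_weight_ge0.
- exists [set x | v x = 0]; split.
  + by apply: lebn_null_measurable; exact: lebn_weight_zero.
  + exact: lebn_weight_zero.
  + move=> x /= h; apply: contrapT => vx; apply: h => _.
    by rewrite /density /dual_weight; move/eqP/negbTE : vx => ->.
Qed.

Lemma density_cube_fin (a : Rn) (l : R) : (\int[mu]_(x in cube a l) (density x)%:E < +oo)%E.
Proof.
by rewrite integral_density; [exact: dual_weight_cube_fin|exact: measurable_cube].
Qed.

Lemma Wp_muckenhoupt : exists alpha c0, [/\ 0 < alpha < 1, 0 < c0 &
  muckenhoupt_type p beta alpha c0 w density].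
Proof.
have [beta0 [alpha [c0 [alpha01 c00 W]]]] := wv.
exists alpha, c0; split=> // a l E E' l0 mE mE' EQ E'Q EE' big.
have mQ r : measurable (cube a r) by exact: measurable_cube.
have l1 : l <= dil alpha * l by rewrite ler_peMl ?(ltW l0)// ltW// dil1.
have muQ : mu (cube a l) = (l ^+ d)%:E by rewrite lebn_cube// ltW.
have := W a l E E' l0 mE mE' EQ E'Q EE'; rewrite muQ -EFinM.
move=> /(_ big)/andP[H _]; rewrite !integral_density// [X in (_ <= X * _)%E]EFinM.
apply: le_trans H; apply: lee_wpmul2l; first by apply: integral_ge0 => x _; rewrite lee_fin.
have Dfin r : (\int[mu]_(x in cube a r) dual_weight p v x)%E \is a fin_num.
  rewrite ge0_fin_numE ?dual_weight_cube_fin//.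
  by apply: integral_ge0 => x _; exact: dual_weight_ge0.
have D0 r : 0 <= fine (\int[mu]_(x in cube a r) dual_weight p v x)%E.
  by apply: fine_ge0; apply: integral_ge0 => x _; exact: dual_weight_ge0.
have ld0 : 0 < l ^+ d by rewrite exprn_gt0.
rewrite -[X in ((_ * X) `^ _)%E](fineK (Dfin _)) -EFinM poweR_EFin lee_fin /=.
apply: ge0_ler_powR; rewrite ?nnegrE.
- by rewrite ltW// (lt_trans ltr01).
- by rewrite divr_ge0// ltW.
- by rewrite mulr_ge0// invr_ge0 ltW.
rewrite mulrC ler_pM2l ?invr_gt0//.
by apply: fine_le => //; apply: le_dual_weight => //; exact: cube_le.
Qed.

Lemma density_powR x : v x != 0 -> density x `^ (1 - p) = v x.
Proof.
move=> vx; rewrite /density (negPf vx) -powRrM.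
rewrite (_ : _ * _ = 1) ?powRr1//.
by field; rewrite subr_eq0 gt_eqF.
Qed.

End dual_weights.

(** * Averages over large cubes *)

Section averages_decay.
Context (R : realType) (n : nat).
Local Notation Rn := 'rV[R]_n.+1.
Local Notation mu := (@lebn R n).
Local Notation d := n.+1.
Context (p beta alpha c0 : R) (w s : Rn -> R).
Context (p1 : 1 < p) (beta0 : 0 < beta) (alpha01 : 0 < alpha < 1) (c00 : 0 < c0).
Context (s0 : forall x, 0 < s x) (ms : measurable_fun setT s).
Context (sfin : forall a l, (\int[mu]_(x in cube a l) (s x)%:E < +oo)%E).
Context (WS : muckenhoupt_type p beta alpha c0 w s).
Context (g : Rn -> R) (g0 : forall x, 0 <= g x) (mg : measurable_fun setT g).
Context (gfin : (\int[mu]_x (g x `^ p * s x)%:E < +oo)%E).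

(** Either [t <= tau], or [(t / tau)^(p-1) >= 1]. *)
Lemma le_young (t tau : R) : 0 <= t -> 0 < tau -> t <= tau + tau `^ (1 - p) * t `^ p.
Proof.
move=> t0 tau0; have pp : 0 <= p by rewrite ltW// (lt_trans ltr01).
have [h|h] := leP t tau; first by rewrite (le_trans h)// lerDl mulr_ge0 ?powR_ge0.
apply: (@le_trans _ _ (tau `^ (1 - p) * t `^ p)); last by rewrite lerDr ltW.
have tgt : 0 < t by apply: lt_trans h.
have tE : t `^ p = t * t `^ (p - 1) by rewrite mulr_powRB1// (lt_trans ltr01).
have -> : tau `^ (1 - p) = (tau `^ (p - 1))^-1 by rewrite -powRN opprB.
rewrite tE mulrCA ler_peMr// mulrC ler_pdivlMr ?powR_gt0// mul1r.
by apply: ge0_ler_powR; rewrite ?nnegrE ?subr_ge0 ltW.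
Qed.

Lemma integral_young (a : Rn) (r tau : R) : 0 < tau ->
  (\int[mu]_(x in cube a r) (g x * s x)%:E <=
   tau%:E * \int[mu]_(x in cube a r) (s x)%:E +
   (tau `^ (1 - p))%:E * \int[mu]_x (g x `^ p * s x)%:E)%E.
Proof.
move=> tau0; have mQ : measurable (cube a r) by exact: measurable_cube.
have msE : measurable_fun setT (fun x => (s x)%:E) by exact/measurable_EFinP.
have mgp : measurable_fun setT (fun x => (g x `^ p * s x)%:E).
  apply/measurable_EFinP; apply: measurable_funM; last exact: ms.
  exact: (measurableT_comp (measurable_powR p)).
have gp0 x : (0 <= (g x `^ p * s x)%:E)%E by rewrite lee_fin mulr_ge0 ?powR_ge0// ltW.
have sE0 x : (0 <= (s x)%:E)%E by rewrite lee_fin ltW.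
have t0 : 0 <= tau `^ (1 - p) by exact: powR_ge0.
apply: (@le_trans _ _ (\int[mu]_(x in cube a r)
    (tau%:E * (s x)%:E + (tau `^ (1 - p))%:E * (g x `^ p * s x)%:E))%E).
  apply: ge0_le_integral; [exact: mQ| | | |].
  - by move=> x _; rewrite lee_fin mulr_ge0// ltW.
  - by apply: measurable_funTS; apply/measurable_EFinP; exact: measurable_funM.
  - apply: measurable_funTS; apply: emeasurable_funD.
      by apply: emeasurable_funM; [exact: measurable_cst|exact: msE].
    by apply: emeasurable_funM; [exact: measurable_cst|exact: mgp].
  - move=> x _; rewrite -!EFinM -EFinD lee_fin mulrA -mulrDl ler_pM2r//.
    exact: le_young.
rewrite ge0_integralD; [|exact: mQ| | | |]; last 4 first.
- by move=> x _; rewrite mule_ge0// lee_fin ltW.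
- by apply: measurable_funTS; apply: emeasurable_funM; [exact: measurable_cst|exact: msE].
- by move=> x _; rewrite mule_ge0.
- by apply: measurable_funTS; apply: emeasurable_funM; [exact: measurable_cst|exact: mgp].
rewrite ge0_integralZl_EFin; [|exact: mQ|by []|exact: measurable_funTS|exact: ltW].
rewrite ge0_integralZl_EFin; [|exact: mQ|by []|exact: measurable_funTS|exact: t0].
rewrite leeD2l//; apply: lee_wpmul2l; first by rewrite lee_fin.
by apply: ge0_subset_integral; [exact: mQ|exact: measurableT|exact: mgp|by []|exact: subsetT].
Qed.

Lemma local_integrability (a : Rn) (r : R) :
  (\int[mu]_(x in cube a r) (g x * s x)%:E < +oo)%E.
Proof.
apply: le_lt_trans (integral_young a r ltr01) _.
rewrite mul1e powR1 mul1e; exact: lte_add_pinfty.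
Qed.

(** W_p with [E] the fixed cube and [E'] its complement in the large one bounds
    [s(Q)^(p-1)] by [|Q|^p] times a quantity tending to 0. Young's inequality with
    [tau] proportional to [kappa |Q| / s(Q)] turns this into the claim. *)
Lemma averages_vanish (a : Rn) (l kappa : R) : 0 < l -> 0 < kappa ->
  (0 < \int[mu]_(x in cube a l) (w x)%:E)%E ->
  exists2 r0, 0 < r0 & forall r, r0 <= r ->
    (\int[mu]_(x in cube a r) (g x * s x)%:E <= (kappa * r ^+ d)%:E)%E.
Proof.
move=> l0 kap0 wl; have /andP[a0 a1] := alpha01.
have [W0 W00 W0le] : exists2 W0 : R, 0 < W0 & (W0%:E <= \int[mu]_(x in cube a l) (w x)%:E)%E.
  move: wl; case: (\int[mu]_(x in cube a l) (w x)%:E)%E => [W|_|//].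
    by rewrite lte_fin => h; exists W.
  by exists 1 => //; rewrite leey.
pose Y := fine (\int[mu]_x (g x `^ p * s x)%:E)%E.
have gp0 x : (0 <= (g x `^ p * s x)%:E)%E by rewrite lee_fin mulr_ge0 ?powR_ge0// ltW.
have YE : (\int[mu]_x (g x `^ p * s x)%:E)%E = Y%:E.
  by rewrite fineK// ge0_fin_numE//; exact: integral_ge0.
have Y0 : 0 <= Y by apply: fine_ge0; exact: integral_ge0.
pose K := (kappa / 2) `^ (1 - p) * (c0 / W0) * Y.
have cW : 0 < c0 / W0 by rewrite divr_gt0.
have K0 : 0 <= K by rewrite /K mulr_ge0// mulr_ge0 ?powR_ge0// ltW.
pose zeta := kappa / 2 / (K + 1).
have zeta0 : 0 < zeta by rewrite !divr_gt0// ltr_wpDl.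
pose q := zeta `^ beta^-1; have q0 : 0 < q by exact: powR_gt0.
pose r0 := l + l / (1 - alpha) + l / q.
have a1' : 0 < 1 - alpha by rewrite subr_gt0.
have r00 : 0 < r0 by rewrite /r0 !addr_gt0// divr_gt0.
exists r0 => // r r0r.
have la0 : 0 < l / (1 - alpha) by rewrite divr_gt0.
have lq0 : 0 < l / q by rewrite divr_gt0.
have lr : l <= r by apply: le_trans r0r; rewrite /r0; lra.
have r_gt0 : 0 < r by apply: lt_le_trans r0r.
have lar : l / (1 - alpha) <= r by apply: le_trans r0r; rewrite /r0; lra.
have lqr : l / q <= r by apply: le_trans r0r; rewrite /r0; lra.
have rd0 : 0 < r ^+ d by rewrite exprn_gt0.
have ratio_le : l ^+ d / r ^+ d <= l / r.
  rewrite -expr_div_n exprS ler_piMr ?divr_ge0 ?(ltW l0) ?(ltW r_gt0)//.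
  by rewrite exprn_ile1// ?divr_ge0 ?(ltW l0) ?(ltW r_gt0)// ler_pdivrMr// mul1r.
have mQ t : measurable (cube a t) by exact: measurable_cube.
have sub : cube a l `<=` cube a r by exact: cube_le.
have muQl : mu (cube a l) = (l ^+ d)%:E by rewrite lebn_cube// ltW.
have muQr : mu (cube a r) = (r ^+ d)%:E by rewrite lebn_cube// ltW.
pose E' := cube a r `\` cube a l.
have mE' : measurable E' by exact: measurableD.
have muE' : mu E' = (r ^+ d - l ^+ d)%:E.
  exact: lebn_setD.
have big : ((alpha * r ^+ d)%:E <= mu E')%E.
  rewrite muE' lee_fin lerBrDr -lerBrDl.
  have : l ^+ d / r ^+ d <= 1 - alpha.
    apply: le_trans ratio_le _; rewrite ler_pdivrMr// mulrC -ler_pdivrMr//.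
  by rewrite ler_pdivrMr//; lra.
have dis : cube a l `&` E' = set0 by apply/seteqP; split => // x [xl []].
have := WS r_gt0 (mQ l) mE' sub (@subDsetl _ _ _) dis big.
rewrite muQl/=; set S := fine _ => WSE.
have Sfin : (\int[mu]_(x in cube a r) (s x)%:E)%E \is a fin_num.
  by rewrite ge0_fin_numE ?sfin//; apply: integral_ge0 => x _; rewrite lee_fin ltW.
have SE : (\int[mu]_(x in cube a r) (s x)%:E)%E = S%:E by rewrite fineK.
have S0 : 0 < S.
  rewrite -lte_fin -SE; apply: integral_gt0 => //.
  by rewrite [ltRHS]muQr lte_fin.
have key : S `^ (p - 1) <= (c0 / W0) * (r ^+ d) `^ p * (l ^+ d / r ^+ d) `^ beta.
  have : (W0%:E * ((S / r ^+ d) `^ p)%:E <= (c0 * (l ^+ d / r ^+ d) `^ beta)%:E * S%:E)%E.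
    apply: (@le_trans _ _ ((\int[mu]_(x in cube a l) (w x)%:E) * ((S / r ^+ d) `^ p)%:E)%E).
      by apply: lee_wpmul2r; rewrite ?lee_fin ?powR_ge0.
    apply: le_trans WSE _; apply: lee_wpmul2l.
      by rewrite lee_fin mulr_ge0 ?powR_ge0// ltW.
    rewrite -SE; apply: ge0_subset_integral; [exact: mE'|exact: mQ| | |exact: subDsetl].
      by apply: measurable_funTS; exact/measurable_EFinP.
    by move=> x _; rewrite lee_fin ltW.
  rewrite -!EFinM lee_fin.
  have -> : (S / r ^+ d) `^ p = S * S `^ (p - 1) / (r ^+ d) `^ p.
    rewrite mulr_powRB1 ?(ltW S0) ?(lt_trans ltr01)// powRM ?(ltW S0) ?invr_ge0 ?(ltW rd0)//.
    by rewrite powR_inv.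
  have rp0 : 0 < (r ^+ d) `^ p by exact: powR_gt0.
  move=> h; rewrite -(ler_pM2l (mulr_gt0 W00 S0)).
  rewrite mulrA ler_pdivrMr// in h; apply: le_trans (_ : _ <= W0 * (S * S `^ (p - 1))) _.
    by rewrite mulrA.
  apply: le_trans h _; rewrite le_eqVlt; apply/orP; left; apply/eqP; field.
  by rewrite gt_eqF.
pose tau := kappa * r ^+ d / (2 * S).
have tau0 : 0 < tau by rewrite divr_gt0 ?mulr_gt0.
apply: le_trans (integral_young a r tau0) _.
rewrite YE SE -!EFinM -EFinD lee_fin.
have E1 : tau * S = kappa / 2 * r ^+ d by rewrite /tau; field; rewrite gt_eqF.
have E2 : tau `^ (1 - p) = (kappa / 2) `^ (1 - p) * (r ^+ d) `^ (1 - p) * S `^ (p - 1).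
  have -> : tau = kappa / 2 * r ^+ d * S^-1 by rewrite /tau; field; rewrite gt_eqF.
  rewrite powRM ?invr_ge0 ?(ltW S0) ?mulr_ge0 ?divr_ge0 ?(ltW rd0) ?(ltW kap0)//.
  rewrite powRM ?divr_ge0 ?(ltW rd0) ?(ltW kap0)//; congr (_ * _).
  by rewrite powR_inv// -powRN opprB.
have E3 : (r ^+ d) `^ (1 - p) * (r ^+ d) `^ p = r ^+ d.
  rewrite -powRD; last by apply/implyP => _; rewrite gt_eqF.
  by rewrite subrK powRr1// ltW.
have Z : (l ^+ d / r ^+ d) `^ beta <= zeta.
  have -> : zeta = q `^ beta by rewrite /q -powRrM mulVf ?gt_eqF// powRr1// ltW.
  apply: ge0_ler_powR; rewrite ?nnegrE ?(ltW beta0) ?(ltW q0)//.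
    by rewrite divr_ge0 ?exprn_ge0 ?(ltW l0) ?(ltW r_gt0).
  by apply: le_trans ratio_le _; rewrite ler_pdivrMr// mulrC -ler_pdivrMr.
rewrite E1 E2.
have step : (kappa / 2) `^ (1 - p) * (r ^+ d) `^ (1 - p) * S `^ (p - 1) * Y <=
    K * zeta * r ^+ d.
  apply: (@le_trans _ _ ((kappa / 2) `^ (1 - p) * (r ^+ d) `^ (1 - p) *
      ((c0 / W0) * (r ^+ d) `^ p * zeta) * Y)).
    apply: ler_wpM2r => //; apply: ler_wpM2l; first by rewrite mulr_ge0 ?powR_ge0.
    apply: le_trans key _; apply: ler_wpM2l => //.
    by rewrite mulr_ge0 ?powR_ge0// ltW.
  rewrite /K -[X in _ <= _ * X]E3 le_eqVlt; apply/orP; left; apply/eqP; ring.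
have Kz : K * zeta <= kappa / 2.
  rewrite /zeta mulrCA ler_piMr ?divr_ge0 ?(ltW kap0)//.
  by rewrite ler_pdivrMr ?mul1r ?lerDl// ltr_wpDl.
have : K * zeta * r ^+ d <= kappa / 2 * r ^+ d by rewrite ler_pM2r.
by move: step; lra.
Qed.

End averages_decay.

(** * Medians *)

Section median.
Context (R : realType) (n : nat).
Local Notation Rn := 'rV[R]_n.+1.
Local Notation mu := (@lebn R n).

(** Values below [c - A] and values above [c + A] are both too rare to contain the
    median. *)
Lemma median_close (h : Rn -> R) (t eta A c v : R) (Q : set Rn) :
  0 < v -> mu Q = v%:E -> 0 < eta -> eta < t -> eta < 1 - t -> 0 <= A ->
  (mu [set x | Q x /\ (A < `|h x - c|)%R] <= (eta * v)%:E)%E ->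
  `|median h t Q - c| <= A.
Proof.
move=> v0 Qv eta0 eta_t eta_1t A0 hc; rewrite /median; set S := [set M | _].
have inS : S (c - A).
  rewrite /S/= Qv -EFinM; apply: le_trans (le_trans hc _); last first.
    by rewrite lee_fin ler_pM2r// ltW.
  apply: lebn_le => x [Qx hx]; split=> //; rewrite ltr_normr; apply/orP; right.
  by move: hx; lra.
have ubS : ubound S (c + A).
  move=> M; rewrite /S/= => hM; rewrite leNgt; apply/negP => cM.
  have : (mu Q <= mu [set x | Q x /\ (h x < M)%R] + mu [set x | Q x /\ (A < `|h x - c|)%R])%E.
    apply: le_trans (lebn_setU_le _ _); apply: lebn_le => x Qx.
    have [hx|hx] := ltP (h x) M; [by left|right]; split=> //.
    by rewrite ltr_normr; apply/orP; left; lra.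
  move=> /le_trans/(_ (leeD hM hc)); rewrite Qv -EFinM -EFinD lee_fin.
  by nra.
have h1 : c - A <= sup S by apply: ub_le_sup => //; exists (c + A).
have h2 : sup S <= c + A by apply: ge_sup => //; exists (c - A).
by rewrite ler_norml; lra.
Qed.

End median.

(** * Averages over cubes and over cells of translated grids *)

Section trapping_averages.
Context (R : realType) (n : nat).
Local Notation Rn := 'rV[R]_n.+1.
Local Notation mu := (@lebn R n).
Local Notation d := n.+1.
Context (a : Rn) (l : R) (l0 : 0 < l).
Context (F : Rn -> R) (mF : measurable_fun setT F) (F0 : forall x, 0 <= F x).
Context (locF : forall c r, (\int[mu]_(y in cube c r) (F y)%:E < +oo)%E).
Context (L Lam : R) (lL : 4 * l <= L) (Lam0 : 0 < Lam).
Context (LamE : ((Lam * (6 * l) ^+ d)%:E <= \int[mu]_(y in cube a l) (F y)%:E)%E).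
Context (tail : forall r, 2 / 3 * L <= r ->
  (\int[mu]_(y in cube a r) (F y)%:E <= (Lam / (2 * 3 ^+ d) * r ^+ d)%:E)%E).

(** The lower corner of the cube, as origin of a grid in which the cube is a cell. *)
Definition corner : Rn := \row_i (a 0 i - l / 2).
Local Notation B := (cell corner l).
Local Notation Q0 := (B 0 a).
Local Notation C u := (cell (shift_origin corner L u) L).

Let L0 : 0 < L. Proof. by move: l0 lL; lra. Qed.

Lemma root_cellE : Q0 = box (corner_box a l).
Proof.
rewrite cellE//; congr box; rewrite /cell_box /corner_box.
have idx0 i : cell_index corner l 0 a i = 0.
  rewrite ffunE; apply: floor_def; rewrite !mxE expr0 mulr1.
  have -> : (a 0 i - (a 0 i - l / 2)) / l = 2^-1 by field; rewrite gt_eqF.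
  by rewrite add0r mulr0z mulr1z; apply/andP; split; lra.
congr pair; apply/rowP => i; rewrite !mxE idx0 /side expr0 divr1; lra.
Qed.

Lemma root_sub_cube : Q0 `<=` cube a l.
Proof.
rewrite root_cellE => x xb i; move: (xb i); rewrite /= !mxE => /andP[h1 h2].
by rewrite ler_distl h1 ltW.
Qed.

Lemma lebn_cube_root : mu (cube a l `\` Q0) = 0%E.
Proof.
rewrite (@lebn_setD _ _ _ _ (l ^+ d) (l ^+ d)).
- by rewrite subrr.
- exact: measurable_cube.
- exact: measurable_cell.
- exact: root_sub_cube.
- by rewrite lebn_cube// ltW.
- by rewrite lebn_cell// /side expr0 divr1.
Qed.

Lemma le_integral_F (X Y : set Rn) : measurable X -> measurable Y -> X `<=` Y ->
  (\int[mu]_(y in X) (F y)%:E <= \int[mu]_(y in Y) (F y)%:E)%E.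
Proof.
move=> mX mY XY; apply: ge0_subset_integral; [exact: mX|exact: mY| | |exact: XY].
  by apply: measurable_funTS; exact/measurable_EFinP.
by move=> y _; rewrite lee_fin.
Qed.

Lemma integral_F_fin (X : set Rn) c r : measurable X -> X `<=` cube c r ->
  (\int[mu]_(y in X) (F y)%:E)%E \is a fin_num.
Proof.
move=> mX Xc; rewrite ge0_fin_numE; last by apply: integral_ge0 => y _; rewrite lee_fin.
apply: le_lt_trans (locF c r); apply: le_integral_F => //; exact: measurable_cube.
Qed.

Lemma cell_sub_big_cube (o : Rn) i y x : cube a l x -> cell o L i y x ->
  cell o L i y `<=` cube a (3 * L).
Proof.
move=> xa xy; rewrite -(cell_eq xy) => z zx k.
have h1 := cell_sub_cube L0 zx k; have h2 := cell_sub_cube L0 (cell_refl o L i x) k.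
have h3 := xa k; have h4 := side_le L0 i.
move: l0 lL h1 h2 h3; rewrite !ler_norml => ? ? /andP[? ?] /andP[? ?] /andP[? ?].
by apply/andP; split; lra.
Qed.

Definition cell_average (u : {ffun 'I_d -> bool}) i y : R :=
  fine (\int[mu]_(z in C u i y) (F z)%:E) / side L i ^+ d.

(** It is increasing when [S] shrinks, as the stopping argument requires, and larger
    than the averages over cubes containing [S], up to the constant of the
    one-third trick. *)
Definition top_average (S : set Rn) : R :=
  sup [set r | exists u i y, S `<=` C u i y /\ r = cell_average u i y].

Lemma cell_average_ge0 u i y : 0 <= cell_average u i y.
Proof.
apply: divr_ge0; last by apply: exprn_ge0; exact: ltW (side_gt0 L0 _).
by apply: fine_ge0; apply: integral_ge0 => z _; rewrite lee_fin.
Qed.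

Lemma top_average_ge0 S : 0 <= top_average S.
Proof.
rewrite /top_average; set E := [set r | _].
have [hs|hs] := pselect (has_sup E); last by rewrite sup_out.
case: (hs) => -[r Er] _; apply: le_trans (_ : r <= _).
  by case: Er => u [i [y [_ ->]]]; exact: cell_average_ge0.
by apply: ub_le_sup => //; case: hs.
Qed.

(** The side of the trapping cell is comparable with that of the cube, so the average
    over that cell is bounded from below. *)
Lemma root_trapped (S : set Rn) : S `<=` cube a l ->
  exists u i y, [/\ S `<=` C u i y, cube a l `<=` C u i y & side L i <= 6 * l].
Proof.
move=> Sa; have l3 : 0 < 3 * l by rewrite mulr_gt0.
have l3L : 3 * l < L by move: l0 lL; lra.
have [j j1 j2] := exists_side L0 l3 l3L.
have [u hu] := cube_sub_shifted_cell corner L0 a (ltW l0) j1.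
exists u, j, a; split=> //; first exact: subset_trans hu.
by move: j2; lra.
Qed.

Lemma has_sup_averages j x : Q0 x ->
  has_sup [set r | exists u i y, B j x `<=` C u i y /\ r = cell_average u i y].
Proof.
move=> xQ; have Ba : B j x `<=` cube a l.
  apply: subset_trans root_sub_cube; rewrite -(cell_eq xQ); exact: cell_nest.
split.
  have [u [i [y [h _ _]]]] := root_trapped Ba.
  by exists (cell_average u i y); exists u, i, y.
have mU : measurable (cube a (3 * L)) by exact: measurable_cube.
have sj : 0 < side l j ^+ d by rewrite exprn_gt0// side_gt0.
exists (fine (\int[mu]_(y in cube a (3 * L)) (F y)%:E) / side l j ^+ d).
move=> _ [u [i [y [BC ->]]]].
have mC : measurable (C u i y) by exact: measurable_cell.
have si : 0 < side L i ^+ d by rewrite exprn_gt0// side_gt0.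
have CU : C u i y `<=` cube a (3 * L).
  apply: (@cell_sub_big_cube _ i y x); first exact: Ba (cell_refl _ _ _ _).
  exact: BC (cell_refl _ _ _ _).
apply: ler_pM.
- by apply: fine_ge0; apply: integral_ge0 => z _; rewrite lee_fin.
- by rewrite invr_ge0 ltW.
- apply: fine_le; [exact: (integral_F_fin mC CU)|exact: (integral_F_fin mU (@subset_refl _ _))|].
  exact: le_integral_F mC mU CU.
- rewrite lef_pV2 ?posrE// -lee_fin.
  rewrite -(lebn_cell corner l0 j x) -(lebn_cell (shift_origin corner L u) L0 i y).
  exact: lebn_le.
Qed.

Lemma top_average_mono i j x : Q0 x -> (i <= j)%N ->
  top_average (B i x) <= top_average (B j x).
Proof.
move=> xQ ij; have [ne _] := has_sup_averages i xQ; have [_ ub] := has_sup_averages j xQ.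
apply: ge_sup ne _ => r [u [i' [y [BC rE]]]].
apply: ub_le_sup => //; exists u, i', y; split=> //.
by apply: subset_trans BC; exact: cell_nest.
Qed.

Lemma cell_average_le u i y j x : Q0 x -> B j x `<=` C u i y ->
  cell_average u i y <= top_average (B j x).
Proof.
by move=> xQ BC; apply: ub_le_sup; [case: (has_sup_averages j xQ)|exists u, i, y].
Qed.

Lemma top_average_ge j x : Q0 x -> Lam <= top_average (B j x).
Proof.
move=> xQ; have Ba : B j x `<=` cube a l.
  apply: subset_trans root_sub_cube; rewrite -(cell_eq xQ); exact: cell_nest.
have [u [i [y [h1 h2 h3]]]] := root_trapped Ba.
apply: le_trans (cell_average_le xQ h1).
have si : 0 < side L i ^+ d by rewrite exprn_gt0// side_gt0.
rewrite ler_pdivlMr//.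
have mC : measurable (C u i y) by exact: measurable_cell.
have Cfin : (\int[mu]_(z in C u i y) (F z)%:E)%E \is a fin_num.
  exact: (integral_F_fin mC (@cell_sub_cube _ _ _ _ L0 _ _)).
rewrite -lee_fin fineK//; apply: le_trans (le_trans LamE _); last first.
  by apply: le_integral_F => //; exact: measurable_cube.
rewrite lee_fin ler_pM2l//; apply: lerXn2r => //; rewrite ?nnegrE ?mulr_ge0 ?(ltW l0)//.
by rewrite ltW// side_gt0.
Qed.

Lemma top_average_adherent j x : Q0 x ->
  exists u i, B j x `<=` C u i x /\ top_average (B j x) < 2 * cell_average u i x.
Proof.
move=> xQ; have A0 : 0 < top_average (B j x) by apply: lt_le_trans (top_average_ge j xQ).
have e0 : 0 < top_average (B j x) / 2 by rewrite divr_gt0.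
have [r [u [i [y [BC ->]]]] hr] := sup_adherent e0 (has_sup_averages j xQ).
have yx : C u i y x by exact: BC (cell_refl _ _ _ _).
exists u, i; rewrite /cell_average (cell_eq yx) -/(cell_average u i y); split=> //.
by move: hr; rewrite -/(top_average (B j x)); lra.
Qed.

(** Cubes that are small compared to [L] are contained in a cell of some translated
    grid; for the others the bound follows from [tail] and [top_average_ge]. *)
Lemma cube_average_le j x rho : Q0 x -> side l j <= rho ->
  (\int[mu]_(y in cube (cell_center corner l j x) rho) (F y)%:E <=
   (6 ^+ d * top_average (B j x) * rho ^+ d)%:E)%E.
Proof.
move=> xQ jr; set c := cell_center _ _ _ _.
have s0 := side_gt0 l0 j; have rho0 : 0 < rho by apply: lt_le_trans jr.
have Bc : B j x `<=` cube c rho by move=> z /(cell_sub_cube l0)/(cube_le jr).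
have A0 := top_average_ge j xQ.
have mR : measurable (cube c rho) by exact: measurable_cube.
have [h|h] := ltP (3 * rho) L.
  have [i i1 i2] := exists_side L0 (mulr_gt0 (ltr0Sn R 2) rho0) h.
  have [u hu] := cube_sub_shifted_cell corner L0 c (ltW rho0) i1.
  have mC : measurable (C u i c) by exact: measurable_cell.
  apply: (le_trans (le_integral_F mR mC hu)).
  have Cfin : (\int[mu]_(z in C u i c) (F z)%:E)%E \is a fin_num.
    exact: (integral_F_fin mC (@cell_sub_cube _ _ _ _ L0 _ _)).
  have si : 0 < side L i ^+ d by rewrite exprn_gt0// side_gt0.
  rewrite -(fineK Cfin) lee_fin.
  have := cell_average_le xQ (subset_trans Bc hu).
  rewrite {1}/cell_average ler_pdivrMr// => /le_trans; apply.
  rewrite -mulrA mulrCA -exprMn; apply: ler_wpM2l; first exact: top_average_ge0.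
  apply: lerXn2r; rewrite ?nnegrE ?mulr_ge0 ?(ltW rho0)//.
    by rewrite ltW// side_gt0.
  by move: i2; lra.
have cQ : cube a l c.
  have Bcl : B j x `<=` cube a l.
    apply: subset_trans root_sub_cube; rewrite -(cell_eq xQ); exact: cell_nest.
  move=> k; pose y : Rn := \row_i (corner 0 i + ((cell_index corner l j x i)%:~R + 2^-1) * side l j).
  have -> : c = y by [].
  apply: Bcl; rewrite cellE// => i; rewrite /= !mxE intrD.
  by move: s0; nra.
have sub : cube c rho `<=` cube a (2 * rho).
  move=> y yc k; have := yc k; have := cQ k; move: l0 lL h; rewrite !ler_norml.
  by move=> ? ? ? /andP[? ?] /andP[? ?]; apply/andP; split; lra.
have m2 : measurable (cube a (2 * rho)) by exact: measurable_cube.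
apply: (le_trans (le_integral_F mR m2 sub)).
have h2 : 2 / 3 * L <= 2 * rho by move: h; lra.
apply: (le_trans (tail h2)); rewrite lee_fin exprMn.
have pd (q : R) : 0 < q -> 0 < q ^+ d by move=> ?; rewrite exprn_gt0.
have d2 := pd 2 (ltr0Sn R 1); have d3 := pd 3 (ltr0Sn R 2).
have d6 : 1 <= 6 ^+ d :> R by rewrite exprn_ege1// ler1n.
have d23 : 2 ^+ d <= 2 * 3 ^+ d :> R.
  rewrite (le_trans (_ : _ <= 3 ^+ d))//; first by rewrite lerXn2r// ?nnegrE// ler_nat.
  by rewrite ler_peMl ?(ltW d3)// ler1n.
have r0 := pd _ rho0.
rewrite mulrA; apply: ler_wpM2r; first exact: ltW.
apply: (@le_trans _ _ Lam).
  rewrite mulrAC ler_pdivrMr ?mulr_gt0//.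
  by rewrite ler_pM2l.
apply: le_trans A0 _; rewrite ler_peMl//; exact: top_average_ge0.
Qed.

Lemma top_cell_average u x : meets (shift_origin corner L u) L Q0 0 x ->
  (\int[mu]_(y in C u 0 x) (F y)%:E <= (Lam / 2 * side L 0 ^+ d)%:E)%E.
Proof.
move=> [z zQ zx]; have CU := @cell_sub_big_cube _ 0 x z (root_sub_cube zQ) zx.
have mC : measurable (C u 0 x) by exact: measurable_cell.
have mU : measurable (cube a (3 * L)) by exact: measurable_cube.
apply: (le_trans (le_integral_F mC mU CU)).
have h : 2 / 3 * L <= 3 * L by move: L0; lra.
apply: (le_trans (tail h)); rewrite lee_fin /side expr0 divr1 exprMn.
rewrite le_eqVlt; apply/orP; left; apply/eqP; field.
by rewrite expf_neq0.
Qed.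

Lemma level_set_sub u lam : level_set (shift_origin corner L u) L F Q0 lam `<=` cube a (3 * L).
Proof.
move=> x [i [[z zQ xz] _]]; have := @cell_sub_big_cube _ i x z (root_sub_cube zQ) xz.
by apply; exact: cell_refl.
Qed.

End trapping_averages.

(** * Summation over one cube *)

Lemma geometric_bracket (R : realType) (b y0 y : R) : 2 <= b -> 0 < y0 -> y0 < y ->
  exists k, y0 * b ^+ k < y <= y0 * b ^+ k.+1.
Proof.
move=> b2 y00 y0y.
have ex : exists k, y <= y0 * b ^+ k.+1.
  have B0 : 0 <= y / y0 by rewrite divr_ge0// ltW// (lt_trans y00).
  exists (Num.bound (y / y0)); have := archi_boundP B0; set N := Num.bound _ => yN.
  rewrite ltr_pdivrMr// in yN; apply: le_trans (ltW yN) _.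
  rewrite mulrC ler_pM2l//; apply: (@le_trans _ _ (2 ^+ N.+1)).
    by rewrite -natrX ler_nat (leq_trans (ltnW (ltn_expl _ (ltnSn 1))))// leq_exp2l.
  by apply: lerXn2r; rewrite ?nnegrE ?(le_trans _ b2).
case: (ex_minnP ex) => -[|k] yk mink.
  by exists 0%N; rewrite expr0 mulr1 y0y.
exists k.+1; rewrite yk andbT ltNge; apply/negP => h.
by have := mink _ h; rewrite ltnn.
Qed.

Lemma nneseries_term_le (R : realType) (u : nat -> \bar R) (k : nat) :
  (forall j, 0 <= u j)%E -> (u k <= \sum_(0 <= j <oo) u j)%E.
Proof.
move=> u0; rewrite (@nneseriesD1 _ u k xpredT)//; apply: leeDl.
by apply: nneseries_ge0 => j _ _.
Qed.

Section countable_cover.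
Context (R : realType) (n : nat).
Local Notation Rn := 'rV[R]_n.+1.
Local Notation mu := (@lebn R n).

(** Sum over m, u and k of the indicators of the covering sets. *)
Lemma integral_le_cover (I : finType) (D N : set Rn) (Y w : Rn -> R)
    (c : nat -> nat -> R) (S : nat -> I -> nat -> set Rn) :
  measurable D -> mu N = 0%E ->
  measurable_fun setT Y -> (forall x, 0 <= Y x) ->
  measurable_fun setT w -> (forall x, 0 <= w x) ->
  (forall m k, 0 <= c m k) -> (forall m u k, measurable (S m u k)) ->
  (forall x, D x -> ~ N x -> exists m u k, S m u k x /\ Y x <= c m k * w x) ->
  (\int[mu]_(x in D) (Y x)%:E <=
   \sum_(0 <= m <oo) \sum_(u : I) \sum_(0 <= k <oo)
     (c m k)%:E * \int[mu]_(x in S m u k) (w x)%:E)%E.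
Proof.
move=> mD N0 mY Y0 mw w0 c0 mS cover.
have mwE : measurable_fun setT (fun x => (w x)%:E) by exact/measurable_EFinP.
pose f m u k x := ((c m k)%:E * ((fun y => (w y)%:E) \_ (S m u k)) x)%E.
have f0 m u k x : (0 <= f m u k x)%E.
  apply: mule_ge0; first by rewrite lee_fin.
  by apply: erestrict_ge0 => y _; rewrite lee_fin.
have mr m u k : measurable_fun D ((fun y => (w y)%:E) \_ (S m u k)).
  apply: measurable_funTS; apply/(measurable_restrictT _ (mS m u k)).
  exact: measurable_funTS.
have mf m u k : measurable_fun D (f m u k).
  by apply: emeasurable_funM; [exact: measurable_cst|exact: mr].
have fk0 m u x : (0 <= \sum_(0 <= k <oo) f m u k x)%E.
  by apply: nneseries_ge0 => k _ _; exact: f0.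
have mfk m u : measurable_fun D (fun x => \sum_(0 <= k <oo) f m u k x)%E.
  apply: ge0_emeasurable_sum => // k x _ _; exact: f0.
have fu0 m x : (0 <= \sum_(u : I) \sum_(0 <= k <oo) f m u k x)%E.
  by apply: sume_ge0 => u _.
have mfu m : measurable_fun D (fun x => \sum_(u : I) \sum_(0 <= k <oo) f m u k x)%E.
  by apply: emeasurable_sum.
apply: (@le_trans _ _ (\int[mu]_(x in D) (\sum_(0 <= m <oo) \sum_(u : I) \sum_(0 <= k <oo) f m u k x))%E).
  apply: ae_ge0_le_integral; [exact: mD| | | | |].
  - by move=> x _; rewrite lee_fin.
  - by apply: measurable_funTS; exact/measurable_EFinP.
  - by move=> x _; apply: nneseries_ge0 => m _ _.
  - by apply: ge0_emeasurable_sum => [m x _ _|m _]; [exact: fu0|exact: mfu].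
  exists N; split; [exact: lebn_null_measurable|exact: N0|].
  move=> x /= hx; apply: contrapT => Nx; apply: hx => Dx.
  have [m [u [k [Sx Yx]]]] := cover x Dx Nx.
  apply: (@le_trans _ _ (f m u k x)).
    by rewrite /f patchE mem_set// -EFinM lee_fin.
  apply: (@le_trans _ _ (\sum_(0 <= k <oo) f m u k x)%E).
    by apply: (nneseries_term_le k (fun j => f0 m u j x)).
  apply: (@le_trans _ _ (\sum_(u : I) \sum_(0 <= k <oo) f m u k x)%E).
    by rewrite (bigD1 u)//= leeDl// sume_ge0.
  exact: (nneseries_term_le m (fu0 ^~ x)).
rewrite integral_nneseries//.
apply: lee_nneseries => [m _ _|m _]; first by apply: integral_ge0 => x _.
rewrite ge0_integral_sum//; apply: lee_sum => u _.
rewrite integral_nneseries//.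
apply: lee_nneseries => [k _ _|k _]; first by apply: integral_ge0 => x _.
rewrite ge0_integralZl//; last 2 first.
- by move=> x _; apply: erestrict_ge0 => y _; rewrite lee_fin.
- by rewrite lee_fin.
apply: lee_wpmul2l; first by rewrite lee_fin.
rewrite -integral_mkcondr; apply: ge0_subset_integral.
- exact: measurableI.
- exact: mS.
- exact: measurable_funTS.
- by move=> x _; rewrite lee_fin.
- exact: subIsetr.
Qed.

End countable_cover.

Lemma mulrn_ereal (R : realType) (x : \bar R) (m : nat) : (0 <= x)%E ->
  (x *+ m)%R = (m%:R%:E * x)%E.
Proof.
move=> x0; elim: m => [|m IH]; first by rewrite mulr0n mul0e.
by rewrite mulrS IH -[in RHS]natr1 EFinD addrC ge0_muleDl// ?lee_fin// mul1e.
Qed.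

Lemma powR_exprn (R : realType) (x q : R) (m : nat) : 0 <= x ->
  (x ^+ m) `^ q = (x `^ q) ^+ m.
Proof.
move=> x0; elim: m => [|m IH]; first by rewrite !expr0 powR1.
by rewrite !exprS powRM ?exprn_ge0// IH.
Qed.

Section one_cube.
Context (R : realType) (n : nat).
Local Notation Rn := 'rV[R]_n.+1.
Local Notation mu := (@lebn R n).
Local Notation d := n.+1.
Context (p beta alpha C1 Cp K eta t : R) (w s : Rn -> R).
Context (p1 : 1 < p) (beta0 : 0 < beta) (alpha01 : 0 < alpha < 1).
Context (C10 : 0 < C1) (Cp0 : 0 < Cp) (K0 : 0 < K).
Context (eta0 : 0 < eta) (eta1 : eta * (1 + 2 ^+ d) < 1).
Context (eta_t : eta < t) (eta_1t : eta < 1 - t).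
Context (eta_beta : 2 `^ p * (2 * eta) `^ beta <= 2^-1).
Context (w0 : forall x, 0 <= w x) (s0 : forall x, 0 < s x).
Context (mw : measurable_fun setT w) (ms : measurable_fun setT s).
Context (sfin : forall a l, (\int[mu]_(x in cube a l) (s x)%:E < +oo)%E).
Local Notation IS A := (\int[mu]_(x in A) (s x)%:E)%E.
Local Notation IW A := (\int[mu]_(x in A) (w x)%:E)%E.
Context (muck : forall o L m x (E G : set Rn), 0 < L -> measurable E -> measurable G ->
  E `<=` cell o L m x ->
  (mu (cell o L m x `&` G) <= ((1 - alpha) / 2)%:E * mu (cell o L m x))%E ->
  (IW E * ((fine (IS (cell o L m x)) / side L m ^+ d) `^ p)%:E <=
   (C1 * (fine (mu E) / side L m ^+ d) `^ beta)%:E * IS (cell o L m x `\` G))%E).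
Context (a : Rn) (l : R) (l0 : 0 < l) (h : Rn -> R) (mh : measurable_fun setT h).
Context (g : Rn -> R) (mg : measurable_fun setT g) (g0 : forall x, 0 <= g x).
Context (e : R) (Psi : {ffun 'I_d -> bool} -> Rn -> \bar R).
Local Notation F := (fun x => g x * s x).
Context (gfin : (\int[mu]_x (g x `^ p * s x)%:E < +oo)%E).
Context (locF : forall c r, (\int[mu]_(y in cube c r) (g y * s y)%:E < +oo)%E).
Context (L Lam : R) (lL : 4 * l <= L) (Lam0 : 0 < Lam).
Context (LamE : ((Lam * (6 * l) ^+ d)%:E <= \int[mu]_(y in cube a l) (g y * s y)%:E)%E).
Context (tail : forall r, 2 / 3 * L <= r ->
  (\int[mu]_(y in cube a r) (g y * s y)%:E <= (Lam / (2 * 3 ^+ d) * r ^+ d)%:E)%E).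
Context (osc : forall c r G, 0 < r -> 0 < G -> dyadic_average_bound (fun x => g x * s x) c r G ->
  exists c0, (mu [set x | cube c r x /\ (K * G < `|h x - c0|)%R] <= (eta * r ^+ d)%:E)%E).
Local Notation o := (corner a l).
Local Notation B := (cell o l).
Local Notation Q0 := (B 0 a).
Local Notation o_ u := (shift_origin o L u).
Context (mPsi : forall u, measurable_fun setT (Psi u)) (Psi0 : forall u x, (0 <= Psi u x)%E).
Context (intPsi : forall u, (\int[mu]_x Psi u x <= Cp%:E * \int[mu]_x (g x `^ p * s x)%:E)%E).
Context (maxPsi : forall u m x r, 0 <= r ->
  (r%:E * IS (cell (o_ u) L m x) <= \int[mu]_(y in cell (o_ u) L m x) (g y * s y)%:E)%E ->
  ((r `^ p * s x)%:E <= (e `^ p * s x)%:E + Psi u x)%E).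

Let L0 : 0 < L. Proof. by move: l0 lL; lra. Qed.
Let mF : measurable_fun setT F. Proof. exact: measurable_funM. Qed.
Let F0 x : 0 <= F x. Proof. by rewrite mulr_ge0// ltW. Qed.

(** The bound for the oscillation of h on a cell provided by [osc]. *)
Definition threshold (S : set Rn) : R := K * (6 ^+ d * top_average a l F L S).

Lemma threshold_ge0 S : 0 <= threshold S.
Proof.
apply: mulr_ge0; first exact: ltW.
by apply: mulr_ge0; [exact: exprn_ge0|exact: top_average_ge0].
Qed.

Lemma threshold_mono i j x : Q0 x -> (i <= j)%N ->
  threshold (B i x) <= threshold (B j x).
Proof.
move=> xQ ij; rewrite /threshold ler_pM2l// ler_pM2l ?exprn_gt0//.
exact: (top_average_mono l0 mF F0 locF lL xQ ij).
Qed.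

Lemma cell_oscillation j x : Q0 x -> exists c : R,
  (mu [set y | B j x y /\ (threshold (B j x) < `|h y - c|)%R] <= eta%:E * mu (B j x))%E.
Proof.
move=> xQ; have sj := side_gt0 l0 j.
have A0 : 0 < top_average a l F L (B j x).
  apply: (lt_le_trans Lam0); exact: (top_average_ge l0 mF F0 locF lL Lam0 LamE j xQ).
have G0 : 0 < 6 ^+ d * top_average a l F L (B j x) by rewrite mulr_gt0// exprn_gt0.
have [m|c hc] := osc sj G0 (c := cell_center o l j x).
  rewrite (eq_integral (fun y => (g y * s y)%:E)); last first.
    by move=> y _; rewrite ger0_norm// F0.
  apply: (cube_average_le l0 mF F0 locF lL Lam0 LamE tail xQ).
  by rewrite ler_peMl ?(ltW sj)// exprn_ege1// ler1n.
exists c; rewrite [X in (_ <= _ * X)%E]lebn_cell// -EFinM.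
apply: le_trans hc; apply: lebn_le => y [By hy]; split=> //.
exact: cell_sub_cube By.
Qed.

Local Notation gen := (generation o l a h threshold eta).
Local Notation c_ := (center_value h threshold eta Q0).

Lemma median_center : `|median h t (cube a l) - c_| <= threshold Q0.
Proof.
have Qa : Q0 a by exact: cell_refl.
have ld : 0 < l ^+ d by exact: exprn_gt0.
apply: (@median_close _ _ _ _ eta _ _ (l ^+ d)) => //.
- by rewrite lebn_cube// ltW.
- exact: threshold_ge0.
apply: (@le_trans _ _ (mu (bad h threshold eta Q0 `|` (cube a l `\` Q0)))).
  apply: lebn_le => x [xa hx]; have [xQ|xQ] := pselect (Q0 x); first by left.
  by right.
apply: le_trans (lebn_setU_le _ _) _; rewrite lebn_cube_root// adde0.
apply: le_trans (lebn_bad_le cell_oscillation 0 Qa) _.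
by rewrite [X in (_ * X <= _)%E]lebn_cell// /side expr0 divr1 -EFinM.
Qed.

Local Notation b := (ratio n alpha).
Local Notation lam k := (Lam / 2 * b ^+ k).
Local Notation trap u k m := (trapped_set (o_ u) L F Q0 o l gen (lam k) m).
Let C3 := 34 * (K * (6 ^+ d * b)).

Lemma ratio_ge2 : 2 <= b.
Proof.
have /andP[a0 a1] := alpha01; rewrite /ratio ler_pdivlMr ?subr_gt0//.
have h2 : 1 <= 2 ^+ d :> R by rewrite exprn_ege1// ler1n.
by nra.
Qed.

(** Sparse domination gives the depth m and a stopping cell; the grid u is one whose
    cell nearly attains [top_average] of that stopping cell, and k is the size of the
    average over it. *)
Lemma oscillation_in_trapped_set x : Q0 x -> ~ exceptional o l a h threshold eta x ->
  exists m u k, trap u k m x /\ `|h x - median h t (cube a l)| <= C3 * 2 ^+ m * lam k.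
Proof.
move=> xQ xN.
have [j [m [i [gx lx nlx hx]]]] := sparse_domination l0 mh threshold_ge0 threshold_mono
  eta0 eta1 cell_oscillation xQ xN.
have [u [i' [BC tc]]] := top_average_adherent l0 mF F0 locF lL Lam0 LamE i xQ.
have tL := top_average_ge l0 mF F0 locF lL Lam0 LamE i xQ.
set T := top_average _ _ _ _ _ in tc tL.
set av := cell_average _ _ _ _ _ _ _ in tc.
have av0 : Lam / 2 < av by lra.
have lam0 : 0 < Lam / 2 by rewrite divr_gt0.
have [k /andP[k1 k2]] := geometric_bracket ratio_ge2 lam0 av0.
exists m, u, k; split.
  exists j => //; split; last by split.
  exists i; split=> //; exists i' => //; split; first by exists x => //; exact: cell_refl.
  have sd : 0 < side L i' ^+ d by rewrite exprn_gt0// side_gt0.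
  have mC : measurable (cell (o_ u) L i' x) by exact: measurable_cell.
  have Ifin := integral_F_fin mF F0 locF mC (@cell_sub_cube _ _ _ _ L0 _ _).
  by rewrite -(fineK Ifin) lte_fin -ltr_pdivlMr.
have Q0m : threshold Q0 <= threshold (B i x).
  by rewrite -(cell_eq xQ); apply: threshold_mono.
have med := le_trans median_center Q0m.
have m1 : 1 <= 2 ^+ m :> R by rewrite exprn_ege1// ler1n.
have th0 := threshold_ge0 (B i x).
have step : `|h x - median h t (cube a l)| <= 17 * 2 ^+ m * threshold (B i x).
  have -> : h x - median h t (cube a l) = (h x - c_) - (median h t (cube a l) - c_) by ring.
  apply: le_trans (ler_normB _ _) _; move: hx med m1 th0.
  set X := threshold _; set M := 2 ^+ m; set n1 := `|_|; set n2 := `|_ - _|.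
  by nra.
apply: (le_trans step); rewrite /threshold -/T /C3.
have -> : 34 * (K * (6 ^+ d * b)) * 2 ^+ m * (Lam / 2 * b ^+ k) =
  17 * 2 ^+ m * (K * (6 ^+ d * (2 * (Lam / 2 * b ^+ k.+1)))).
  by rewrite [b ^+ k.+1]exprS; ring.
have m0 : 0 < 17 * 2 ^+ m :> R by rewrite mulr_gt0// exprn_gt0.
rewrite (ler_pM2l m0) (ler_pM2l K0) ler_pM2l ?exprn_gt0//.
by lra.
Qed.

Let J := ((e `^ p)%:E * IS (cube a (3 * L)) + Cp%:E * \int[mu]_x (g x `^ p * s x)%:E)%E.

(** The factor [2^(m p)] from sparse domination meets [theta^(m beta)] from W_p. *)
Lemma trapped_sum_le m u :
  (\sum_(0 <= k <oo) ((C3 * 2 ^+ m * lam k) `^ p)%:E * IW (trap u k m) <=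
   (C3 `^ p * C1 * ((1 - 2 * eta)^-1) `^ beta * 2^-1 ^+ m)%:E * J)%E.
Proof.
have eta2 : 2 * eta < 1.
  have h2 : 2 <= 2 ^+ d :> R by rewrite exprS ler_peMr// exprn_ege1// ler1n.
  by move: eta1 eta0; nra.
have th0 : 0 < 2 * eta by rewrite mulr_gt0.
have b0 : 0 < b by apply: lt_le_trans ratio_ge2.
have C30 : 0 <= C3.
  apply: mulr_ge0 => //; apply: mulr_ge0; first exact: ltW.
  by apply: mulr_ge0; [exact: exprn_ge0|exact: ltW].
have lam_ge0 k : 0 <= lam k.
  by apply: mulr_ge0; [apply: divr_ge0 => //; exact: ltW|apply: exprn_ge0; exact: ltW].
have m0 : 0 <= 2 ^+ m :> R by rewrite exprn_ge0.
have IW0 A : (0 <= IW A)%E by apply: integral_ge0 => y _; rewrite lee_fin.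
rewrite (eq_eseriesr (g := fun k => (((C3 * 2 ^+ m) `^ p)%:E *
  (((lam k) `^ p)%:E * IW (trap u k m)))%E)); last first.
  by move=> k _; rewrite (powRM p (mulr_ge0 C30 m0) (lam_ge0 k)) EFinM muleA.
rewrite nneseriesZl; last by move=> k _; rewrite mule_ge0// lee_fin powR_ge0.
have := @level_sum R n p beta alpha C1 e w s beta0 alpha01 C10 w0 s0 mw ms sfin
  (o_ u) L L0 (fun m x E G => @muck (o_ u) L m x E G L0) F mF F0 (Psi u) (mPsi u) (Psi0 u)
  (maxPsi (u := u)) Q0 (Lam / 2) (divr_gt0 Lam0 (ltr0Sn R 1))
  (@top_cell_average _ _ a l l0 F mF F0 L Lam lL tail u)
  o l l0 gen (2 * eta) th0 eta2 (@generation_invariant _ _ _ _ _ _ _ _)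
  (@generation_unique _ _ _ _ _ _ _ _) (@layerS _ _ _ _ _ _ _ _)
  (fun g m i x => @lebn_layer_le _ _ o l l0 a h threshold eta mh eta0 cell_oscillation g m i x) m.
move=> H; apply: (@le_trans _ _ (((C3 * 2 ^+ m) `^ p)%:E * ((gap_constant beta C1 (2 * eta) m)%:E * J))%E).
  apply: lee_wpmul2l; first by rewrite lee_fin powR_ge0.
  apply: (le_trans H); apply: lee_wpmul2l.
    by rewrite lee_fin /gap_constant mulr_ge0 ?powR_ge0// ltW.
  apply: (@le_trans _ _ (\int[mu]_(y in cube a (3 * L)) majorant p e s (Psi u) y)%E).
    apply: ge0_subset_integral.
    - exact: measurable_level_set.
    - exact: measurable_cube.
    - by apply: measurable_funTS; exact: measurable_majorant.
    - by move=> y _; exact: majorant_ge0.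
    - exact: level_set_sub.
  rewrite ge0_integralD; [|exact: measurable_cube| | | |]; last 4 first.
  - by move=> y _; rewrite lee_fin mulr_ge0 ?powR_ge0// ltW.
  - apply: measurable_funTS; apply/measurable_EFinP.
    by apply: measurable_funM; [exact: measurable_cst|exact: ms].
  - by move=> y _; exact: Psi0.
  - by apply: measurable_funTS; exact: mPsi.
  apply: leeD.
    under eq_integral do rewrite EFinM.
    rewrite ge0_integralZl; [exact: lexx|exact: measurable_cube| | |].
    - by apply: measurable_funTS; exact/measurable_EFinP.
    - by move=> y _; rewrite lee_fin ltW.
    - by rewrite lee_fin powR_ge0.
  apply: le_trans (intPsi u); apply: ge0_subset_integral.
  - exact: measurable_cube.
  - exact: measurableT.
  - exact: mPsi.
  - by move=> y _; exact: Psi0.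
  - exact: subsetT.
rewrite muleA -EFinM; apply: lee_wpmul2r.
  apply: adde_ge0; apply: mule_ge0; rewrite ?lee_fin ?powR_ge0 ?(ltW Cp0)//.
    by apply: integral_ge0 => x _; rewrite lee_fin ltW.
  by apply: integral_ge0 => x _; rewrite lee_fin mulr_ge0 ?powR_ge0// ltW.
have i0 : 0 <= (1 - 2 * eta)^-1 by rewrite invr_ge0 subr_ge0 ltW.
have t0 : 0 <= 2 * eta by exact: ltW.
rewrite lee_fin /gap_constant (powRM _ C30 m0) (powRM _ (exprn_ge0 m t0) i0).
rewrite (powR_exprn _ _ t0) powR_exprn//.
set A := C3 `^ p; set D := (1 - 2 * eta)^-1 `^ beta; set X := 2 `^ p; set Y := (2 * eta) `^ beta.
have -> : A * X ^+ m * (C1 * (Y ^+ m * D)) = A * C1 * D * (X * Y) ^+ m by rewrite exprMn; ring.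
apply: ler_wpM2l; first by rewrite !mulr_ge0 ?powR_ge0// ltW.
by apply: lerXn2r; rewrite ?nnegrE ?mulr_ge0 ?powR_ge0 ?invr_ge0.
Qed.

Lemma weighted_oscillation_bound :
  (\int[mu]_(x in cube a l) (`|h x - median h t (cube a l)| `^ p * w x)%:E <=
   (C3 `^ p * C1 * ((1 - 2 * eta)^-1) `^ beta * 2 * #|{ffun 'I_d -> bool}|%:R)%:E * J)%E.
Proof.
set cm := median h t (cube a l); set M := C3 `^ p * C1 * _ `^ beta.
have M0 : 0 <= M by rewrite !mulr_ge0 ?powR_ge0// ltW.
have J0 : (0 <= J)%E.
  apply: adde_ge0; apply: mule_ge0; rewrite ?lee_fin ?powR_ge0 ?(ltW Cp0)//.
    by apply: integral_ge0 => x _; rewrite lee_fin ltW.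
  by apply: integral_ge0 => x _; rewrite lee_fin mulr_ge0 ?powR_ge0// ltW.
have b0 : 0 < b by apply: lt_le_trans ratio_ge2.
have C30 : 0 <= C3.
  apply: mulr_ge0 => //; apply: mulr_ge0; first exact: ltW.
  by apply: mulr_ge0; [exact: exprn_ge0|exact: ltW].
have lam_ge0 k : 0 <= lam k.
  by apply: mulr_ge0; [apply: divr_ge0 => //; exact: ltW|apply: exprn_ge0; exact: ltW].
have mY : measurable_fun setT (fun x => `|h x - cm| `^ p * w x).
  apply: measurable_funM; last exact: mw.
  apply: (measurableT_comp (measurable_powR p)).
  apply: (measurableT_comp (@normr_measurable R setT)).
  by apply: measurable_funB; [exact: mh|exact: measurable_cst].
pose N := exceptional o l a h threshold eta `|` (cube a l `\` Q0).
have N0 : mu N = 0%E.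
  apply/eqP; rewrite eq_le measure_ge0 andbT; apply: le_trans (lebn_setU_le _ _) _.
  by rewrite lebn_cube_root// lebn_null_exceptional ?adde0//; exact: cell_oscillation.
apply: (le_trans (@integral_le_cover _ _ {ffun 'I_d -> bool} (cube a l) N _ w
  (fun m k => (C3 * 2 ^+ m * lam k) `^ p) (fun m u k => trap u k m)
  (measurable_cube _ _) N0 mY _ mw w0 _ _ _)).
- by move=> x; rewrite mulr_ge0 ?powR_ge0.
- by move=> m k; rewrite powR_ge0.
- move=> m u k; apply: measurable_trapped_set => //; exact: generation_invariant.
- move=> x xa xN; have xQ : Q0 x by apply: contrapT => nQ; apply: xN; right.
  have xE : ~ exceptional o l a h threshold eta x by move=> xE; apply: xN; left.
  have [m [u [k [tx hx]]]] := oscillation_in_trapped_set xQ xE.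
  exists m, u, k; split=> //; apply: ler_wpM2r => //.
  have c0 : 0 <= C3 * 2 ^+ m * lam k.
    by apply: mulr_ge0 => //; apply: mulr_ge0 => //; exact: exprn_ge0.
  by apply: (ge0_ler_powR (ltW (lt_trans ltr01 p1))); rewrite ?nnegrE.
apply: (@le_trans _ _ (\sum_(0 <= m <oo) (M * #|{ffun 'I_d -> bool}|%:R * 2^-1 ^+ m)%:E * J)%E).
  apply: lee_nneseries => [m _ _|m _].
    apply: sume_ge0 => u _; apply: nneseries_ge0 => k _ _.
    rewrite mule_ge0 ?lee_fin ?powR_ge0//.
    by apply: integral_ge0 => y _; rewrite lee_fin.
  apply: (@le_trans _ _ (\sum_(u : {ffun 'I_d -> bool}) (M * 2^-1 ^+ m)%:E * J)%E).
    by apply: lee_sum => u _; exact: trapped_sum_le.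
  rewrite sumr_const mulrn_ereal; last by rewrite mule_ge0// lee_fin mulr_ge0.
  by rewrite muleA -EFinM mulrA (mulrC _ M).
rewrite (eq_eseriesr (fun m _ => muleC _ J)).
have Jfin : J \is a fin_num.
  rewrite ge0_fin_numE// /J lte_add_pinfty// lte_mul_pinfty// ?lee_fin ?powR_ge0 ?ltW//.
rewrite -(fineK Jfin) nneseriesZl; last first.
  by move=> m _; rewrite lee_fin; apply: mulr_ge0; [exact: mulr_ge0|exact: exprn_ge0].
rewrite muleC fineK//; apply: lee_wpmul2r => //.
set c := M * _; have c0 : 0 <= c by rewrite mulr_ge0.
rewrite mulrAC -/c.
apply: le_trans (epsilon_trick0 xpredT (mulr_ge0 c0 (ler0n R 2))); apply: lee_nneseries => [m _ _|m _].
  by rewrite lee_fin mulr_ge0// exprn_ge0.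
rewrite lee_fin natrX [2 ^+ m.+1]exprS invfM -[leRHS]mulrA.
by apply: ler_wpM2l => //; rewrite mulrA divff// mul1r exprVn.
Qed.

End one_cube.

(** * The estimate on cubes for functions on the whole space *)

Section parameters.
Context (R : realType).

Lemma small_power (p I del : R) : 0 < p -> 0 <= I -> 0 < del ->
  exists2 e : R, 0 < e & e `^ p * I <= del.
Proof.
move=> p0 I0 del0; have q0 : 0 < del / (I + 1) by rewrite divr_gt0// ltr_wpDl.
exists ((del / (I + 1)) `^ p^-1); first exact: powR_gt0.
rewrite -powRrM mulVf ?gt_eqF// powRr1 ?(ltW q0)//.
by rewrite mulrAC ler_pdivrMr ?ltr_wpDl// ler_pM2l// lerDl.
Qed.

Lemma small_fraction (n : nat) (p beta t : R) : 0 < beta -> 0 < t < 1 ->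
  exists eta : R, [/\ 0 < eta, eta * (1 + 2 ^+ n.+1) < 1, eta < t, eta < 1 - t &
    2 `^ p * (2 * eta) `^ beta <= 2^-1].
Proof.
move=> beta0 /andP[t0 t1].
have q0 : 0 < 2^-1 / 2 `^ p :> R by rewrite divr_gt0// powR_gt0.
have D0 : 0 < (1 + 2 ^+ n.+1)^-1 :> R by rewrite invr_gt0 ltr_wpDr// exprn_ge0.
have t10 : 0 < 1 - t by rewrite subr_gt0.
set m := Num.min (Num.min t (1 - t)) (Num.min (1 + 2 ^+ n.+1)^-1 ((2^-1 / 2 `^ p) `^ beta^-1)).
have m0 : 0 < m by rewrite /m !lt_min t0 t10 D0 powR_gt0.
have : m <= m by []. rewrite {2}/m !le_min => /andP[/andP[h1 h2] /andP[h3 h4]].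
exists (m / 2); split.
- by rewrite divr_gt0.
- rewrite -ltr_pdivlMr ?ltr_wpDr ?exprn_ge0// div1r; move: m0 h3; lra.
- by move: m0 h1; lra.
- by move: m0 h2; lra.
have -> : 2 * (m / 2) = m by field.
rewrite -ler_pdivlMl ?powR_gt0// mulrC.
apply: (@le_trans _ _ (((2^-1 / 2 `^ p) `^ beta^-1) `^ beta)).
  by apply: (ge0_ler_powR (ltW beta0)); rewrite ?nnegrE ?powR_ge0// ltW.
by rewrite -powRrM mulVf ?gt_eqF// powRr1 ?(ltW q0).
Qed.

End parameters.

Section cube_bound.
Context (R : realType) (n : nat).
Local Notation Rn := 'rV[R]_n.+1.
Local Notation mu := (@lebn R n).
Local Notation d := n.+1.

Lemma integral_null_weight (D : set Rn) (Y w : Rn -> R) : measurable D ->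
  measurable_fun setT Y -> (forall x, 0 <= Y x) ->
  measurable_fun setT w -> (forall x, 0 <= w x) ->
  (\int[mu]_(x in D) (w x)%:E = 0)%E -> (\int[mu]_(x in D) (Y x * w x)%:E = 0)%E.
Proof.
move=> mD mY Y0 mw w0 I0.
have mwE : measurable_fun D (fun x => (w x)%:E).
  by apply: measurable_funTS; exact/measurable_EFinP.
have : (\int[mu]_(x in D) `|(w x)%:E| = 0)%E.
  by rewrite -[RHS]I0; apply: eq_integral => x _; rewrite gee0_abs// lee_fin.
move=> /(ae_eq_integral_abs mu mD mwE) wae.
rewrite (@ge0_ae_eq_integral _ _ _ mu D _ (cst 0%E))//.
- exact: integral0.
- by apply: measurable_funTS; apply/measurable_EFinP; exact: measurable_funM.
- by move=> x _; rewrite lee_fin mulr_ge0.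
- by apply: filterS wae => x wx Dx; have [->] := wx Dx; rewrite mulr0.
Qed.

Context (p : R) (dil : R -> R) (beta : R) (w v : Rn -> R).
Context (k : Rn -> Rn -> R) (T : (Rn -> R) -> Rn -> R) (omega : R -> R) (cn t : R).
Context (p1 : 1 < p).
Context (dil1 : forall alpha : R, 0 < alpha < 1 -> 1 < dil alpha).
Context (w0 : forall x, 0 <= w x) (mw : measurable_fun setT w).
Context (v0 : forall x, 0 <= v x) (mv : measurable_fun setT v).
Context (wv : Wp p dil beta w v).
Local Notation s := (density p v).

Let p0 : 0 < p. Proof. exact: lt_trans p1. Qed.
Let s0 x : 0 < s x. Proof. exact: density_gt0. Qed.
Let ms : measurable_fun setT s. Proof. exact: measurable_density. Qed.
Let sfin a l : (\int[mu]_(x in cube a l) (s x)%:E < +oo)%E.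
Proof. exact: (density_cube_fin v0 mv wv). Qed.

Lemma measurable_quotient (f : Rn -> R) : measurable_fun setT f ->
  measurable_fun setT (fun x => `|f x| / s x).
Proof.
move=> mf; apply: measurable_funM.
  exact: (measurableT_comp (@normr_measurable R setT)).
rewrite (_ : (fun x => _) = (fun x => s x `^ (-1))).
  exact: (measurableT_comp (measurable_powR _)).
by apply/funext => x; rewrite powR_inv1// ltW.
Qed.

(** [(|f| / s)^p s] equals [|f|^p s^(1-p)], which is [|f|^p v] almost everywhere. *)
Lemma dual_integral_le (f : Rn -> R) : measurable_fun setT f ->
  (\int[mu]_x ((`|f x| / s x) `^ p * s x)%:E <= \int[mu]_x (`|f x| `^ p * v x)%:E)%E.
Proof.
move=> mf; apply: ae_ge0_le_integral; [exact: measurableT| | | | |].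
- by move=> x _; rewrite lee_fin mulr_ge0 ?powR_ge0// ltW.
- apply/measurable_EFinP; apply: measurable_funM; last exact: ms.
  by apply: (measurableT_comp (measurable_powR p)); exact: measurable_quotient.
- by move=> x _; rewrite lee_fin mulr_ge0 ?powR_ge0.
- apply/measurable_EFinP; apply: measurable_funM; last exact: mv.
  apply: (measurableT_comp (measurable_powR p)).
  exact: (measurableT_comp (@normr_measurable R setT)).
have Z0 := lebn_weight_zero v0 mv wv.
exists [set x | v x = 0]; split; [exact: lebn_null_measurable|exact: Z0|].
move=> x /= hx; apply: contrapT => vx; apply: hx => _; rewrite lee_fin.
rewrite powRM ?invr_ge0 ?(ltW (s0 x))// -mulrA.
rewrite -[in leRHS](density_powR p1 v0 (x := x)); last exact/eqP.
apply: ler_wpM2l; first exact: powR_ge0.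
rewrite (powR_inv p (s0 x)) powRB ?(gt_eqF (s0 x)) ?implybT//.
by rewrite powRr1 ?(ltW (s0 x))// mulrC.
Qed.

Context (T_singular : singular_integral k T) (T_weak : weak_type11 T).
Context (cn_const : @cube_ratio_constant R n cn).
Context (omega_incr : forall x y : R, 0 < x -> x <= y -> omega x <= omega y).
Context (omega_dini : (\int[lebesgue_measure]_(tau in `]0%R, 1%R[)
                   (omega (cn * tau) / tau)%:E < +oo)%E).
Context (k_reg : kernel_regularity k omega).
Context (t01 : 0 < t < 1).

Theorem cube_bound : exists2 c : R, 0 < c &
  forall (a : Rn) (l : R) (f h : Rn -> R), 0 < l ->
    measurable_fun setT f -> pv_integral k f h ->
    (\int[mu]_(x in cube a l) (`|h x - median h t (cube a l)| `^ p * w x)%:E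
     <= c%:E * \int[mu]_x (`|f x| `^ p * v x)%:E)%E.
Proof.
have beta0 : 0 < beta by case: wv.
have [alpha [c0 [alpha01 c00 WS]]] := Wp_muckenhoupt p1 dil1 v0 mv w0 wv.
have [C1 C10 muck] := muckenhoupt_cell p0 beta0 alpha01 c00 w0 s0 mw ms sfin WS.
have [Cp Cp0 maxi] := dyadic_maximal n p1.
have [eta [eta0 eta1 eta_t eta_1t eta_beta]] := small_fraction n p beta0 t01.
have [K K0 locosc] := local_oscillation cn_const omega_incr k_reg omega_dini
  T_singular T_weak eta0.
(* Here 34 is the product of 17 = 16 + 1, from the distances of h and of the median
   to the central value, and of 2, lost when approximating the supremum. *)
set M := (34 * (K * (6 ^+ d * ratio n alpha))) `^ p * C1 * (1 - 2 * eta)^-1 `^ beta *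
  2 * #|{ffun 'I_d -> bool}|%:R.
have M0 : 0 <= M.
  apply: mulr_ge0 => //; apply: mulr_ge0 => //; apply: mulr_ge0; last exact: powR_ge0.
  by apply: mulr_ge0; [exact: powR_ge0|exact: ltW].
exists (M * Cp + 1); first by rewrite ltr_wpDl// mulr_ge0// ltW.
move=> a l f h l0 mf fh; have mh : measurable_fun setT h by case: fh.
set X := (\int[mu]_(x in _) _)%E; set Y := (\int[mu]_x _)%E.
have Y0 : (0 <= Y)%E by apply: integral_ge0 => x _; rewrite lee_fin mulr_ge0 ?powR_ge0.
have c_gt0 : 0 < M * Cp + 1 by rewrite ltr_wpDl// mulr_ge0// ltW.
have [Yoo|Yfin] := eqVneq Y +oo%E; first by rewrite Yoo gt0_muley ?lte_fin ?leey.
have Ylt : (Y < +oo)%E by rewrite ltey.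
have [W0|Wn0] := eqVneq (\int[mu]_(x in cube a l) (w x)%:E)%E 0%E.
  rewrite /X integral_null_weight ?mule_ge0 ?lee_fin ?(ltW c_gt0)//.
  - exact: measurable_cube.
  - apply: (measurableT_comp (measurable_powR p)).
    apply: (measurableT_comp (@normr_measurable R setT)).
    by apply: measurable_funB; [exact: mh|exact: measurable_cst].
have W0 : (0 < \int[mu]_(x in cube a l) (w x)%:E)%E.
  rewrite lt_neqAle eq_sym Wn0; apply: integral_ge0 => x _; by rewrite lee_fin.
suff main (del : R) : 0 < del -> (X <= M%:E * (del%:E + Cp%:E * (Y + del%:E)))%E.
  have Xle : (X <= M%:E * (Cp%:E * Y))%E.
    have Yn : Y \is a fin_num by rewrite ge0_fin_numE.
    pose y := fine Y; have YE : Y = y%:E by rewrite fineK.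
    rewrite YE -!EFinM; apply/lee_addgt0Pr => e e0.
    pose q := M * (1 + Cp) + 1; have q0 : 0 < q by rewrite ltr_wpDl// mulr_ge0// addr_ge0// ltW.
    apply: (le_trans (main (e / q) (divr_gt0 e0 q0))).
    rewrite YE -[(y%:E + _)%E]EFinD -[(Cp%:E * _)%E]EFinM -[((e / q)%:E + _)%E]EFinD.
    rewrite -EFinM -EFinD lee_fin.
    have -> : M * (e / q + Cp * (y + e / q)) = M * (Cp * y) + M * (1 + Cp) * (e / q).
      by ring.
    rewrite lerD2l mulrCA ler_piMr ?(ltW e0)// ler_pdivrMr// mul1r /q.
    by rewrite lerDl.
  apply: le_trans Xle _; rewrite muleA -EFinM; apply: lee_wpmul2r => //.
  by rewrite lee_fin lerDl.
move=> del0.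
have mQ : measurable (cube a l) by exact: measurable_cube.
have Is0 A : (0 <= \int[mu]_(x in A) (s x)%:E)%E.
  by apply: integral_ge0 => x _; rewrite lee_fin ltW.
have Isfin r : (\int[mu]_(x in cube a r) (s x)%:E)%E \is a fin_num by rewrite ge0_fin_numE.
have [eps eps0 epsd] := small_power p0 (fine_ge0 (Is0 (cube a l))) del0.
(* The function g s dominates |f| and has positive integral over the cube. *)
pose q x := `|f x| / s x; pose g x := Num.max (q x) (eps * \1_(cube a l) x).
have q0 x : 0 <= q x by apply: divr_ge0 => //; exact: ltW.
have mq : measurable_fun setT q by exact: measurable_quotient.
have g0 x : 0 <= g x by rewrite le_max q0.
have mg : measurable_fun setT g.
  apply: measurable_maxr; first exact: mq.
  by apply: measurable_funM; [exact: measurable_cst|exact: measurable_indic].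
have fg x : `|f x| <= g x * s x by rewrite -ler_pdivrMr// le_max lexx.
have mqp : measurable_fun setT (fun x => (q x `^ p * s x)%:E).
  apply/measurable_EFinP; apply: measurable_funM; last exact: ms.
  exact: (measurableT_comp (measurable_powR p)).
have mgp : measurable_fun setT (fun x => (g x `^ p * s x)%:E).
  apply/measurable_EFinP; apply: measurable_funM; last exact: ms.
  exact: (measurableT_comp (measurable_powR p)).
have mes : measurable_fun setT (fun x => (eps `^ p * s x)%:E).
  apply/measurable_EFinP; apply: measurable_funM; [exact: measurable_cst|exact: ms].
have gY : (\int[mu]_x (g x `^ p * s x)%:E <= Y + del%:E)%E.
  pose U := (fun x => (eps `^ p * s x)%:E) \_ (cube a l).
  have U0 x : (0 <= U x)%E.
    by apply: erestrict_ge0 => y _; rewrite lee_fin mulr_ge0 ?powR_ge0// ltW.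
  have mU : measurable_fun setT U.
    by apply/(measurable_restrictT _ mQ); exact: measurable_funTS.
  apply: (@le_trans _ _ (\int[mu]_x ((q x `^ p * s x)%:E + U x))%E).
    apply: ge0_le_integral; [exact: measurableT| |exact: mgp| |].
    - by move=> x _; rewrite lee_fin mulr_ge0 ?powR_ge0// ltW.
    - exact: emeasurable_funD.
    move=> x _; rewrite /g indicE; case: (leP (q x)) => hx; last first.
      by rewrite leeDl.
    rewrite /U patchE; case: ifPn hx => xQ hx.
      rewrite mulr1 -EFinD lee_fin lerDr mulr_ge0 ?powR_ge0//; exact: ltW.
    by rewrite mulr0 powR0 ?gt_eqF// mul0r adde0 lee_fin mulr_ge0 ?powR_ge0// ltW.
  rewrite ge0_integralD//; last by move=> x _; rewrite lee_fin mulr_ge0 ?powR_ge0// ltW.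
  apply: leeD; first exact: dual_integral_le.
  rewrite -integral_mkcond; under eq_integral do rewrite EFinM.
  rewrite ge0_integralZl//; last 3 first.
  - by apply: measurable_funTS; exact/measurable_EFinP.
  - by move=> x _; rewrite lee_fin ltW.
  - by rewrite lee_fin powR_ge0.
  by rewrite -(fineK (Isfin l)) -EFinM lee_fin.
have gfin : (\int[mu]_x (g x `^ p * s x)%:E < +oo)%E.
  by apply: le_lt_trans gY _; rewrite lte_add_pinfty// ltry.
have locF := local_integrability p1 s0 ms sfin g0 mg gfin.
have mgs : measurable_fun setT (fun x => (g x * s x)%:E).
  by apply/measurable_EFinP; exact: measurable_funM.
have gs0 x : (0 <= (g x * s x)%:E)%E by rewrite lee_fin mulr_ge0// ltW.
have I_gt0 : (0 < \int[mu]_(x in cube a l) (g x * s x)%:E)%E.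
  have es0 x : 0 < eps * s x by exact: mulr_gt0.
  have mes' : measurable_fun setT (fun x => eps * s x).
    by apply: measurable_funM; [exact: measurable_cst|exact: ms].
  have muQ : (0 < mu (cube a l))%E by rewrite lebn_cube ?(ltW l0)// lte_fin exprn_gt0.
  apply: lt_le_trans (integral_gt0 es0 mes' mQ muQ) _.
  apply: ge0_le_integral => //.
  - by move=> x _; rewrite lee_fin ltW.
  - by apply: measurable_funTS; exact/measurable_EFinP.
  - exact: measurable_funTS.
  move=> x xQ; rewrite lee_fin ler_pM2r// le_max indicE mem_set// mulr1 lexx orbT //.
have Ifin : (\int[mu]_(x in cube a l) (g x * s x)%:E)%E \is a fin_num.
  by rewrite ge0_fin_numE ?locF// ltW.
have l6 : 0 < (6 * l) ^+ d by rewrite exprn_gt0// mulr_gt0.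
pose Lam := fine (\int[mu]_(x in cube a l) (g x * s x)%:E)%E / (6 * l) ^+ d.
have Lam0 : 0 < Lam by rewrite divr_gt0// fine_gt0// I_gt0 locF.
have LamE : ((Lam * (6 * l) ^+ d)%:E <= \int[mu]_(x in cube a l) (g x * s x)%:E)%E.
  by rewrite /Lam divfK ?gt_eqF// fineK.
have kap0 : 0 < Lam / (2 * 3 ^+ d) by rewrite divr_gt0// mulr_gt0// exprn_gt0.
have [r0 r00 far] := averages_vanish p1 beta0 alpha01 c00 s0 ms sfin WS g0 mg gfin l0 kap0 W0.
(* Large enough for the cube to be trapped in the cells of side L, and for the decay
   of averages to hold from the scale 2 L / 3 on. *)
pose L := 4 * l + 2 * r0.
have lL : 4 * l <= L by rewrite lerDl mulr_ge0// ltW.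
have L0 : 0 < L by rewrite addr_gt0// mulr_gt0.
have tail r : 2 / 3 * L <= r ->
    (\int[mu]_(y in cube a r) (g y * s y)%:E <= (Lam / (2 * 3 ^+ d) * r ^+ d)%:E)%E.
  by move=> Lr; apply: far; move: Lr; rewrite /L; lra.
have [e e0 ed] := small_power p0 (fine_ge0 (Is0 (cube a (3 * L)))) del0.
have [Psi hPsi] := choice (fun u => maxi (shift_origin (corner a l) L u) L s g e L0 e0 s0 g0 ms mg sfin).
have osc c r G : 0 < r -> 0 < G -> dyadic_average_bound (fun x => g x * s x) c r G ->
    exists c1, (mu [set x | cube c r x /\ (K * G < `|h x - c1|)%R] <= (eta * r ^+ d)%:E)%E.
  move=> hr hG hF; apply: (locosc f h c r G hr hG mf fh) => m.
  apply: le_trans (hF m); apply: ge0_le_integral.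
  - exact: measurable_cube.
  - by move=> x _; rewrite lee_fin.
  - apply: measurable_funTS; apply/measurable_EFinP.
    exact: (measurableT_comp (@normr_measurable R setT)).
  - apply: measurable_funTS; apply/measurable_EFinP.
    by apply: (measurableT_comp (@normr_measurable R setT)); exact: measurable_funM.
  - by move=> x _; rewrite lee_fin (le_trans (fg x))// ler_norm.
have := @weighted_oscillation_bound R n p beta alpha C1 Cp K eta t w s p1 beta0 alpha01
  C10 Cp0 K0 eta0 eta1 eta_t eta_1t eta_beta w0 s0 mw ms sfin muck a l l0 h mh g mg g0
  e Psi gfin locF L Lam lL Lam0 LamE tail osc (fun u => let: And4 h _ _ _ := hPsi u in h)
  (fun u => let: And4 _ h _ _ := hPsi u in h)
  (fun u => let: And4 _ _ h _ := hPsi u in h)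
  (fun u => let: And4 _ _ _ h := hPsi u in h).
move=> /le_trans; apply; apply: lee_wpmul2l; first by rewrite lee_fin.
apply: leeD; first by rewrite -(fineK (Isfin (3 * L))) -EFinM lee_fin.
by apply: lee_wpmul2l; first by rewrite lee_fin ltW.
Qed.

End cube_bound.

(** * Passage to the whole space *)

Section power_limit.
Context (R : realType).

(** Away from 0 the power is differentiable; at 0 it is small by [small_power]. *)
Lemma cvg_norm_power (p : R) (u : nat -> R) (a : R) : 0 < p ->
  u @ \oo --> a -> (fun N => `|u N| `^ p) @ \oo --> `|a| `^ p.
Proof.
move=> p0 ua; have [a0|an0] := eqVneq a 0.
  rewrite a0 normr0 powR0 ?gt_eqF//; apply/cvgr0Pnorm_lt => e e0.
  have [r r0 re] := small_power p0 (@ler01 R) (divr_gt0 e0 (ltr0Sn R 1)).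
  rewrite a0 in ua; near=> N; rewrite ger0_norm ?powR_ge0//.
  apply: (@le_lt_trans _ _ (r `^ p)); last by move: re e0; lra.
  apply: (ge0_ler_powR (ltW p0)); rewrite ?nnegrE// ?(ltW r0)// ltW//.
  by near: N; exact: cvgr0_norm_lt.
have a_gt0 : 0 < `|a| by rewrite normr_gt0.
have := @is_derive1_powR R p `|a| a_gt0.
move=> /(@ex_derive _ _ _ _ _ _ _)/derivable1_diffP/differentiable_continuous cont.
exact: (cvg_comp _ _ (cvg_norm ua) cont).
Unshelve. all: by end_near.
Qed.

End power_limit.

Section limits.
Context (R : realType) (n : nat).
Local Notation Rn := 'rV[R]_n.+1.
Local Notation mu := (@lebn R n).

Lemma centred_cubes_expand :
  (fun N => (0 : Rn, N.+1%:R : R)) @ \oo --> (@expanding_cubes R n).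
Proof.
move=> A [r /= r0 rA].
have near_A : \forall N \near \oo, A (0, N.+1%:R); last exact: near_A.
near=> N; apply: rA; split; first exact: ltr0Sn.
apply: cube_le; apply: le_trans (_ : N%:R <= _); last by rewrite ler_nat.
by near: N; exact: nbhs_infty_ger.
Unshelve. all: by end_near.
Qed.

Lemma near_in_centred_cube (x : Rn) : \forall N \near \oo, cube 0 N.+1%:R x.
Proof.
near=> N => i; rewrite mxE subr0.
have h : \sum_j `|x 0 j| *+ 2 <= N%:R by near: N; exact: nbhs_infty_ger.
rewrite ler_pdivlMr// mulr_natr.
apply: (@le_trans _ _ N%:R); last by rewrite ler_nat.
apply: le_trans h; rewrite (bigD1 i)//= lerDl; apply: sumr_ge0 => j _.
exact: mulrn_wge0.
Unshelve. all: by end_near.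
Qed.

Lemma integral_from_centred_cubes (p : R) (h w : Rn -> R) (m : nat -> R) (Y : \bar R) :
  0 < p -> measurable_fun setT h -> measurable_fun setT w -> (forall x, 0 <= w x) ->
  m @ \oo --> (0 : R) ->
  (forall N, (\int[mu]_(x in cube 0 N.+1%:R) (`|h x - m N| `^ p * w x)%:E <= Y)%E) ->
  (\int[mu]_x (`|h x| `^ p * w x)%:E <= Y)%E.
Proof.
move=> p0 mh mw w0 m0 bound.
pose f N := (fun x => (`|h x - m N| `^ p * w x)%:E) \_ (cube 0 N.+1%:R).
have mf N : measurable_fun setT (f N).
  apply/(measurable_restrictT _ (measurable_cube _ _)); apply: measurable_funTS.
  apply/measurable_EFinP; apply: measurable_funM; last exact: mw.
  apply: (measurableT_comp (measurable_powR p)).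
  apply: (measurableT_comp (@normr_measurable R setT)).
  by apply: measurable_funB; [exact: mh|exact: measurable_cst].
have f0 N x : (0 <= f N x)%E.
  by apply: erestrict_ge0 => y _; rewrite lee_fin mulr_ge0 ?powR_ge0.
have lim x : f^~ x @ \oo --> (`|h x| `^ p * w x)%:E.
  apply: (@cvg_trans _ ((fun N => (`|h x - m N| `^ p * w x)%:E) @ \oo)).
    apply: near_eq_cvg; near=> N; rewrite /f patchE mem_set//.
    by near: N; exact: near_in_centred_cube.
  apply: cvg_EFin; first by near=> N.
  apply: cvgM; last exact: cvg_cst.
  apply: cvg_norm_power => //; rewrite -[X in _ --> X]subr0.
  by apply: cvgB; [exact: cvg_cst|exact: m0].
have -> : (\int[mu]_x (`|h x| `^ p * w x)%:E = \int[mu]_x limn_einf (f^~ x))%E.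
  apply: eq_integral => x _; rewrite is_cvg_limn_einfE; last by apply/cvg_ex; eexists; exact: lim.
  by apply/esym/cvg_lim => //; exact: lim.
apply: le_trans (fatou _ measurableT mf (fun N x _ => f0 N x)) _.
rewrite limn_einf_lim; apply: lime_le; first exact: is_cvg_einfs.
near=> N; apply: (@le_trans _ _ (\int[mu]_x f N x)%E).
  by apply: ereal_inf_lbound; exists N => //=.
by rewrite -integral_mkcond.
Unshelve. all: by end_near.
Qed.

End limits.

Theorem theorem6p3 (R : realType) (n : nat) (p : R) (dil : R -> R) (beta : R)
    (w v : 'rV[R]_n.+1 -> R) (k : 'rV[R]_n.+1 -> 'rV[R]_n.+1 -> R)
    (T : ('rV[R]_n.+1 -> R) -> 'rV[R]_n.+1 -> R)
    (omega : R -> R) (cn s t : R)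
  (p_gt1 : 1 < p)
  (dil_gt1 : forall alpha : R, 0 < alpha < 1 -> 1 < dil alpha)
  (dil_incr : forall alpha alpha' : R, 0 < alpha -> alpha <= alpha' -> alpha' < 1 ->
    dil alpha <= dil alpha')
  (w_weight : weight w) (v_weight : weight v)
  (wv_Wp : Wp p dil beta w v)
  (T_singular : singular_integral k T)
  (T_weak : weak_type11 T)
  (cn_const : @cube_ratio_constant R n cn)
  (omega_incr : forall x y : R, 0 < x -> x <= y -> omega x <= omega y)
  (omega_dini : (\int[lebesgue_measure]_(tau in `]0%R, 1%R[)
                   (omega (cn * tau) / tau)%:E < +oo)%E)
  (k_reg : kernel_regularity k omega)
  (s_bounds : 0 < s <= 2^-1)
  (t_bounds : 2^-1 < t < 1 - s)
  (st_beta : 2 `^ p * (s / (1 - t)) `^ beta < 1) :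
  exists2 c : R, 0 < c &
    (forall (a : 'rV[R]_n.+1) (l : R) (f : 'rV[R]_n.+1 -> R), 0 < l ->
       measurable_fun setT f -> [set x | f x != 0] `<=` cube a l ->
       (\int[@lebn R n]_(x in cube a l)
            (`|T f x - median (T f) t (cube a l)| `^ p * w x)%:E
        <= c%:E * \int[@lebn R n]_(x in cube a l) (`|f x| `^ p * v x)%:E)%E) /\
    (forall f : 'rV[R]_n.+1 -> R,
       measurable_fun setT f -> pv_integral k f (T f) ->
       median (T f) t (cube q.1 q.2) @[q --> expanding_cubes] --> (0 : R) ->
       (\int[@lebn R n]_x (`|T f x| `^ p * w x)%:E
        <= c%:E * \int[@lebn R n]_x (`|f x| `^ p * v x)%:E)%E).
Proof.
have [w0 mw _] := w_weight; have [v0 mv _] := v_weight.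
have [/andP[s0 s1] /andP[t0 t1]] := (s_bounds, t_bounds).
have t01 : 0 < t < 1 by apply/andP; split; lra.
have p0 : 0 < p by exact: lt_trans p_gt1.
have [c c0 bound] := cube_bound p_gt1 dil_gt1 w0 mw v0 mv wv_Wp T_singular T_weak
  cn_const omega_incr omega_dini k_reg t01.
exists c => //; split; last first.
  move=> f mf Tf med0; have mTf : measurable_fun setT (T f) by case: Tf.
  apply: (@integral_from_centred_cubes _ _ _ _ _
    (fun N => median (T f) t (cube 0 N.+1%:R))) => //.
    exact: (cvg_comp _ _ (@centred_cubes_expand R n) med0).
  by move=> N; apply: bound => //; exact: ltr0Sn.
move=> a l f l0 mf supp.
have mQ : measurable (cube a l) by exact: measurable_cube.
have f_off x : ~ cube a l x -> f x = 0.
  by move=> xQ; apply/eqP; apply/negPn/negP => fx; apply: xQ; exact: supp.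
have off_cube (F : 'rV[R]_n.+1 -> \bar R) : (forall x, ~ cube a l x -> F x = 0%E) ->
    (\int[@lebn R n]_x F x = \int[@lebn R n]_(x in cube a l) F x)%E.
  move=> F0; rewrite [RHS]integral_mkcond; apply: eq_integral => x _.
  by rewrite patchE; case: ifPn => // /negP xQ; apply: F0 => /mem_set.
have YE : (\int[@lebn R n]_x (`|f x| `^ p * v x)%:E =
    \int[@lebn R n]_(x in cube a l) (`|f x| `^ p * v x)%:E)%E.
  by apply: off_cube => x /f_off ->; rewrite normr0 powR0 ?gt_eqF// mul0r.
have [Yoo|Yfin] := eqVneq (\int[@lebn R n]_(x in cube a l) (`|f x| `^ p * v x)%:E)%E +oo%E.
  by rewrite Yoo gt0_muley ?lte_fin ?leey.
have sf0 x : 0 < density p v x by exact: density_gt0.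
have msf : measurable_fun setT (density p v) by exact: measurable_density.
have f_loc : (\int[@lebn R n]_(x in cube a l) `|f x|%:E < +oo)%E.
  have gfin : (\int[@lebn R n]_x ((`|f x| / density p v x) `^ p * density p v x)%:E < +oo)%E.
    apply: le_lt_trans (dual_integral_le p_gt1 v0 mv wv_Wp mf) _.
    by rewrite YE ltey.
  have := local_integrability p_gt1 sf0 msf (density_cube_fin v0 mv wv_Wp) _ _ gfin a l.
  under [X in _ -> (X < _)%E]eq_integral => x _.
    rewrite -(divfK (lt0r_neq0 (sf0 x)) `|f x|); over.
  apply; first by move=> x; rewrite divr_ge0// ltW.
  exact: measurable_quotient.
have f_int : (@lebn R n).-integrable setT (EFin \o f).
  apply/integrableP; split; first exact/measurable_EFinP.
  rewrite off_cube//; last by move=> x /f_off /= ->; rewrite normr0.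
by rewrite -YE; apply: bound => //; exact: T_singular.
Qed.
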